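(* Let $X:M \to \mathbb{R}^3_1$ be a conformal proper maximal immersion of a Riemann surface $M$ with $\partial(M)\neq\emptyset$ (where $\partial(M)$ may contain singular points), and suppose that $S:=X(M)$ is a graph over a closed starlike region $\Omega\subset\{x_3=0\}\equiv\mathbb{C}$ centered at $(\pi_0\circ X)(p_0)$, where $p_0\in\mathrm{Int}(M)$. Then $M$ is relative parabolic.
   Context: $\mathbb{R}^3_1$ denotes the Lorentz-Minkowski space: $\mathbb{R}^3$ with the metric $\langle\,,\rangle = dx_1^2+dx_2^2-dx_3^2$. $\pi_0:\mathbb{R}^3\to\{x_3=0\}$ is the orthogonal projection $(x_1,x_2,x_3)\mapsto(x_1,x_2,0)$. A region is starlike centered at a point $c$ of it if it contains the segment from $c$ to each of its points. $S$ is a graph over $\Omega$ if $S=\{(z,u(z)) : z\in\Omega\}$ for a function $u:\Omega\to\mathbb{R}$. Surfaces with boundary. Riemann surfaces are connected. A Riemann surface $M$ with $\partial(M)\neq\emptyset$ is assumed to satisfy $M\subseteq M'$ for an open Riemann surface $M'$; $\partial(M)\subset M$ is the topological frontier of $M$ in $M'$ and consists of a proper (without accumulation) family of pairwise disjoint closed curves in $M'$, at least piecewise $\mathcal{C}^1$ (closed as subsets of $M'$), some of which may be degenerate, i.e. isolated points. $\mathrm{Int}(M)=M-\partial(M)$. Maps on $M$ are called smooth (conformal, harmonic, meromorphic, ...) if they are restrictions of such maps on $M'$. Maximal immersions. A smooth map $X:M\to\mathbb{R}^3_1$ is spacelike if the metric induced from $\langle\,,\rangle$ is Riemannian at every point of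 $\mathrm{Int}(M)$. A conformal map $X:M\to\mathbb{R}^3_1$ is a (conformal) maximal immersion if it is spacelike and $X|_{\mathrm{Int}(M)}$ has zero mean curvature. A point of $\partial(M)$ is singular if the tangent plane there with the induced metric is not Riemannian; such points are allowed (in particular, $X$ may map a whole singular loop of $\partial(M)$ to a single point). The Weierstrass data of $X$ are assumed to extend meromorphically beyond $\partial(M)$. Relative parabolicity. A Riemann surface $R$ with $\partial(R)\neq\emptyset$ is relative parabolic if the only bounded harmonic function $f$ on $R$ vanishing on $\partial(R)$ is $f=0$. *)

(* Defs.v *)
From HB Require Import structures.
From mathcomp Require Import all_boot all_order all_algebra.
From mathcomp Require Import complex.
From mathcomp Require Import all_classical all_reals all_analysis.

Set Implicit Arguments.
Unset Strict Implicit.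
Unset Printing Implicit Defensive.

Import Order.TTheory GRing.Theory Num.Theory.
Import numFieldNormedType.Exports.

Local Open Scope classical_set_scope.
Local Open Scope complex_scope.
Local Open Scope ring_scope.

(* [R[i]^o] is the complex line as a normed space over [R[i]]: its topology is
   that of the modulus, and [derivable f z 1] is complex differentiability. *)
Notation Cplx R := (R[i]^o).

Section Charts.
Context {R : realType} {T : topologicalType}.

(* [coord] and [param] are total; they are only meaningful on [cdom] and on its
   image [cimg], where they are mutually inverse (see [riemann_surface]). *)
Record chart := Chart {
  cdom : set T;
  coord : T -> Cplx R;
  param : Cplx R -> T }.

Definition cimg (c : chart) : set (Cplx R) := coord c @` cdom c.

Definition transition (c d : chart) : Cplx R -> Cplx R :=
  fun z => coord d (param c z).

End Charts.
Arguments chart : clear implicits.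

Record riemann_surface (R : realType) (T : topologicalType) := RiemannSurface {
  atlas : set (chart R T);
  atlas_cover : forall p, exists2 c, atlas c & cdom c p;
  cdom_open : forall c, atlas c -> open (cdom c);
  cimg_open : forall c, atlas c -> open (cimg c);
  coordK : forall c, atlas c ->
    forall p, cdom c p -> param c (coord c p) = p;
  coord_continuous : forall c, atlas c ->
    forall p, cdom c p -> {for p, continuous (coord c)};
  param_continuous : forall c, atlas c ->
    forall z, cimg c z -> {for z, continuous (param c)};
  transition_holomorphic : forall c d, atlas c -> atlas d ->
    forall p, cdom c p -> cdom d p -> derivable (transition c d) (coord c p) 1;
  surface_hausdorff : hausdorff_space T;
  surface_second_countable : @second_countable T;
  surface_connected : connected [set: T] }.

Section RealCalculus.
Context {R : realType}.

(* Partial derivatives of a function of z = x + iy: in the direction x for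
   [false], in the direction y for [true]. *)
Definition step (b : bool) (t : R) : Cplx R :=
  if b then 0 +i* t else t +i* 0.

Definition slice (b : bool) (f : Cplx R -> R) (z : Cplx R) : R -> R :=
  fun t => f (z + step b t).

Definition partial (b : bool) (f : Cplx R -> R) : Cplx R -> R :=
  fun z => derive1 (slice b f z) 0.

Definition dx := partial false.
Definition dy := partial true.

Definition partials (s : seq bool) (f : Cplx R -> R) : Cplx R -> R :=
  foldr partial f s.

Definition Ck_on (k : nat) (V : set (Cplx R)) (f : Cplx R -> R) : Prop :=
  forall z, V z -> forall s : seq bool, (size s <= k)%N ->
    {for z, continuous (partials s f)} /\
    ((size s < k)%N -> forall b, derivable (slice b (partials s f) z) 0 1).

End RealCalculus.

Section OnSurfaces.
Context {R : realType} {T : topologicalType} (S : riemann_surface R T).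

Definition Ck_surface (k : nat) (U : set T) (f : T -> R) : Prop :=
  forall c, atlas S c ->
    Ck_on k (coord c @` (cdom c `&` U)) (f \o param c).

Definition harmonic_surface (U : set T) (f : T -> R) : Prop :=
  Ck_surface 2 U f /\
  forall c, atlas S c -> forall p, U p -> cdom c p ->
    dx (dx (f \o param c)) (coord c p) + dy (dy (f \o param c)) (coord c p) = 0.

(* C^1 on a one-sided punctured neighbourhood of t, with a limit of the
   derivative at t, for F = t^'+ or t^'-. *)
Definition C1_side (h : R -> R) (F : set_system R) : Prop :=
  (\forall s \near F, derivable h s 1 /\ {for s, continuous (derive1 h)}) /\
  cvg (derive1 h @ F).

Definition C1_both_sides (h : R -> R) (t : R) : Prop :=
  C1_side h t^'+ /\ C1_side h t^'-.

(* Requiring both one-sided conditions at every parameter forces the corners to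
   be isolated, hence locally finite. *)
Definition piecewise_C1 (g : R -> T) : Prop :=
  continuous g /\
  forall t c, atlas S c -> cdom c (g t) ->
    C1_both_sides (fun s => complex.Re (coord c (g s))) t /\
    C1_both_sides (fun s => complex.Im (coord c (g s))) t.

Definition loop_curve (C : set T) : Prop := exists g : R -> T,
  [/\ piecewise_C1 g, forall t, g (t + 1) = g t,
      set_inj `[0, 1[ g & C = range g].

(* A non-compact simple curve, closed in the surface: properness says that both
   ends leave every compact set. *)
Definition line_curve (C : set T) : Prop := exists g : R -> T,
  [/\ piecewise_C1 g, set_inj [set: R] g,
      forall K : set T, compact K -> compact (g @^-1` K) & C = range g].

Definition nondegenerate_curve (C : set T) : Prop :=
  loop_curve C \/ line_curve C.

Definition degenerate_curve (C : set T) : Prop := exists q : T, C = [set q].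

Definition frontier (A : set T) : set T := closure A `\` A°.

(* The boundary is a separate datum [dM], because its degenerate components are
   not determined by the set [M]: an isolated point of the boundary has a
   neighbourhood contained in [M], so it lies on the frontier of the interior
   [M `\` dM] but not on that of [M]. *)
Definition surface_with_boundary (M dM : set T) : Prop :=
  [/\ connected M, dM `<=` M, dM = frontier (M `\` dM) &
    exists F : set (set T),
      [/\ dM = \bigcup_(C in F) C,
          forall C D, F C -> F D -> C `&` D !=set0 -> C = D,
          forall K, compact K -> finite_set [set C | F C /\ C `&` K !=set0] &
          forall C, F C -> degenerate_curve C \/
            (nondegenerate_curve C /\ C `<=` frontier M)]].

(* Functions harmonic on a surface with boundary are continuous up to the
   boundary and harmonic inside. This includes the restrictions to [M] of
   functions harmonic on a neighbourhood of [M], and does not depend on the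
   ambient surface. *)
Definition relative_parabolic (M dM : set T) : Prop :=
  forall f : T -> R,
    {within M, continuous f} ->
    harmonic_surface (M `\` dM) f ->
    (exists B : R, forall p, M p -> `|f p| <= B) ->
    (forall p, dM p -> f p = 0) ->
    forall p, M p -> f p = 0.

End OnSurfaces.

Section Lorentz.
Context {R : realType}.

Definition lorentz (v w : 'rV[R]_3) : R :=
  v 0 0 * w 0 0 + v 0 1 * w 0 1 - v 0 2 * w 0 2.

(* The vector orthogonal to v and w with <lcross v w, n> = det (v, w, n). *)
Definition lcross (v w : 'rV[R]_3) : 'rV[R]_3 :=
  \row_(j < 3)
    if j == 0 then v 0 1 * w 0 2 - v 0 2 * w 0 1
    else if j == 1 then v 0 2 * w 0 0 - v 0 0 * w 0 2
    else - (v 0 0 * w 0 1 - v 0 1 * w 0 0).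

(* The projection (x1, x2, x3) |-> (x1, x2, 0), with the plane x3 = 0
   identified with C. *)
Definition pi0 (v : 'rV[R]_3) : Cplx R := (v 0 0) +i* (v 0 1).

Definition space_point (z : Cplx R) (h : R) : 'rV[R]_3 :=
  \row_(j < 3) if j == 0 then complex.Re z else if j == 1 then complex.Im z else h.

Definition graph_over (Sigma : set 'rV[R]_3) (Omega : set (Cplx R)) : Prop :=
  exists u : Cplx R -> R, Sigma = [set space_point z (u z) | z in Omega].

Definition starlike (c : Cplx R) (Omega : set (Cplx R)) : Prop :=
  Omega c /\
  forall z, Omega z -> forall t : R, 0 <= t <= 1 ->
    Omega ((1 - t)%:C * c + t%:C * z).

End Lorentz.

Section MaximalImmersions.
Context {R : realType} {T : topologicalType} (S : riemann_surface R T).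
Implicit Types (X : T -> 'rV[R]_3) (c : chart R T) (z : Cplx R).

Definition component X (j : 'I_3) : T -> R := fun p => X p 0 j.

Definition dX (s : seq bool) X c z : 'rV[R]_3 :=
  \row_(j < 3) partials s (component X j \o param c) z.

Notation Xx := (dX [:: false]).
Notation Xy := (dX [:: true]).

Definition spacelike_at X c z : Prop :=
  forall a b : R, (a, b) != (0, 0) ->
    0 < lorentz (a *: Xx X c z + b *: Xy X c z) (a *: Xx X c z + b *: Xy X c z).

Definition conformal_at X c z : Prop :=
  lorentz (Xx X c z) (Xx X c z) = lorentz (Xy X c z) (Xy X c z) /\
  lorentz (Xx X c z) (Xy X c z) = 0.

(* For spacelike X the cross product is timelike, whence the sign. *)
Definition unit_normal X c z : 'rV[R]_3 :=
  let n := lcross (Xx X c z) (Xy X c z) in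
  (Num.sqrt (- lorentz n n))^-1 *: n.

(* Half the trace of the second fundamental form (e, f, g) with respect to the
   first (E, F, G). *)
Definition mean_curvature X c z : R :=
  let N := unit_normal X c z in
  let E := lorentz (Xx X c z) (Xx X c z) in
  let F := lorentz (Xx X c z) (Xy X c z) in
  let G := lorentz (Xy X c z) (Xy X c z) in
  let e := lorentz (dX [:: false; false] X c z) N in
  let f := lorentz (dX [:: false; true] X c z) N in
  let g := lorentz (dX [:: true; true] X c z) N in
  (e * G - 2 * f * F + g * E) / (2 * (E * G - F ^+ 2)).

Definition meromorphic_at (f : Cplx R -> Cplx R) z : Prop :=
  exists (n : nat) (g : Cplx R -> Cplx R),
    (\forall w \near z, derivable g w 1) /\
    (\forall w \near z^', f w = g w / (w - z) ^+ n).

(* [om c] is the coefficient f of the 1-form f(z) dz in the chart [c]; its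
   values at poles are irrelevant. *)
Definition meromorphic_form (U : set T)
    (om : chart R T -> Cplx R -> Cplx R) : Prop :=
  (forall c, atlas S c -> forall p, U p -> cdom c p ->
    meromorphic_at (om c) (coord c p)) /\
  (forall c d, atlas S c -> atlas S d ->
    forall p, U p -> cdom c p -> cdom d p ->
      \forall w \near (coord c p)^',
        om c w = om d (transition c d w) * 'D_1 (transition c d) w).

(* Coefficient of phi_j, where X = Re \int (phi_1, phi_2, phi_3), that is
   phi_j = 2 (d X_j / d z) dz. In terms of the Gauss map g,
   phi_1 = (i/2) (1/g - g) phi_3, phi_2 = -(1/2) (1/g + g) phi_3 and
   g = i phi_3 / (phi_1 - i phi_2). *)
Definition weierstrass_coef X (j : 'I_3) c z : Cplx R :=
  dx (component X j \o param c) z +i* (- dy (component X j \o param c) z).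

Definition weierstrass_extends (M dM : set T) X : Prop :=
  exists U : set T, [/\ open U, M `<=` U &
    forall j : 'I_3, exists om, meromorphic_form U om /\
      forall c, atlas S c -> forall p, (M `\` dM) p -> cdom c p ->
        om c (coord c p) = weierstrass_coef X j c (coord c p)].

(* X is smooth and conformal beyond the boundary, the induced metric being
   allowed to degenerate at points of [dM]. *)
Definition conformal_maximal_immersion (M dM : set T) X : Prop :=
  [/\ exists U : set T, [/\ open U, M `<=` U,
        forall j k, Ck_surface S k U (component X j) &
        forall c, atlas S c -> forall p, U p -> cdom c p ->
          conformal_at X c (coord c p)],
      forall c, atlas S c -> forall p, (M `\` dM) p -> cdom c p ->
        spacelike_at X c (coord c p),
      forall c, atlas S c -> forall p, (M `\` dM) p -> cdom c p ->
        mean_curvature X c (coord c p) = 0 &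
      weierstrass_extends M dM X].

Definition proper_on (M : set T) X : Prop :=
  forall K : set 'rV[R]_3, compact K -> compact (M `&` X @^-1` K).

End MaximalImmersions.

(* Main.v *)
Require Import Defs.
From mathcomp Require Import all_boot all_order all_algebra.
From mathcomp Require Import complex.
From mathcomp Require Import all_classical all_reals all_analysis.
From mathcomp Require Import ring lra zify.
Import Defs.

(** Let [p0] project to the origin, let [x] be [X - X p0], let [u] be the
    function whose graph is [X(M)], and let [|z|] be the distance to the origin
    in the plane. The theorem follows from the cone estimate
<<
      |x3| <= |z| - eps r   on M outside the disc of radius r,
>>
    by a barrier argument. The coordinates of a maximal immersion are harmonic
    ([meromorphic_gradient_harmonic]), so that the Laplacian of [f = <x, x>] is
    [4 la], where [la] is the conformal factor, while the square of its gradient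
    is at least [4 la f] where [f > 0]; hence [phi = log (1 + log f - log f0)]
    is strictly superharmonic ([log_log_superharmonic]). By the cone estimate
    [f >= eps r |z|] outside the disc, which makes [phi] proper there. If [F]
    is bounded and harmonic and vanishes on the boundary, then [F - e phi] is
    negative at infinity and has no positive local maximum outside the closed
    disc; as [e] is arbitrary, a positive supremum of [F] is attained in the
    compact part of [M] that lies over the disc. This is excluded by the strong
    maximum principle, [M] being connected with a nonempty boundary
    ([bounded_harmonic_le0]).

    The cone estimate has two parts. Near the origin [|x3| <= (1 - eps) |z|]
    because the metric is definite at [p0], where the projection is open
    ([cone_estimate_near]). Further away it suffices that [u] be 1-Lipschitz
    along the segments issued from the origin, which lie in [Omega]. Where the
    metric is definite, the chords from a point to the nearby ones are spacelike
    ([spacelike_expansion]), which is the local estimate. On the boundary the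
    metric may degenerate, and [u] is not even known to be continuous; only its
    graph is closed, since [X] is proper. The boundary points that matter are
    those with timelike chords arbitrarily close to them. As [X] is conformal on
    a neighbourhood of [M], its differential there has rank at most one, so a
    weak form of Sard's theorem ([sard_nowhere_dense], [bad_values_local]) shows
    that the pairs formed by the slope [x2 / x1] and [x3 + s x1] take only a
    nowhere dense set of values there. By the theorem of Kuratowski and Ulam
    ([nowhere_dense_sections]), along the rays of generic slope these points are
    seen only through a set with empty interior of values of [x3 + s x1] and
    [x3 - s x1], for some [s] just above the expected Lipschitz constant. A
    function of one variable with a closed graph and the local estimate outside
    such a set of values is Lipschitz, by Baire's theorem ([closed_graph_lip]).
    The estimate passes from the generic rays to all points because the
    projection is open on the dense interior of [M] ([projection_open],
    [cone_estimate]). *)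

Set Implicit Arguments.
Unset Strict Implicit.
Unset Printing Implicit Defensive.

Import Order.TTheory GRing.Theory Num.Theory.
Import numFieldNormedType.Exports.

Local Open Scope classical_set_scope.
Local Open Scope ring_scope.

(** * Second-order jets of functions of one real variable *)

Section RealLine.
Context {R : realType}.
Implicit Types (f g dg : R -> R).

Lemma near_absP (x : R) (P : set R) :
  (\forall t \near x, P t) <->
  exists2 e : R, 0 < e & forall t, `|t - x| < e -> P t.
Proof.
split=> [/nbhs_ballP[e /= e0 xe]|[e e0 xe]].
  by exists e => // t xt; apply: xe; rewrite /ball/= distrC.
by apply/nbhs_ballP; exists e => //= t; rewrite /ball/= distrC; exact: xe.
Qed.

Lemma near0P (P : set R) :
  (\forall t \near (0 : R), P t) <->
  exists2 e : R, 0 < e & forall t, `|t| < e -> P t.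
Proof.
split=> [/near_absP[e e0 xe]|[e e0 xe]].
  by exists e => // t te; apply: xe; rewrite subr0.
by apply/near_absP; exists e => // t; rewrite subr0; exact: xe.
Qed.

Lemma is_derive_continuous g (x a : R) : is_derive x 1 g a ->
  {for x, continuous g}.
Proof. by move=> [gx _]; exact/differentiable_continuous/derivable1_diffP. Qed.

Lemma continuous_dist (T : topologicalType) (g : T -> R) (x : T) (e : R) :
  {for x, continuous g} -> 0 < e ->
  \forall t \near x, `|g t - g x| < e.
Proof.
move=> /cvgrPdist_lt gx e0; near=> t; rewrite distrC.
by near: t; exact: gx.
Unshelve. all: by end_near. Qed.

Lemma mean_value g dg (t : R) :
  (forall s : R, `|s| <= `|t| -> is_derive s 1 g (dg s)) ->
  exists2 s, `|s| <= `|t| & g t - g 0 = dg s * t.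
Proof.
have mvt (a b : R) : a <= b ->
    (forall s : R, s \in `[a, b] -> is_derive s 1 g (dg s)) ->
    exists2 s, s \in `[a, b] & g b - g a = dg s * (b - a).
  move=> ab gd.
  have cg : {within `[a, b], continuous g}.
    by apply: derivable_within_continuous => s si; have [] := gd s si.
  have go (s : R) : s \in `]a, b[ -> is_derive s 1 g (dg s).
    move=> si; apply: (gd s); exact: subset_itv_oo_cc si.
  exact: (MVT_segment ab go cg).
move=> gd; have [t0|t0] := leP 0 t.
  have tE : `|t| = t by rewrite ger0_norm.
  have [|s] := mvt 0 t t0.
    by move=> s; rewrite in_itv/= => /andP[s0 st]; apply: (gd s); rewrite ger0_norm// tE.
  rewrite in_itv/= subr0 => /andP[s0 st] E.
  by exists s => //; rewrite ger0_norm// tE.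
have tE : `|t| = - t by rewrite ltr0_norm.
have [|s] := mvt t 0 (ltW t0).
  by move=> s; rewrite in_itv/= => /andP[s0 st]; apply: (gd s); rewrite ler0_norm// tE lerN2.
rewrite in_itv/= sub0r => /andP[s0 st] E.
exists s; first by rewrite ler0_norm// tE lerN2.
by rewrite -opprB E mulrN opprK.
Qed.

(** [jet2 g a b]: [g] is differentiable near 0, with [g'(0) = a], and its
    derivative is differentiable at 0, with [g''(0) = b]. *)
Definition jet2 g (a b : R) : Prop := exists dg,
  [/\ \forall t \near (0 : R), is_derive (t : R) 1 g (dg t), dg 0 = a &
      is_derive (0 : R) 1 dg b].

Lemma jet2_derive g a b : jet2 g a b -> is_derive (0 : R) 1 g a.
Proof. by move=> [dg [/nbhs_singleton + <-]]. Qed.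

Lemma jet2_cst (c : R) : jet2 (fun=> c) 0 0.
Proof.
exists (fun=> 0); split => //; last exact: is_derive_cst.
by near=> t; exact: is_derive_cst.
Unshelve. all: by end_near. Qed.

Lemma jet2D g1 g2 a1 a2 b1 b2 : jet2 g1 a1 b1 -> jet2 g2 a2 b2 ->
  jet2 (fun t => g1 t + g2 t) (a1 + a2) (b1 + b2).
Proof.
move=> [d1 [n1 <- e1]] [d2 [n2 <- e2]]; exists (fun t => d1 t + d2 t).
split => //; last exact: is_deriveD.
by near=> t; apply: is_deriveD; near: t.
Unshelve. all: by end_near. Qed.

Lemma jet2M g1 g2 a1 a2 b1 b2 : jet2 g1 a1 b1 -> jet2 g2 a2 b2 ->
  jet2 (fun t => g1 t * g2 t) (g1 0 * a2 + g2 0 * a1)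
       (g1 0 * b2 + g2 0 * b1 + 2 * a1 * a2).
Proof.
move=> j1 j2; have D1 := jet2_derive j1; have D2 := jet2_derive j2.
case: j1 => [d1 [n1 E1 e1]]; case: j2 => [d2 [n2 E2 e2]].
exists (fun t => g1 t * d2 t + g2 t * d1 t); split.
- near=> t; have -> : g1 t * d2 t + g2 t * d1 t = g1 t *: d2 t + g2 t *: d1 t by [].
  by apply: is_deriveM; near: t.
- by rewrite E1 E2.
- have h1 : is_derive (0 : R) 1 (fun t => g1 t * d2 t) (g1 0 *: b2 + d2 0 *: a1).
    exact: is_deriveM.
  have h2 : is_derive (0 : R) 1 (fun t => g2 t * d1 t) (g2 0 *: b1 + d1 0 *: a2).
    exact: is_deriveM.
  apply: is_derive_eq (is_deriveD h1 h2) _.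
  by rewrite E1 E2 /GRing.scale/=; ring.
Unshelve. all: by end_near. Qed.

Lemma jet2Z c g a b : jet2 g a b -> jet2 (fun t => c * g t) (c * a) (c * b).
Proof.
by move=> /(jet2M (jet2_cst c)); congr (jet2 _ _ _); ring.
Qed.

Lemma jet2_near g1 g2 a b : (\forall t \near (0 : R), g1 t = g2 t) ->
  jet2 g1 a b -> jet2 g2 a b.
Proof.
move=> /near0P[e1 e10 E] [dg [/near0P[e2 e20 nd] dg0 dd]].
exists dg; split => //; apply/near0P; exists (Num.min e1 e2).
  by rewrite lt_min e10.
move=> t; rewrite lt_min => /andP[t1 t2].
apply: (near_eq_is_derive (f := g1)).
  apply/near_absP; exists (e1 - `|t|); first by rewrite subr_gt0.
  move=> s st; apply/E; rewrite -[s](subrK t) (le_lt_trans (ler_normD _ _))//.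
  by rewrite -ltrBrDr.
exact: nd.
Qed.

(** The chain rule to second order. *)
Lemma jet2_comp (h dh : R -> R) c g a b : jet2 g a b ->
  (\forall x \near g 0, is_derive (x : R) 1 h (dh x)) -> is_derive (g 0) 1 dh c ->
  jet2 (fun t => h (g t)) (dh (g 0) * a) (c * a ^+ 2 + dh (g 0) * b).
Proof.
move=> jg hd dhd; have D := jet2_derive jg.
case: jg => [dg [n E e]].
have gc := is_derive_continuous D.
exists (fun t => dh (g t) * dg t); split; last 1 first.
- have h1 : is_derive (0 : R) 1 (dh \o g) (c * a) by exact: is_derive1_comp.
  apply: is_derive_eq (is_deriveM h1 e) _.
  by rewrite E /GRing.scale/=; ring.
- have /gc hg := hd.
  near=> t; apply: is_derive1_comp; last by near: t.
  by near: t; exact: hg.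
- by rewrite E.
Unshelve. all: by end_near. Qed.

Lemma jet2V g a b : jet2 g a b -> 0 < g 0 ->
  jet2 (fun t => (g t)^-1) (- (a / g 0 ^+ 2))
       (2 * a ^+ 2 / g 0 ^+ 3 - b / g 0 ^+ 2).
Proof.
move=> jg g0; have gn : g 0 != 0 by rewrite gt_eqF.
have Vd (x : R) : x != 0 -> is_derive x 1 (fun y : R => y^-1) (- (x * x)^-1).
  move=> x0; have := @is_deriveV R id x 1 1 x0 (is_derive_id _ _).
  by rewrite [_ *: _]mulr1 expr2.
have := @jet2_comp (fun y => y^-1) (fun y => - (y * y)^-1) (2 * g 0 ^- 3) _ _ _ jg.
move=> H; have {}H := H _ _.
suff : jet2 (fun t => (g t)^-1) (- (g 0 * g 0)^-1 * a)
   (2 * g 0 ^- 3 * a ^+ 2 + - (g 0 * g 0)^-1 * b).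
  by congr (jet2 _ _ _); field.
apply: H.
  near=> x; apply: Vd; rewrite gt_eqF//; near: x; exact: lt_nbhsr.
have M : is_derive (g 0) 1 (fun y : R => y * y) (g 0 *: 1 + g 0 *: 1).
  by apply: is_deriveM; exact: is_derive_id.
have n2 : g 0 * g 0 != 0 by rewrite mulf_neq0.
have M' := @is_deriveV R (fun y : R => y * y) _ _ _ n2 M.
apply: is_derive_eq (is_deriveN M') _.
by rewrite /GRing.scale/=; field.
Unshelve. all: by end_near. Qed.

Lemma jet2_ln g a b : jet2 g a b -> 0 < g 0 ->
  jet2 (fun t => ln (g t)) (a / g 0) (b / g 0 - (a / g 0) ^+ 2).
Proof.
move=> jg g0; have gn : g 0 != 0 by rewrite gt_eqF.
suff : jet2 (fun t => ln (g t)) ((g 0)^-1 * a)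
   (- (g 0) ^- 2 * a ^+ 2 + (g 0)^-1 * b).
  by congr (jet2 _ _ _); field.
apply: (@jet2_comp _ (fun y => y^-1)) => //.
  near=> x; apply: is_derive1_ln; near: x; exact: lt_nbhsr.
have := @is_deriveV R id (g 0) 1 1 gn (is_derive_id _ _).
by rewrite [_ *: _]mulr1.
Unshelve. all: by end_near. Qed.

Lemma jet2_local_min_slope g a b : jet2 g a b ->
  (\forall t \near (0 : R), g 0 <= g t) -> a = 0.
Proof.
move=> [dg [nd dg0 _]] mx.
have [e e0 He] := proj1 (near0P _) nd; have [e' e'0 He'] := proj1 (near0P _) mx.
have D0 : is_derive (0 : R) 1 g 0.
  have m0 : 0 < Num.min e e' by rewrite lt_min e0.
  apply: (@derive1_at_min _ g (- Num.min e e') (Num.min e e')).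
  - by rewrite ge0_cp// ltW.
  - move=> t; rewrite in_itv/= -ltr_norml lt_min => /andP[te _].
    by have [] := He t te.
  - by rewrite in_itv/= m0 oppr_lt0 m0.
  - by move=> t; rewrite in_itv/= -ltr_norml lt_min => /andP[_ /He'].
by rewrite -dg0; have := He 0; rewrite normr0 => /(_ e0)[_ <-]; case: D0.
Qed.

(** The second derivative test at a local maximum. *)
Lemma jet2_local_max g a b : jet2 g a b ->
  (\forall t \near (0 : R), g t <= g 0) -> b <= 0.
Proof.
move=> [dg [nd _ dd]] mx; rewrite leNgt; apply/negP => b0.
have [e e0 He] := proj1 (near0P _) nd; have [e' e'0 He'] := proj1 (near0P _) mx.
have D0 : is_derive (0 : R) 1 g 0.
  have m0 : 0 < Num.min e e' by rewrite lt_min e0.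
  apply: (@derive1_at_max _ g (- Num.min e e') (Num.min e e')).
  - by rewrite ge0_cp// ltW.
  - move=> t; rewrite in_itv/= -ltr_norml lt_min => /andP[te _].
    by have [] := He t te.
  - by rewrite in_itv/= m0 oppr_lt0 m0.
  - by move=> t; rewrite in_itv/= -ltr_norml lt_min => /andP[_ /He'].
have dg0 : dg 0 = 0.
  have := He 0; rewrite normr0 => /(_ e0)[_ <-]; by case: D0.
have [h [hE hc h0]] := proj1 (is_derive1_caratheodory _ _ _) dd.
have /near0P[d d0 Hd] : \forall t \near (0 : R), 0 < h t.
  have : \forall y \near h 0, 0 < y by rewrite h0; exact: lt_nbhsr.
  by move/hc.
pose t := Num.min d (Num.min e e') / 2.
have m0 : 0 < Num.min d (Num.min e e') by rewrite !lt_min d0 e0.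
have t0 : 0 < t by rewrite divr_gt0.
have : `|t| < Num.min d (Num.min e e') by rewrite gtr0_norm// ltr_pdivrMr//; lra.
rewrite !lt_min => /and3P[td te te'].
have cE (s : R) : s \in `[0, t] -> is_derive s 1 g (dg s).
  rewrite in_itv/= => /andP[s0 st]; apply: (He s).
  by rewrite (le_lt_trans _ te)// ger0_norm// ger0_norm// ltW.
have cg : {within `[0, t], continuous g}.
  by apply: derivable_within_continuous => s si; have [] := cE s si.
have go (s : R) : s \in `]0, t[ -> is_derive s 1 g (dg s).
  by move=> si; apply: (cE s); exact: subset_itv_oo_cc si.
have [s] := MVT t0 go cg; rewrite in_itv/= subr0 => /andP[s0 st] E.
have := He' t te'; rewrite -subr_le0 E pmulr_lle0// leNgt => /negP; apply.
have := hE s; rewrite dg0 !subr0 => ->; rewrite mulr_gt0// Hd//.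
by rewrite gtr0_norm// (lt_trans st)// (le_lt_trans (ler_norm _) td).
Qed.

End RealLine.

(** * Functions on a segment with a closed graph *)

Section Baire.
Context {R : realType}.
Implicit Types (P : set R) (A : nat -> set R).

(** Baire's theorem in a closed subset of the line: one of countably many
    closed sets covering [P] contains a relatively open part of [P]. *)
Lemma baire_closed_subset P A : closed P -> P !=set0 ->
  (forall k, closed (A k)) -> P `<=` \bigcup_k A k ->
  exists k x (e : R),
    [/\ P x, 0 < e & forall t, P t -> `|t - x| < e -> A k t].
Proof.
move=> cP [x0 Px0] cA PA; apply: contrapT => nex.
have step (n : nat) (s : {s : R * R | P s.1 /\ 0 < s.2}) :
  exists s' : {s : R * R | P s.1 /\ 0 < s.2},
    [/\ `|(sval s').1 - (sval s).1| + (sval s').2 <= (sval s).2,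
        (sval s').2 <= n.+1%:R^-1 &
        forall t, `|t - (sval s').1| <= (sval s').2 -> ~ A n t].
  case: s => -[x e] /= [Px e0].
  have [t [Pt te nAt]] : exists t, [/\ P t, `|t - x| < e & ~ A n t].
    apply: contrapT => H; apply: nex; exists n, x, e; split => // t Pt te.
    by apply: contrapT => nAt; apply: H; exists t.
  have /near_absP[d d0 dA] : \forall u \near t, ~ A n u.
    by apply: open_nbhs_nbhs; split => //; exact: closed_openC.
  pose m := Num.min (d / 2) (Num.min (e - `|t - x|) n.+1%:R^-1).
  have m0 : 0 < m by rewrite !lt_min divr_gt0//= subr_gt0 te invr_gt0 ltr0n.
  have [md [me mn]] : m <= d / 2 /\ m <= e - `|t - x| /\ m <= n.+1%:R^-1.
    by rewrite /m !ge_min !lexx !orbT.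
  exists (exist _ (t, m) (conj Pt m0)) => /=; split => //.
  - by rewrite addrC -lerBrDr.
  - move=> u um; apply: dA; rewrite (le_lt_trans um)// (le_lt_trans md)//.
    by rewrite ltr_pdivrMr//; lra.
have /choice[F HF] (ns : nat * {s : R * R | P s.1 /\ 0 < s.2}) := step ns.1 ns.2.
pose s0 : {s : R * R | P s.1 /\ 0 < s.2} := exist _ (x0, 1) (conj Px0 ltr01).
pose fix u n := if n is m.+1 then F (m, u m) else s0.
pose x n := (sval (u n)).1; pose r n := (sval (u n)).2.
have Px n : P (x n) by rewrite /x; case: (svalP (u n)).
have r0 n : 0 < r n by rewrite /r; case: (svalP (u n)).
have uS n : [/\ `|x n.+1 - x n| + r n.+1 <= r n, r n.+1 <= n.+1%:R^-1 &
      forall t, `|t - x n.+1| <= r n.+1 -> ~ A n t].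
  by have := HF (n, u n).
have nest n m t : `|t - x (n + m)%N| <= r (n + m)%N -> `|t - x n| <= r n.
  elim: m => [|m IH]; first by rewrite addn0.
  rewrite addnS => h; apply: IH; have [h1 _ _] := uS (n + m)%N.
  rewrite (le_trans _ h1)// (le_trans (ler_distD (x (n + m).+1) _ _))// addrC.
  by rewrite lerD2l.
have mid n : `|x n - x n| <= r n by rewrite subrr normr0 ltW.
have lu n m : x n - r n <= x m + r m.
  have [/subnKC nm|/ltnW/subnKC mn] := leqP n m.
    have := @nest n (m - n)%N (x m); rewrite nm => /(_ (mid m)).
    rewrite ler_distl => /andP[+ _]; move=> /le_trans; apply.
    by rewrite lerDl ltW.
  have := @nest m (n - m)%N (x n); rewrite mn => /(_ (mid n)).
  rewrite ler_distl => /andP[_]; apply: le_trans.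
  by rewrite gerBl ltW.
pose E := range (fun n => x n - r n).
have hE : has_sup E.
  split; first by exists (x 0 - r 0); exists 0.
  by exists (x 0 + r 0) => _ [n _ <-]; exact: lu.
pose y := sup E.
have yr n : `|y - x n| <= r n.
  rewrite ler_distl; apply/andP; split.
    by apply: sup_upper_bound => //; exists n.
  by apply: sup_le_ub; [case: hE|move=> _ [m _ <-]; exact: lu].
have Py : P y.
  apply: cP => B /near_absP[e e0 eB].
  have [n ne] : exists n : nat, n.+1%:R^-1 < e.
    exists (Num.truncn e^-1).
    by rewrite invf_plt ?posrE// truncnS_gt.
  exists (x n.+1); split => //; apply: eB.
  by rewrite distrC (le_lt_trans (yr _))//; have [_ + _] := uS n => /le_lt_trans; apply.
have [k _ Ak] := PA y Py.
by have [_ _ /(_ y (yr _))] := uS k.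
Qed.

End Baire.

Section ClosedGraph.
Context {R : realType}.
Implicit Types (v : R -> R) (N : set R) (al be ka : R).

(** [N] has empty interior. *)
Definition codense N : Prop :=
  forall a b : R, a < b -> exists2 y, a < y < b & ~ N y.

(** The graph of [v] over the segment is closed, in the form: values of [v]
    that stay bounded near [t] are close to [v t]. *)
Definition closed_graph v al be : Prop :=
  forall t, al <= t <= be -> forall K e : R, 0 < e ->
  exists2 d : R, 0 < d & forall s, al <= s <= be -> `|s - t| < d ->
    `|v s| <= K -> `|v s - v t| < e.

(** The local Lipschitz estimate of constant [ka] at [t], along the points whose
    value is close to that at [t]; [v] may be discontinuous at [t]. *)
Definition locally_lip v al be ka (t : R) : Prop :=
  exists2 d : R, 0 < d & forall s, al <= s <= be -> `|s - t| < d ->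
    `|v s - v t| < d -> `|v s - v t| <= ka * `|s - t|.

(** If [v + ka t] decreased from [a] to [b], it would take a value [y] outside
    [N] between the two values; the estimate fails at the last point where it
    is at least [y]. *)
Lemma bounded_monotone v al be ka K N a b : closed_graph v al be ->
  al <= a -> a <= b -> b <= be ->
  (forall t, a <= t <= b -> `|v t| <= K) ->
  codense N ->
  (forall t, al <= t <= be -> `|v t| <= K -> ~ N (v t + ka * t) ->
     locally_lip v al be ka t) ->
  v a + ka * a <= v b + ka * b.
Proof.
move=> cv ala ab bbe vK nN lip; rewrite leNgt; apply/negP => wba.
have [y /andP[by_ ya] nNy] := nN _ _ wba.
pose w t := v t + ka * t.
have inab t : a <= t <= b -> al <= t <= be.
  by move=> /andP[t1 t2]; rewrite (le_trans ala)//= (le_trans t2).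
have cw t e : a <= t <= b -> 0 < e -> exists2 d : R, 0 < d &
    forall s, a <= s <= b -> `|s - t| < d -> `|v s - v t| < e /\ `|w s - w t| < e.
  move=> tab e0; have e2 : 0 < e / 2 by rewrite divr_gt0.
  have [d d0 Hd] := cv t (inab t tab) K _ e2.
  have k0 : 0 < `|ka| + 1 by rewrite ltr_pwDr.
  exists (Num.min d (e / 2 / (`|ka| + 1))).
    by rewrite lt_min d0 !divr_gt0.
  move=> s sab; rewrite lt_min => /andP[sd].
  rewrite ltr_pdivlMr// mulrC => se.
  have vs := Hd s (inab s sab) sd (vK s sab).
  split; first by rewrite (lt_trans vs)// ltr_pdivrMr//; lra.
  have -> : w s - w t = (v s - v t) + ka * (s - t) by rewrite /w; ring.
  rewrite (le_lt_trans (ler_normD _ _))// [ltRHS](splitr e) ltrD// normrM.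
  by rewrite (le_lt_trans _ se)// mulrDl mul1r lerDl.
pose S := [set s | a <= s <= b /\ y <= w s].
have Sa : S a by split; rewrite ?lexx// ltW.
have hS : has_sup S.
  by split; [exists a|exists b => s [/andP[]]].
pose t := sup S.
have at_ : a <= t by apply: sup_upper_bound.
have tb : t <= b by apply: sup_le_ub; [case: hS|move=> s [/andP[]]].
have tab : a <= t <= b by rewrite at_.
have wt1 : y <= w t.
  apply/ler_addgt0Pr => e e0; have [d d0 Hd] := cw t e tab e0.
  have [s [sab ys] ts] := sup_adherent d0 hS.
  have st : s <= t by apply: sup_upper_bound.
  have [|_ +] := Hd s sab.
    by rewrite ler0_norm ?subr_le0// opprB ltrBlDr addrC -ltrBlDr.
  by rewrite ltr_distl => /andP[_ /ltW]; lra.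
have tltb : t < b.
  rewrite lt_neqAle tb andbT; apply/eqP => tE.
  by move: wt1; rewrite tE leNgt by_.
have gtS s : t < s -> s <= b -> w s < y.
  move=> ts sb; rewrite ltNge; apply/negP => ys.
  suff : s <= t by rewrite leNgt ts.
  by apply: sup_upper_bound => //; split => //; rewrite sb (le_trans at_)// ltW.
have near_right d : 0 < d -> exists s, [/\ t < s, s <= b & `|s - t| < d].
  move=> d0; exists (Num.min b (t + d / 2)).
  rewrite lt_min tltb ltrDl divr_gt0// ge_min lexx; split => //.
  have h1 : Num.min b (t + d / 2) <= t + d / 2 by rewrite ge_min lexx orbT.
  have h2 : t <= Num.min b (t + d / 2) by rewrite le_min tb lerDl divr_ge0// ltW.
  by rewrite ger0_norm ?subr_ge0//; lra.
have wt : w t = y.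
  apply/eqP; rewrite eq_le wt1 andbT; apply/ler_addgt0Pr => e e0.
  have [d d0 Hd] := cw t e tab e0.
  have [s [ts sb sd]] := near_right d d0.
  have [|_] := Hd s _ sd; first by rewrite sb (le_trans at_)// ltW.
  rewrite ltr_distl => /andP[+ _]; have := gtS s ts sb; lra.
have nNt : ~ N (v t + ka * t) by rewrite -/(w t) wt.
have [d d0 Hd] := lip t (inab t tab) (vK t tab) nNt.
have [e e0 He] := cw t d tab d0.
have m0 : 0 < Num.min d e by rewrite lt_min d0.
have [s [ts sb]] := near_right _ m0.
rewrite lt_min => /andP[sd se].
have sab : a <= s <= b by rewrite sb (le_trans at_)// ltW.
have [vd _] := He s sab se.
have := Hd s (inab s sab) sd vd.
rewrite (gtr0_norm (x := s - t)) ?subr_gt0// ler_norml => /andP[h _].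
have := gtS s ts sb; rewrite -wt /w; lra.
Qed.

Lemma bounded_lip v al be ka K N1 N2 a b : closed_graph v al be ->
  al <= a -> a <= b -> b <= be ->
  (forall t, a <= t <= b -> `|v t| <= K) ->
  codense N1 -> codense N2 ->
  (forall t, al <= t <= be -> `|v t| <= K ->
     ~ N1 (v t + ka * t) \/ ~ N2 (v t - ka * t) ->
     locally_lip v al be ka t) ->
  `|v b - v a| <= ka * (b - a).
Proof.
move=> cv ala ab bbe vK nN1 nN2 lip.
have h1 : v a + ka * a <= v b + ka * b.
  apply: (bounded_monotone cv ala ab bbe vK nN1) => t tab tK tN.
  by apply: lip => //; left.
have h2 : - v a + ka * a <= - v b + ka * b.
  apply: (@bounded_monotone (fun t => - v t) al be ka K [set x | N2 (- x)]) => //.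
  - move=> t tab K' e e0; have [d d0 Hd] := cv t tab K' e e0.
    by exists d => // s sab sd; rewrite normrN -opprD normrN; exact: Hd.
  - by move=> t; rewrite normrN; exact: vK.
  - move=> c d cd; have [|y /andP[dy yc] nNy] := nN2 (- d) (- c); first by rewrite ltrN2.
    by exists (- y); rewrite /= ?opprK// ltrNr yc ltrNl dy.
  - move=> t tab; rewrite normrN /= opprD opprK => tK tN.
    have [|d d0 Hd] := lip t tab tK; first by right.
    by exists d => // s sab sd; rewrite -opprD normrN; exact: Hd.
by rewrite ler_norml; apply/andP; split; lra.
Qed.

(** [v] is bounded near [t]. *)
Definition locally_bounded v al be (t : R) : Prop := exists K d, 0 < d /\
  forall s, al <= s <= be -> `|s - t| < d -> `|v s| <= K.

Lemma locally_bounded_segment v al be a b : al <= a -> a <= b -> b <= be ->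
  (forall t, a <= t <= b -> locally_bounded v al be t) ->
  exists K, forall t, a <= t <= b -> `|v t| <= K.
Proof.
move=> ala ab bbe lb.
pose S := [set t | a <= t <= b /\ exists K, forall s, a <= s <= t -> `|v s| <= K].
have Sa : S a.
  split; first by rewrite lexx.
  by exists `|v a| => s; rewrite -eq_le => /eqP ->.
have hS : has_sup S by split; [exists a|exists b => s [/andP[]]].
pose t := sup S.
have at_ : a <= t by apply: sup_upper_bound.
have tb : t <= b by apply: sup_le_ub; [case: hS|move=> s [/andP[]]].
have [|K [d [d0 Hd]]] := lb t; first by rewrite at_.
have [s Ss ts] := sup_adherent d0 hS.
have st : s <= t by apply: sup_upper_bound.
have [/andP[as_ sb] [K' HK']] := Ss.
pose u := Num.min b (t + d / 2).
have ub : u <= b by rewrite ge_min lexx.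
have ud : u <= t + d / 2 by rewrite ge_min lexx orbT.
have tu : t <= u by rewrite le_min tb lerDl divr_ge0// ltW.
have au : a <= u by rewrite (le_trans at_).
have Su : forall s', a <= s' <= u -> `|v s'| <= Num.max K K'.
  move=> s' /andP[as' s'u]; rewrite le_max.
  have [s's|ss'] := leP s' s; first by rewrite HK' ?orbT// as'.
  rewrite Hd//; first by rewrite (le_trans ala as')/= (le_trans _ bbe)// (le_trans s'u).
  by rewrite -/t in ts; rewrite ltr_distl; apply/andP; split; lra.
have uS : S u by split; [rewrite au|exists (Num.max K K')].
have ut : u <= t by apply: sup_upper_bound.
have bt : b <= u.
  have [bd|db] := leP b (t + d / 2); first by rewrite /u min_l.
  by move: ut; rewrite /u min_r ?(ltW db)//; lra.
exists (Num.max K K') => s' /andP[as' s'b].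
by apply: Su; rewrite as' (le_trans s'b).
Qed.

(** A function with a closed graph is Lipschitz as soon as it satisfies the
    local estimate wherever [v + ka t] or [v - ka t] avoids a set with empty
    interior. It is not assumed to be bounded: by Baire's theorem it would be
    bounded on a part of the set of the points near which it is not, hence near
    them, by the estimate on the complementary intervals. *)
Lemma closed_graph_lip v al be ka : 0 <= ka -> al <= be ->
  closed_graph v al be ->
  (forall K : R, exists N1 N2, [/\ codense N1, codense N2 &
     forall t, al <= t <= be -> `|v t| <= K ->
       ~ N1 (v t + ka * t) \/ ~ N2 (v t - ka * t) ->
       locally_lip v al be ka t]) ->
  `|v be - v al| <= ka * (be - al).
Proof.
move=> ka0 albe cv bad.
have blip K a b : al <= a -> a <= b -> b <= be ->
    (forall t, a <= t <= b -> `|v t| <= K) -> `|v b - v a| <= ka * (b - a).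
  move=> ala ab bbe vK; have [N1 [N2 [n1 n2 lip]]] := bad K.
  exact: (bounded_lip cv ala ab bbe vK n1 n2 lip).
pose lb := locally_bounded v al be.
have nbd a b : al <= a <= be -> al <= b <= be ->
    (forall t, Num.min a b <= t <= Num.max a b -> lb t) ->
    `|v b - v a| <= ka * `|b - a|.
  move=> /andP[a1 a2] /andP[b1 b2]; have [ab|/ltW ba] := leP a b => H.
    have [K HK] := locally_bounded_segment a1 ab b2 H.
    by rewrite (ger0_norm (x := b - a)) ?subr_ge0//; exact: (blip K _ _ a1 ab b2 HK).
  have [K HK] := locally_bounded_segment b1 ba a2 H.
  by rewrite distrC (distrC b) (ger0_norm (x := a - b)) ?subr_ge0//; apply: blip HK.
suff lball t : al <= t <= be -> lb t.
  have [K HK] := locally_bounded_segment (lexx al) albe (lexx be) lball.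
  exact: (blip K _ _ (lexx al) albe (lexx be) HK).
apply: contrapT => nlb.
pose P := [set s | al <= s <= be /\ ~ lb s].
pose A (k : nat) := [set s | al <= s <= be /\ `|v s| <= k%:R].
have cI s : ~ (al <= s <= be) -> exists2 d, 0 < d & forall u, `|u - s| < d -> ~ (al <= u <= be).
  move=> /negP; rewrite negb_and -!ltNge => /orP[sal|bes].
    exists (al - s); first by rewrite subr_gt0.
    by move=> u; rewrite ltr_norml => /andP[_ h] /andP[h' _]; lra.
  exists (s - be); first by rewrite subr_gt0.
  by move=> u; rewrite ltr_norml => /andP[h _] /andP[_ h']; lra.
have cP : closed P.
  rewrite -openC openE => s /not_andP[sn|/contrapT [K [d [d0 Hd]]]].
    have [d d0 Hd] := cI s sn.
    by apply/near_absP; exists d => // u /Hd un [].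
  apply/near_absP; exists (d / 2); first by rewrite divr_gt0.
  move=> u us [_]; apply; exists K, (d / 2); split; first by rewrite divr_gt0.
  move=> r rab ru; apply: Hd => //.
  by rewrite (le_lt_trans (ler_distD u _ _))// [ltRHS](splitr d) ltrD.
have cA k : closed (A k).
  move=> s sA; have [sab|/cI[d d0 Hd]] := pselect (al <= s <= be); last first.
    have [|u [[+ _] /Hd]] := sA [set u | `|u - s| < d]; last by [].
    by apply/near_absP; exists d.
  split => //; apply/ler_addgt0Pr => e e0.
  have [d d0 Hd] := cv s sab k%:R e e0.
  have [|u [[uab uk] us]] := sA [set u | `|u - s| < d].
    by apply/near_absP; exists d.
  have := Hd u uab us uk => h.
  rewrite -[v s](subrK (v u)) (le_trans (ler_normD _ _))// addrC lerD//.
  by rewrite distrC ltW.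
have PA : P `<=` \bigcup_k A k.
  move=> s [sab _]; exists (Num.truncn `|v s|).+1 => //; split => //.
  exact: ltW (truncnS_gt _).
have P0 : P !=set0.
  move: nlb => /not_implyP[tab tn]; exists t; split => //.
have [k [x [e [[xab xn] e0 Hx]]]] := baire_closed_subset cP P0 cA PA.
apply: (xn); exists (k%:R + ka * (be - al)), e; split => // s sab sx.
have kb : 0 <= ka * (be - al) by rewrite mulr_ge0// subr_ge0.
have [Ps|/not_andP[//|/contrapT lbs]] := pselect (P s).
  by have [_ /le_trans] := Hx s Ps sx; apply; rewrite lerDl.
(* [t1]: the point of [P] between [x] and [s] closest to [s] *)
pose Q := P `&` `[Num.min x s, Num.max x s].
have cQ : compact Q by rewrite /Q setIC; apply: compact_closedI => //; exact: segment_compact.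
have Qx : Q x.
  by split => //; rewrite /= in_itv/= ge_min lexx le_max lexx.
have [|t1] := @compact_EVT_min _ R (fun u => `|u - s|) Q (ex_intro _ x Qx) cQ.
  apply: continuous_subspaceT => u; apply: cvg_norm; apply: cvgB => //; exact: cvg_cst.
rewrite inE => -[Pt1]; rewrite /= in_itv/= => /andP[t1m t1M] t1min.
have [t1ab _] := Pt1.
have t1x : `|t1 - x| <= `|s - x|.
  move: t1m t1M; have [xs|/ltW xs] := leP x s => t1m t1M.
    by rewrite !ger0_norm ?subr_ge0// lerB.
  by rewrite !ler0_norm ?subr_le0// lerN2 lerB.
have [_ vt1] := Hx t1 Pt1 (le_lt_trans t1x sx).
have t1s : t1 != s by apply/eqP => E; case: Pt1 => _; rewrite E.
(* [v] is locally bounded, hence Lipschitz, between [t1] and [s], and tends to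
   [v t1] at [t1] since its graph is closed *)
pose a_ (th : R) := t1 + th * (s - t1).
have lbA th : 0 < th <= 1 -> al <= a_ th <= be /\ lb (a_ th).
  move=> /andP[th0 th1].
  have conv (c d : R) : c <= t1 <= d -> c <= s <= d -> c <= a_ th <= d.
    move=> /andP[h1 h2] /andP[h3 h4]; rewrite /a_; clear -h1 h2 h3 h4 th0 th1.
    by apply/andP; split; nra.
  have uab := conv _ _ t1ab sab; split => //.
  apply: contrapT => nlbu.
  have Qu : Q (a_ th).
    split => //; rewrite /= in_itv/=; apply: conv; first by rewrite t1m.
    by rewrite ge_min le_max !lexx !orbT.
  have := t1min (a_ th); rewrite inE => /(_ Qu); rewrite leNgt => /negP; apply.
  have -> : a_ th - s = (1 - th) * (t1 - s) by rewrite /a_; ring.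
  rewrite normrM ger0_norm ?subr_ge0//.
  by rewrite gtr_pMl ?normr_gt0 ?subr_eq0//; lra.
have aE th : 0 < th <= 1 -> `|v s - v (a_ th)| <= ka * (be - al).
  move=> thI; have [aI _] := lbA th thI.
  have /le_trans -> // : `|v s - v (a_ th)| <= ka * `|s - a_ th|.
    apply: nbd => // u /andP[tm tM].
    have st0 : s - t1 != 0 by rewrite subr_eq0 eq_sym.
    have uE : u = a_ ((u - t1) / (s - t1)).
      by rewrite /a_ divfK// addrC subrK.
    rewrite uE; apply lbA; move: thI => /andP[th0 th1].
    suff /andP[h1 h2] : th <= (u - t1) / (s - t1) <= 1.
      by rewrite h2 (lt_le_trans th0 h1).
    have [ts|st] := ltP t1 s.
      rewrite ler_pdivrMr ?subr_gt0// ler_pdivlMr ?subr_gt0// mul1r.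
      move: tm tM; rewrite ge_min le_max /a_ => /orP[h1|h1] /orP[h2|h2];
        apply/andP; split; clear -h1 h2 ts th0 th1; nra.
    have {}st : s < t1 by rewrite lt_neqAle st andbT eq_sym.
    rewrite ler_ndivrMr ?subr_lt0// ler_ndivlMr ?subr_lt0// mul1r.
    move: tm tM; rewrite ge_min le_max /a_ => /orP[h1|h1] /orP[h2|h2];
      apply/andP; split; clear -h1 h2 st th0 th1; nra.
  rewrite ler_wpM2l//; move: sab aI => /andP[? ?] /andP[? ?].
  by rewrite ler_norml; apply/andP; split; lra.
have acl d : 0 < d -> exists2 th, 0 < th <= 1 & `|a_ th - t1| < d.
  move=> d0; have n0 : 0 < `|s - t1| by rewrite normr_gt0 subr_eq0 eq_sym.
  exists (Num.min 1 (d / 2 / `|s - t1|)).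
    by rewrite lt_min ltr01 !divr_gt0//= ge_min lexx.
  rewrite /a_ addrC addKr normrM ger0_norm; last first.
    by rewrite le_min ler01 !divr_ge0// ltW.
  rewrite (le_lt_trans (y := d / 2))//; last by rewrite ltr_pdivrMr//; lra.
  by rewrite -ler_pdivlMr// ge_min lexx orbT.
apply/ler_addgt0Pr => eps eps0.
have [d d0 Hd] := cv t1 t1ab (`|v s| + ka * (be - al)) eps eps0.
have [th thI tha] := acl d d0; have [aI _] := lbA th thI; have as_ := aE th thI.
have := Hd _ aI tha _ => h.
have {}h : `|v (a_ th) - v t1| < eps.
  apply: h; rewrite -[v (a_ th)](subrK (v s)) (le_trans (ler_normD _ _))//.
  by rewrite addrC lerD2l distrC.
have -> : v s = (v s - v (a_ th)) + ((v (a_ th) - v t1) + v t1) by ring.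
rewrite (le_trans (ler_normD _ _))//.
have := ler_normD (v (a_ th) - v t1) (v t1); lra.
Qed.

End ClosedGraph.

(** * Nowhere dense sets of critical values *)

Section PlaneCategory.
Context {R : realType}.
Implicit Types (N : set (R * R)).

(** Every open rectangle contains an open rectangle that misses [N]. *)
Definition nowhere_dense2 N : Prop :=
  forall a b c d : R, a < b -> c < d ->
  exists a' b' c' d', [/\ [/\ a <= a', a' < b' & b' <= b],
    [/\ c <= c', c' < d' & d' <= d] &
    forall x y, a' < x < b' -> c' < y < d' -> ~ N (x, y)].

Lemma nowhere_dense2S N N' : N `<=` N' -> nowhere_dense2 N' -> nowhere_dense2 N.
Proof.
move=> NN' nd a b c d ab cd; have [a' [b' [c' [d' [h1 h2 h3]]]]] := nd _ _ _ _ ab cd.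
by exists a', b', c', d'; split => // x y hx hy /NN'; exact: h3.
Qed.

Lemma nowhere_dense2U N N' : nowhere_dense2 N -> nowhere_dense2 N' ->
  nowhere_dense2 (N `|` N').
Proof.
move=> nd nd' a b c d ab cd.
have [a1 [b1 [c1 [d1 [[aa1 ab1 bb1] [cc1 cd1 dd1] h1]]]]] := nd _ _ _ _ ab cd.
have [a2 [b2 [c2 [d2 [[aa2 ab2 bb2] [cc2 cd2 dd2] h2]]]]] := nd' _ _ _ _ ab1 cd1.
exists a2, b2, c2, d2; split.
- by split => //; [exact: le_trans aa2|exact: le_trans bb1].
- by split => //; [exact: le_trans cc2|exact: le_trans dd1].
- move=> x y /andP[x1 x2] /andP[y1 y2] [|]; last by apply: h2; apply/andP.
  by apply: h1; [rewrite (le_lt_trans aa2)//= (lt_le_trans x2)|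
                 rewrite (le_lt_trans cc2)//= (lt_le_trans y2)].
Qed.

Lemma nowhere_dense2_0 : nowhere_dense2 set0.
Proof. by move=> a b c d ab cd; exists a, b, c, d; split; [split|split|move=> x y _ _ []]. Qed.

(** The category analogue of Fubini's theorem (Kuratowski and Ulam): some
    vertical line, in any given strip, meets countably many nowhere dense sets
    along sets with empty interior. *)
Lemma nowhere_dense_sections (N : nat -> set (R * R)) (a b : R) :
  (forall n, nowhere_dense2 (N n)) -> a < b ->
  exists2 m, a < m < b & forall n, codense [set y | N n (m, y)].
Proof.
move=> nd ab.
pose D (k : nat) : set R := if unpickle k is Some (n, (q1, q2)) then
  if (q1 : rat) < q2 then [set m | exists a' b' c' d' : R,
    [/\ a' < m < b', ratr q1 <= c', c' < d', d' <= ratr q2 &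
    forall x y, a' < x < b' -> c' < y < d' -> ~ N n (x, y)]]
  else setT else setT.
have oD k : open (D k) /\ dense (D k).
  rewrite /D; case: unpickle => [[n [q1 q2]]|]; last first.
    by split; [exact: openT|move=> O [x Ox] _; exists x].
  case: ifP => q12; last by split; [exact: openT|move=> O [x Ox] _; exists x].
  split.
    rewrite openE => m [a' [b' [c' [d' [/andP[am mb] qc cd dq H]]]]].
    have : \forall u \near m, a' < u < b'.
      by near=> u; apply/andP; split; near: u; [exact: lt_nbhsr|exact: lt_nbhsl].
    by apply: filterS => u ui; exists a', b', c', d'.
  move=> O [x Ox] oO.
  have /near_absP[e e0 eO] : \forall u \near x, O u by exact: open_nbhs_nbhs.
  have xe : x - e < x + e by lra.
  have qr : ratr q1 < ratr q2 :> R by rewrite ltr_rat.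
  have [a' [b' [c' [d' [[xa' ab' bx] [qc cd dq] H]]]]] := nd n _ _ _ _ xe qr.
  exists ((a' + b') / 2); split.
    by apply: eO; rewrite ltr_norml; apply/andP; split; lra.
  by exists a', b', c', d'; split => //; apply/andP; split; lra.
have := Baire oD => /(_ `]a, b[%classic)[].
- by exists ((a + b) / 2); rewrite /= in_itv/=; apply/andP; split; lra.
- exact: interval_open.
move=> m [/=]; rewrite in_itv/= => mab mD; exists m => // n c d cd.
have [q1] := rat_in_itvoo cd; rewrite in_itv/= => /andP[cq1 q1d].
have [q2] := rat_in_itvoo q1d; rewrite in_itv/= => /andP[q12 q2d].
have := mD (pickle (n, (q1, q2))) I; rewrite /D pickleK.
rewrite ltr_rat in q12; rewrite q12.
move=> [a' [b' [c' [d' [mI qc' cd' dq H]]]]].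
exists ((c' + d') / 2); last by apply: H => //; apply/andP; split; lra.
by apply/andP; split; lra.
Unshelve. all: by end_near. Qed.

Lemma eq_of_modn (m i j : nat) : (i %% m = j %% m)%N ->
  `|i%:R - j%:R : R| < m%:R -> i = j.
Proof.
wlog ij : i j / (i <= j)%N.
  move=> H E h; have [ij|/ltnW ji] := leqP i j; first exact: H.
  by apply/esym/H => //; rewrite distrC.
move=> /eqP; rewrite eq_sym eqn_mod_dvd// => mij.
rewrite distrC -natrB// normr_nat ltr_nat => jim.
by apply/eqP; rewrite eqn_leq ij/= -subn_eq0 eqn0Ngt; apply/negP => /dvdn_leq/(_ mij);
  rewrite leqNgt jim.
Qed.

(** A form of Sard's theorem. [Z] lies in a square of side [S]; the map
    [(f, g)] is Lipschitz on [Z], and at each point of [Z] the increments of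
    one coordinate are controlled, to second order, by those of the other one:
    this is how a differential of rank at most one shows on [Z]. The proof is a
    count: if the image were dense in a rectangle, it would contain points close
    to each of [P * P] nodes; such a node is determined by the cell of a square
    grid of [n.+1 * n.+1] cells of side [S / n] where its preimage lies, by
    which coordinate controls the other one, and by the residue modulo [m0] of
    the index of the controlling coordinate, and these are too few. *)
Lemma sard_nowhere_dense (U : Type) (Z : set U) (X Y f g : U -> R) (x0 y0 S C : R) :
  0 < S -> 0 <= C ->
  (forall z, Z z -> x0 <= X z <= x0 + S /\ y0 <= Y z <= y0 + S) ->
  (forall z z' (e : R), Z z -> Z z' -> `|X z' - X z| <= e -> `|Y z' - Y z| <= e ->
     `|f z' - f z| <= C * e /\ `|g z' - g z| <= C * e) ->
  (forall z, Z z ->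
    (forall z' (e : R), Z z' -> `|X z' - X z| <= e -> `|Y z' - Y z| <= e ->
      `|g z' - g z| <= C * `|f z' - f z| + C * e ^+ 2) \/
    (forall z' (e : R), Z z' -> `|X z' - X z| <= e -> `|Y z' - Y z| <= e ->
      `|f z' - f z| <= C * `|g z' - g z| + C * e ^+ 2)) ->
  nowhere_dense2 [set (f z, g z) | z in Z].
Proof.
move=> S0 C0 ZS lipZ rkZ; apply: contrapT.
move=> /existsNP[a /existsNP[b /existsNP[c /existsNP[d]]]].
move=> /not_implyP[ab /not_implyP[cd H]].
have {}H a' b' c' d' : a <= a' -> a' < b' -> b' <= b -> c <= c' -> c' < d' ->
    d' <= d -> exists2 z, Z z & a' < f z < b' /\ c' < g z < d'.
  move=> h1 h2 h3 h4 h5 h6; apply: contrapT => nz; apply: H.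
  exists a', b', c', d'; split => // x y hx hy [z Zz [fx gy]].
  by apply: nz; exists z => //; rewrite fx gy.
pose be := Num.min (b - a) (d - c).
have be0 : 0 < be by rewrite lt_min !subr_gt0 ab.
have [beb bed] : be <= b - a /\ be <= d - c by rewrite /be !ge_min !lexx orbT.
have natgt (r : R) : exists k : nat, r < k%:R.
  by exists (Num.truncn r).+1; exact: truncnS_gt.
have [K] := natgt ((C * S + 1) / be); rewrite ltr_pdivrMr// => HK.
pose M := (8 * K + 17)%N; pose m0 := (K * M.+1).+1.
have [n Hn] := natgt ((C + 1 + C * S ^+ 2) * M.+1%:R / be).
have CS : 0 <= C * S ^+ 2 by rewrite mulr_ge0// sqr_ge0.
have n0 : 0 < n%:R :> R.
  by apply: le_lt_trans Hn; rewrite divr_ge0 ?(ltW be0)// mulr_ge0//; lra.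
rewrite ltr_pdivrMr// in Hn.
have n1 : 1 <= n%:R :> R by rewrite ler1n -(ltr0n R).
pose P := (M * n)%N; pose d0 := be / P.+1%:R.
have d00 : 0 < d0 by rewrite divr_gt0// ltr0n.
pose e := S / n%:R; have e0 : 0 < e by rewrite divr_gt0.
pose sg := (2 * n%:R ^+ 2)^-1 : R.
have sg0 : 0 < sg by rewrite invr_gt0 mulr_gt0// exprn_gt0.
have PM : P.+1%:R <= n%:R * M.+1%:R :> R.
  by rewrite -natrM ler_nat mulnS addnC /P mulnC -addn1 leq_add2l -(ltr0n R).
have d0E : d0 * P.+1%:R = be by rewrite /d0 divfK// pnatr_eq0.
(* the two smallness conditions on the mesh *)
have mesh1 : (2 * C + 2) * sg + C * e ^+ 2 < d0.
  have -> : (2 * C + 2) * sg + C * e ^+ 2 = (C + 1 + C * S ^+ 2) / n%:R ^+ 2.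
    by rewrite /sg /e; field; rewrite gt_eqF.
  rewrite ltr_pdivrMr ?exprn_gt0// /d0 mulrAC ltr_pdivlMr ?ltr0n//.
  rewrite (le_lt_trans (y := (C + 1 + C * S ^+ 2) * (n%:R * M.+1%:R)))//.
    by rewrite ler_wpM2l//; lra.
  rewrite mulrCA (_ : be * n%:R ^+ 2 = n%:R * (n%:R * be)); last by ring.
  by rewrite ltr_pM2l.
have mesh2 : C * e + 2 * sg <= K%:R * M.+1%:R * d0.
  have e2sg : 2 * sg <= n%:R^-1.
    rewrite /sg invfM mulrA divff// mul1r.
    by rewrite lef_pV2 ?posrE ?exprn_gt0// expr2 ler_peMl// ltW.
  have : C * e + 2 * sg <= (C * S + 1) / n%:R.
    by rewrite [leRHS]mulrDl /e mulrA lerD2l mul1r.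
  move/le_trans; apply; rewrite ler_pdivrMr//.
  have -> : K%:R * M.+1%:R * d0 * n%:R = K%:R * (n%:R * M.+1%:R) * d0 by ring.
  have h : K%:R * P.+1%:R * d0 <= K%:R * (n%:R * M.+1%:R) * d0.
    by rewrite ler_wpM2r ?(ltW d00)// ler_wpM2l.
  by rewrite (le_trans _ h)// -mulrA (mulrC _ d0) d0E ltW.
have sgd0 : sg <= d0.
  have := mesh1; have := mulr_ge0 C0 (sqr_ge0 e); have := mulr_ge0 C0 (ltW sg0).
  by move=> *; nra.
pose L (i : nat) : R := i.+1%:R * d0.
have Lb (i : 'I_P) : d0 <= L i /\ L i + d0 <= be.
  split; first by rewrite /L ler_peMl ?ler1n// ltW.
  have : i.+2%:R <= P.+1%:R :> R by rewrite ler_nat ltnS.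
  move=> /(ler_wpM2r (ltW d00)); rewrite mulrC -[i.+2%:R]natr1.
  by rewrite mulrDr mulr1 mulrC (mulrC P.+1%:R) d0E.
let bound := ltac:(0) in idtac.
have fit (l u v : R) : d0 <= l /\ l + d0 <= be -> be <= v - u ->
    [/\ u <= u + l - sg, u + l - sg < u + l + sg & u + l + sg <= v].
  by move=> [k1 k2] k3; clear -sg0 sgd0 k1 k2 k3; split; lra.
have pick_ (ij : 'I_P * 'I_P) : exists z, [/\ Z z,
    `|f z - (a + L ij.1)| < sg & `|g z - (c + L ij.2)| < sg].
  have [h1 h2 h3] := fit _ _ _ (Lb ij.1) beb; have [h4 h5 h6] := fit _ _ _ (Lb ij.2) bed.
  have [z Zz [/andP[f1 f2] /andP[g1 g2]]] := H _ _ _ _ h1 h2 h3 h4 h5 h6.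
  exists z; clear -f1 f2 g1 g2 Zz.
  by split => //; rewrite ltr_norml; apply/andP; split; lra.
have [z Hz] := choice pick_.
pose orient (z : U) := `[< forall z' (e : R), Z z' -> `|X z' - X z| <= e -> `|Y z' - Y z| <= e ->
      `|g z' - g z| <= C * `|f z' - f z| + C * e ^+ 2 >].
pose cx (z : U) : 'I_n.+1 := inord (Num.truncn ((X z - x0) / e)).
pose cy (z : U) : 'I_n.+1 := inord (Num.truncn ((Y z - y0) / e)).
pose code (ij : 'I_P * 'I_P) : bool * ('I_n.+1 * 'I_n.+1) * 'I_m0 :=
  (orient (z ij), (cx (z ij), cy (z ij)),
   inord ((if orient (z ij) then ij.1 : nat else ij.2) %% m0)).
(* points in the same cell are close *)
have cell (u u' w : R) : w <= u <= w + S -> w <= u' <= w + S ->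
    (inord (Num.truncn ((u - w) / e)) : 'I_n.+1) = inord (Num.truncn ((u' - w) / e)) ->
    `|u' - u| <= e.
  move=> uI u'I E.
  have tr (r : R) : w <= r <= w + S -> 0 <= (r - w) / e /\ (Num.truncn ((r - w) / e) < n.+1)%N.
    move=> /andP[r1 r2]; have r0 : 0 <= (r - w) / e.
      by rewrite divr_ge0 ?subr_ge0// ltW.
    split => //; rewrite ltnS -(ler_nat R) (@le_trans _ _ ((r - w) / e)) ?truncn_le//.
    by rewrite ler_pdivrMr// /e mulrC divfK ?gt_eqF//; clear -r2; lra.
  have [u0 un] := tr _ uI; have [u'0 u'n] := tr _ u'I.
  have {}E : Num.truncn ((u - w) / e) = Num.truncn ((u' - w) / e).
    by have := congr1 (@nat_of_ord _) E; rewrite !inordK.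
  have /andP[h1 h2] := truncn_itv u0; have /andP[h3 h4] := truncn_itv u'0.
  rewrite E in h1 h2; move: h1 h2 h3 h4; set k := Num.truncn _ => h1 h2 h3 h4.
  rewrite ler_pdivlMr// in h1; rewrite ler_pdivlMr// in h3.
  rewrite ltr_pdivrMr// -natr1 mulrDl mul1r in h2.
  rewrite ltr_pdivrMr// -natr1 mulrDl mul1r in h4.
  clear -h1 h2 h3 h4.
  by rewrite ler_norml; apply/andP; split; lra.
have Ldist (i j : nat) (r s w : R) : `|r - (w + L i)| < sg -> `|s - (w + L j)| < sg ->
    `|L j - L i| <= `|s - r| + 2 * sg.
  rewrite !ltr_norml => /andP[h1 h2] /andP[h3 h4]; have h5 := ler_norm (s - r).
  have h6 := ler_norm (r - s); rewrite (distrC r s) in h6; clear -h1 h2 h3 h4 h5 h6.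
  by rewrite ler_norml; apply/andP; split; lra.
have LE (i j : nat) : `|L j - L i| = `|j%:R - i%:R| * d0.
  by rewrite /L -mulrBl normrM (gtr0_norm d00) -natr1 -[i.+1%:R]natr1 opprD addrACA subrr addr0.
have far (i j : nat) : i != j -> d0 <= `|L j - L i|.
  move=> ij; rewrite LE ler_peMl ?(ltW d00)//.
  wlog lij : i j ij / (i < j)%N.
    move=> h; case: (ltngtP i j) => [|ji|E]; first exact: h.
      by rewrite distrC; apply: h => //; rewrite eq_sym.
    by rewrite E eqxx in ij.
  by rewrite -natrB 1?ltnW// normr_nat ler1n subn_gt0.
(* the combinatorial core: same residue, same cell, same orientation *)
have core (F G : U -> R) (w w' : R) (u u' : U) (i i' j j' : nat) :
    Z u -> Z u' -> `|X u' - X u| <= e -> `|Y u' - Y u| <= e ->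
    (`|F u' - F u| <= C * e) ->
    (`|G u' - G u| <= C * `|F u' - F u| + C * e ^+ 2) ->
    `|F u - (w + L i)| < sg -> `|F u' - (w + L i')| < sg ->
    `|G u - (w' + L j)| < sg -> `|G u' - (w' + L j')| < sg ->
    (i %% m0 = i' %% m0)%N -> i = i' /\ j = j'.
  move=> Zu Zu' hX hY FC GF Fi Fi' Gj Gj' mod_.
  have ii' : i = i'.
    apply: (eq_of_modn mod_); rewrite distrC -(ltr_pM2r d00) -LE.
    rewrite (le_lt_trans (Ldist _ _ _ _ _ Fi Fi'))//.
    rewrite (le_lt_trans (y := C * e + 2 * sg)) ?lerD2r//.
    rewrite (le_lt_trans mesh2)// ltr_pM2r// /m0 -natrM ltr_nat ltnS//.
  split => //; apply/eqP; apply: contrapT => /negP/far.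
  have := Ldist _ _ _ _ _ Gj Gj'; rewrite -ii' in Fi'.
  have F2 : `|F u' - F u| <= 2 * sg.
    move: Fi Fi'; rewrite !ltr_norml => /andP[h1 h2] /andP[h3 h4].
    clear -h1 h2 h3 h4.
    by rewrite ler_norml; apply/andP; split; lra.
  have := ler_wpM2l C0 F2; move: mesh1 GF; clear; lra.
have inj : injective code.
  move=> [i j] [i' j'] [] E1 E2 E3 E4.
  have [Zu /= fi gj] := Hz (i, j); have [Zu' /= fi' gj'] := Hz (i', j').
  have [xu yu] := ZS _ Zu; have [xu' yu'] := ZS _ Zu'.
  have hX := cell _ _ _ xu xu' E2; have hY := cell _ _ _ yu yu' E3.
  have [hf hg] := lipZ _ _ _ Zu Zu' hX hY.
  have m00 : (0 < m0)%N by [].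
  have {}E4 := congr1 (@nat_of_ord _) E4.
  rewrite /= !inordK ?ltn_mod// -E1 in E4.
  have [ho|ho] := boolP (orient (z (i, j))).
    rewrite ho in E4; move/asboolP : ho => /(_ _ _ Zu' hX hY) ho.
    have [ii jj] := core f g a c _ _ _ _ _ _ Zu Zu' hX hY hf ho fi fi' gj gj' E4.
    by congr pair; exact: val_inj.
  rewrite (negbTE ho) in E4; move/asboolPn : ho => ho.
  case: (rkZ _ Zu) => [/ho//|{}ho].
  have [jj ii] := core g f c a _ _ _ _ _ _ Zu Zu' hX hY hg (ho _ _ Zu' hX hY) gj gj' fi fi' E4.
  by congr pair; exact: val_inj.
have := leq_card code inj; rewrite !card_prod !card_ord card_bool leqNgt => /negP; apply.
have n1' : (1 <= n)%N by rewrite -(ler_nat R).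
have h1 : (n.+1 * n.+1 <= 4 * (n * n))%N.
  have n2 : (n.+1 <= 2 * n)%N by rewrite mul2n -addnn -addn1 leq_add2l.
  by rewrite (leq_trans (leq_mul n2 n2))// mulnACA.
have h2 : (8 * m0 < M * M)%N.
  have -> : (M * M = 8 * (K * M) + 17 * M)%N by rewrite {1}/M mulnDl mulnA.
  have ME : M = (8 * K + 17)%N by [].
  by rewrite /m0 mulnS; clear -ME; lia.
apply: (@leq_ltn_trans (2 * (4 * (n * n)) * m0)%N).
  by rewrite leq_mul2r leq_mul2l h1 !orbT.
rewrite /P mulnACA (_ : (2 * (4 * (n * n)) * m0)%N = (8 * m0 * (n * n))%N); last by ring.
by rewrite ltn_pmul2r// muln_gt0 n1'.
Qed.

End PlaneCategory.

(** * The cone estimate *)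

Lemma compact_local_induction (T : topologicalType) (K : set T) (P : set T -> Prop) :
  compact K -> (forall A B, A `<=` B -> P B -> P A) -> P set0 ->
  (forall A B, P A -> P B -> P (A `|` B)) ->
  (forall p, K p -> exists2 V, nbhs p V & P V) -> P K.
Proof.
move=> cK PS P0 PU Ploc; apply: contrapT => nPK.
pose F : set_system T := [set A | P (K `\` A)].
have FF : ProperFilter F.
  apply: Build_ProperFilter_ex.
    move=> A FA; apply: contrapT => /forallNP nA; apply: nPK.
    by apply: PS FA => x Kx; split => //; exact: nA.
  split.
  - by apply: PS P0 => x [_ /(_ I)].
  - move=> A B FA FB; apply: PS (PU _ _ FA FB) => x [Kx /not_andP[]]; by [left|right].
  - by move=> A B AB; apply: PS => x [Kx nB]; split => // /AB.
have FK : F K by apply: PS P0 => x [].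
have [p [Kp clp]] := cK F FF FK; have [V pV PV] := Ploc p Kp.
have FV : F (~` V) by apply: PS PV => x [_ /contrapT].
by have [x []] := clp _ _ FV pV.
Qed.

Section ProperGraph.
Context {R : realType} {T : topologicalType}.
Variables (M : set T) (x1 x2 x3 : T -> R).

(** The part of [M] sent into the cube of half-side [k]. *)
Definition box (k : R) : set T :=
  [set p | [/\ M p, `|x1 p| <= k, `|x2 p| <= k & `|x3 p| <= k]].

Definition radius (p : T) : R := Num.sqrt (x1 p ^+ 2 + x2 p ^+ 2).

(** Near [q] the chords of [x] issued from [x q] are not timelike. *)
Definition spacelike_chords (q : T) : Prop := \forall q' \near q,
  (x3 q' - x3 q) ^+ 2 <= (x1 q' - x1 q) ^+ 2 + (x2 q' - x2 q) ^+ 2.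

(** The values of the slope [x2 / x1] and of [x3 + s * x1] at the points that
    have timelike chords arbitrarily close to them; the lower bound on [x1]
    keeps the slope bounded. *)
Definition bad_values (A : set T) (k s : R) : set (R * R) :=
  [set (x2 q / x1 q, x3 q + s * x1 q) | q in
    [set q | [/\ A q, box k q, k^-1 <= `|x1 q| & ~ spacelike_chords q]]].

Hypothesis cx1 : forall p, M p -> {for p, continuous x1}.
Hypothesis cx2 : forall p, M p -> {for p, continuous x2}.
Hypothesis cx3 : forall p, M p -> {for p, continuous x3}.
Hypothesis properM : forall k, compact (box k).
Hypothesis graphM : forall p q, M p -> M q -> x1 p = x1 q -> x2 p = x2 q ->
  x3 p = x3 q.

Lemma near_separated (f : T -> R) (p q : T) : {for q, continuous f} -> f q != f p ->
  exists2 d, 0 < d & \forall q' \near q, d <= `|f q' - f p|.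
Proof.
move=> cf; rewrite -subr_eq0 -normr_gt0 => n0; exists (`|f q - f p| / 2).
  by rewrite divr_gt0.
near=> q'; have : `|f q' - f q| < `|f q - f p| / 2.
  by near: q'; apply: (continuous_dist cf); rewrite divr_gt0.
have := ler_distD (f q') (f q) (f p); rewrite (distrC (f q) (f q')); lra.
Unshelve. all: by end_near. Qed.

(** A neighbourhood of a fibre of the proper map [(x1, x2, x3)] contains the
    preimage of a neighbourhood of its value. *)
Lemma proper_nbhs (p : T) (V : set T) : M p ->
  (forall q, M q -> x1 q = x1 p -> x2 q = x2 p -> x3 q = x3 p -> nbhs q V) ->
  exists2 d, 0 < d & forall q, M q -> `|x1 q - x1 p| < d -> `|x2 q - x2 p| < d ->
    `|x3 q - x3 p| < d -> V q.
Proof.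
move=> Mp HV; pose k := `|x1 p| + `|x2 p| + `|x3 p| + 1.
pose P (A : set T) := exists2 d, 0 < d & forall q, A q -> M q ->
  `|x1 q - x1 p| < d -> `|x2 q - x2 p| < d -> `|x3 q - x3 p| < d -> V q.
have sep (q : T) (f : T -> R) : f = x1 \/ f = x2 \/ f = x3 ->
    {for q, continuous f} -> f q != f p -> exists2 W, nbhs q W & P W.
  move=> fE cf fq; have [d d0 Hd] := near_separated cf fq.
  exists [set q' | d <= `|f q' - f p|] => //; exists d => // q' /= h _ h1 h2 h3.
  have : `|f q' - f p| < d by case: fE => [|[]] ->.
  by rewrite ltNge h.
have : P (box k).
  apply: compact_local_induction.
  - exact: properM.
  - by move=> A B AB [d d0 Hd]; exists d => // q /AB; exact: Hd.
  - by exists 1.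
  - move=> A B [d d0 Hd] [d' d'0 Hd']; exists (Num.min d d').
      by rewrite lt_min d0.
    move=> q + Mq; rewrite !lt_min => AB /andP[? ?] /andP[? ?] /andP[? ?].
    by case: AB => ?; [apply: Hd|apply: Hd'].
  - move=> q [Mq _ _ _].
    have [e1|] := eqVneq (x1 q) (x1 p); last by apply: sep; [left|exact: cx1].
    have [e2|] := eqVneq (x2 q) (x2 p); last by apply: sep; [right; left|exact: cx2].
    have [e3|] := eqVneq (x3 q) (x3 p); last by apply: sep; [right; right|exact: cx3].
    by exists V; [exact: HV|exists 1].
move=> [d d0 Hd]; exists (Num.min d 1); first by rewrite lt_min d0 ltr01.
move=> q Mq; rewrite !lt_min => /andP[h1 k1] /andP[h2 k2] /andP[h3 k3].
apply: Hd => //; split => //.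
- have := ler_normD (x1 q - x1 p) (x1 p); rewrite subrK /k.
  have := normr_ge0 (x2 p); have := normr_ge0 (x3 p); lra.
- have := ler_normD (x2 q - x2 p) (x2 p); rewrite subrK /k.
  have := normr_ge0 (x1 p); have := normr_ge0 (x3 p); lra.
- have := ler_normD (x3 q - x3 p) (x3 p); rewrite subrK /k.
  have := normr_ge0 (x1 p); have := normr_ge0 (x2 p); lra.
Qed.

(** The height is a function of [(x1, x2)] with a closed graph. *)
Lemma graph_closed (p : T) (K e : R) : M p -> 0 < e ->
  exists2 d, 0 < d & forall q, M q -> `|x1 q - x1 p| < d -> `|x2 q - x2 p| < d ->
    `|x3 q| <= K -> `|x3 q - x3 p| < e.
Proof.
move=> Mp e0; pose k := `|x1 p| + `|x2 p| + `|K| + 1.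
pose P (A : set T) := exists2 d, 0 < d & forall q, A q -> M q ->
  `|x1 q - x1 p| < d -> `|x2 q - x2 p| < d -> `|x3 q - x3 p| < e.
have sep (q : T) (f : T -> R) : f = x1 \/ f = x2 ->
    {for q, continuous f} -> f q != f p -> exists2 W, nbhs q W & P W.
  move=> fE cf fq; have [d d0 Hd] := near_separated cf fq.
  exists [set q' | d <= `|f q' - f p|] => //; exists d => // q' /= h _ h1 h2.
  have : `|f q' - f p| < d by case: fE => ->.
  by rewrite ltNge h.
have : P (box k).
  apply: compact_local_induction.
  - exact: properM.
  - by move=> A B AB [d d0 Hd]; exists d => // q /AB; exact: Hd.
  - by exists 1.
  - move=> A B [d d0 Hd] [d' d'0 Hd']; exists (Num.min d d').
      by rewrite lt_min d0.
    move=> q + Mq; rewrite !lt_min => AB /andP[? ?] /andP[? ?].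
    by case: AB => ?; [apply: Hd|apply: Hd'].
  - move=> q [Mq _ _ _].
    have [e1|] := eqVneq (x1 q) (x1 p); last by apply: sep; [left|exact: cx1].
    have [e2|] := eqVneq (x2 q) (x2 p); last by apply: sep; [right|exact: cx2].
    have e3 := graphM Mq Mp e1 e2.
    exists [set q' | `|x3 q' - x3 p| < e]; last by exists 1.
    by rewrite -e3; apply: continuous_dist => //; exact: cx3.
move=> [d d0 Hd]; exists (Num.min d 1); first by rewrite lt_min d0 ltr01.
move=> q Mq; rewrite !lt_min => /andP[h1 k1] /andP[h2 k2] qK.
apply: (Hd q) => //; split => //.
- have := ler_normD (x1 q - x1 p) (x1 p); rewrite subrK /k.
  have := normr_ge0 (x2 p); have := normr_ge0 K; lra.
- have := ler_normD (x2 q - x2 p) (x2 p); rewrite subrK /k.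
  have := normr_ge0 (x1 p); have := normr_ge0 K; lra.
- rewrite (le_trans qK)// /k.
  have := normr_ge0 (x1 p); have := normr_ge0 (x2 p); have := ler_norm K; lra.
Qed.

Hypothesis sardM : forall q, M q -> exists2 V, nbhs q V &
  forall k s, 0 < k -> nowhere_dense2 (bad_values V k s).

Lemma bad_values_nowhere_dense k s : 0 < k -> nowhere_dense2 (bad_values setT k s).
Proof.
move=> k0; have : nowhere_dense2 (bad_values (box k) k s).
  pose P (A : set T) := nowhere_dense2 (bad_values A k s).
  apply: (@compact_local_induction _ (box k) P).
  - exact: properM.
  - move=> A B AB; apply: nowhere_dense2S => _ [q [Aq bq kq nq] <-].
    by exists q => //; split => //; exact: AB.
  - apply: nowhere_dense2S nowhere_dense2_0 => _ [q [[]]].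
  - move=> A B ndA ndB; apply: nowhere_dense2S (nowhere_dense2U ndA ndB).
    by move=> _ [q [[Aq|Bq] bq kq nq] <-]; [left|right]; exists q.
  - by move=> q [Mq _ _ _]; have [V qV HV] := sardM Mq; exists V => //; exact: HV.
apply: nowhere_dense2S => _ [q [_ bq kq nq] <-].
by exists q.
Qed.

(** On the segment from the centre to [q], of slope [m], the height is Lipschitz
    if [m] is generic. *)
Lemma ray_lip (q q' : T) (s m th : R) : M q -> M q' -> 0 < s -> x1 q != 0 ->
  (forall th, 0 <= th <= 1 -> exists2 p, M p & x1 p = th * x1 q /\ x2 p = th * x2 q) ->
  x2 q = m * x1 q -> 1 + m ^+ 2 <= s ^+ 2 ->
  (forall k : nat, codense [set y | bad_values setT k.+1%:R s (m, y)]) ->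
  (forall k : nat, codense [set y | bad_values setT k.+1%:R (- s) (m, y)]) ->
  0 < th <= 1 -> x1 q' = th * x1 q -> x2 q' = th * x2 q ->
  `|x3 q - x3 q'| <= s * `|x1 q| * (1 - th).
Proof.
move=> Mq Mq' s0 q0 star qm sm gen1 gen2 /andP[th0 th1] e1 e2.
have {}star' (t : R) : exists p, 0 <= t <= 1 -> [/\ M p, x1 p = t * x1 q & x2 p = t * x2 q].
  have [/star[p Mp [h1 h2]]|nt] := pselect (0 <= t <= 1); first by exists p.
  by exists q.
have [ga Hga] := choice star'.
pose v t := x3 (ga t).
have I01 t : th <= t <= 1 -> 0 <= t <= 1.
  by move=> /andP[h ->]; rewrite (le_trans (ltW th0) h).
have v1 : v 1 = x3 q.
  have [|h1 h2 h3] := Hga 1; first by rewrite ler01 lexx.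
  by apply: graphM => //; rewrite ?h2 ?h3 mul1r.
have vth : v th = x3 q'.
  have [|h1 h2 h3] := Hga th; first by rewrite ltW.
  by apply: graphM => //; rewrite ?h2 ?h3.
rewrite -v1 -vth; pose c := `|x1 q| + `|x2 q| + 1.
have c0 : 0 < c by rewrite ltr_pwDr// addr_ge0.
have cd (t u d : R) : `|u - t| < d / c ->
    `|u * x1 q - t * x1 q| < d /\ `|u * x2 q - t * x2 q| < d.
  rewrite ltr_pdivlMr// => h; rewrite -!mulrBl !normrM.
  split; apply: le_lt_trans h; apply: ler_wpM2l => //; rewrite /c.
    by have := normr_ge0 (x2 q); lra.
  by have := normr_ge0 (x1 q); lra.
have a0 : 0 < `|x1 q| by rewrite normr_gt0.
apply: closed_graph_lip => //; first by rewrite mulr_ge0// ltW.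
  move=> t tI K e e0; have [Mt t1 t2] := Hga t (I01 t tI).
  have [d d0 Hd] := graph_closed K Mt e0.
  exists (d / c); first by rewrite divr_gt0.
  move=> u uI /cd[h1 h2] uK; have [Mu u1 u2] := Hga u (I01 u uI).
  by apply: Hd => //; rewrite ?u1 ?u2 ?t1 ?t2.
move=> K.
pose k0 := Num.truncn (`|K| + `|x1 q| + `|x2 q| + (th * `|x1 q|)^-1).
pose k := k0.+1.
have kb : `|K| + `|x1 q| + `|x2 q| + (th * `|x1 q|)^-1 <= k%:R.
  exact: ltW (truncnS_gt _).
have i0 : 0 < (th * `|x1 q|)^-1 by rewrite invr_gt0 mulr_gt0.
have n1 := normr_ge0 (x1 q); have n2 := normr_ge0 (x2 q); have n3 := normr_ge0 K.
pose sg := if 0 < x1 q then s else - s.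
have sgE : s * `|x1 q| = sg * x1 q.
  rewrite /sg; case: ltP => h; first by rewrite gtr0_norm.
  by rewrite ler0_norm// mulrN mulNr.
exists [set y | bad_values setT k%:R sg (m, y)], [set y | bad_values setT k%:R (- sg) (m, y)].
split.
- by rewrite /sg; case: ifP => _; [exact: (gen1 k0)|exact: (gen2 k0)].
- by rewrite /sg; case: ifP => _; rewrite ?opprK; [exact: (gen2 k0)|exact: (gen1 k0)].
move=> t tI vK Hbad; have [Mt t1 t2] := Hga t (I01 t tI).
have /andP[tth t11] := tI; have t0 : 0 < t by rewrite (lt_le_trans th0).
pose V := [set p | (x3 p - x3 (ga t)) ^+ 2 <=
  (x1 p - x1 (ga t)) ^+ 2 + (x2 p - x2 (ga t)) ^+ 2].
have HV p : M p -> x1 p = x1 (ga t) -> x2 p = x2 (ga t) -> x3 p = x3 (ga t) -> nbhs p V.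
  move=> Mp p1 p2 p3; suff : spacelike_chords p by rewrite /spacelike_chords p1 p2 p3.
  apply: contrapT => nsp.
  have bp : box k%:R p.
    split; rewrite // ?p1 ?p2 ?p3 ?t1 ?t2 ?normrM ?(gtr0_norm t0).
    - by rewrite (le_trans (ler_piMl _ t11))//; lra.
    - by rewrite (le_trans (ler_piMl _ t11))//; lra.
    - by move: vK (ler_norm K); rewrite /v; lra.
  have kp : k%:R^-1 <= `|x1 p|.
    rewrite p1 t1 normrM (gtr0_norm t0).
    apply: (le_trans (y := th * `|x1 q|)); last by rewrite ler_wpM2r.
    have kp0 : 0 < k%:R :> R by rewrite ltr0n.
    by rewrite invf_ple ?posrE ?mulr_gt0//; lra.
  have mE : x2 p / x1 p = m.
    by rewrite p1 p2 t1 t2 qm; field; rewrite q0 gt_eqF.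
  case: Hbad => h; apply: h; exists p.
  - by split.
  - by rewrite mE p3 p1 t1 /v sgE; congr pair; ring.
  - by split.
  - by rewrite mE p3 p1 t1 /v sgE; congr pair; ring.
have [d d0 Hd] := proper_nbhs Mt HV.
exists (Num.min d (d / c)); first by rewrite lt_min d0 divr_gt0.
move=> u uI; rewrite !lt_min => /andP[_ /cd[h1 h2]] /andP[h3 _].
have [Mu u1 u2] := Hga u (I01 u uI).
have := Hd (ga u) Mu; rewrite u1 u2 t1 t2 => /(_ h1 h2 h3).
rewrite /V /= u1 u2 t1 t2 -/(v u) -/(v t) => h.
rewrite -(@ler_pXn2r _ 2)// ?nnegrE ?mulr_ge0 ?(ltW s0)//.
rewrite !exprMn !real_normK ?num_real//.
rewrite (le_trans h)// -!mulrBl !exprMn qm exprMn.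
have -> : (u - t) ^+ 2 * x1 q ^+ 2 + (u - t) ^+ 2 * (m ^+ 2 * x1 q ^+ 2) =
  (1 + m ^+ 2) * (x1 q ^+ 2 * (u - t) ^+ 2) by ring.
by rewrite -[leRHS]mulrA ler_wpM2r// mulr_ge0// sqr_ge0.
Qed.

Hypothesis starM : forall p th, M p -> 0 <= th <= 1 ->
  exists2 q, M q & x1 q = th * x1 p /\ x2 q = th * x2 p.

(** The projection is open at a dense set of points of [M]. *)
Hypothesis openM : forall p V, M p -> nbhs p V -> exists p' d,
  [/\ M p', V p', 0 < d & forall y1 y2, `|y1 - x1 p'| < d -> `|y2 - x2 p'| < d ->
    exists q, [/\ M q, V q, x1 q = y1 & x2 q = y2]].

Lemma radius_continuous p : M p -> {for p, continuous radius}.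
Proof.
move=> Mp; apply: continuous_comp; last exact: sqrt_continuous.
by apply: cvgD; apply: cvgM; (exact: cx1 || exact: cx2).
Qed.

Lemma slope_lip (m m' : R) : `|Num.sqrt (1 + m' ^+ 2) - Num.sqrt (1 + m ^+ 2)| <= `|m' - m|.
Proof.
wlog mm : m m' / Num.sqrt (1 + m ^+ 2) <= Num.sqrt (1 + m' ^+ 2).
  move=> H; have [/H//|/ltW/H] := leP (Num.sqrt (1 + m ^+ 2)) (Num.sqrt (1 + m' ^+ 2)).
  by rewrite distrC (distrC m).
rewrite ger0_norm ?subr_ge0// lerBlDr.
have p0 (x : R) : 0 <= 1 + x ^+ 2 by rewrite addr_ge0// sqr_ge0.
have mL : `|m| <= Num.sqrt (1 + m ^+ 2).
  by rewrite -sqrtr_sqr ler_sqrt// lerDr.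
rewrite -(@ler_pXn2r _ 2)// ?nnegrE ?addr_ge0 ?sqrtr_ge0//.
rewrite sqrrD !sqr_sqrtr// real_normK ?num_real//.
have : m * (m' - m) <= `|m' - m| * Num.sqrt (1 + m ^+ 2).
  by rewrite (le_trans (ler_norm _))// normrM mulrC ler_wpM2l.
by rewrite -mulr_natr; lra.
Qed.

(** The height gains at most [radius p - r] between the radius [r] and [p].
    This holds along the generic rays, with a constant arbitrarily close to
    one, and then along every ray, as the projection is open on a dense set. *)
Lemma cone_estimate (r eps : R) : 0 < r -> 0 < eps ->
  (forall p, M p -> radius p <= r -> `|x3 p| <= (1 - eps) * radius p) ->
  forall p, M p -> r <= radius p -> `|x3 p| <= radius p - eps * r.
Proof.
move=> r0 eps0 base p Mp rp; rewrite leNgt; apply/negP => bad.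
have [rpr|rltp] := leP (radius p) r.
  have rE : radius p = r by apply/eqP; rewrite eq_le rpr.
  by have := base p Mp rpr; rewrite rE in bad *; lra.
pose eta := (`|x3 p| - (radius p - eps * r)) / 2.
have eta0 : 0 < eta by rewrite divr_gt0// subr_gt0.
pose V := [set q | [/\ radius q - eps * r + eta < `|x3 q|, r < radius q &
  radius q < radius p + 1]].
have cr := radius_continuous Mp.
have pV : nbhs p V.
  pose e := Num.min (eta / 2) (Num.min (radius p - r) 1).
  have e0 : 0 < e by rewrite !lt_min subr_gt0 rltp ltr01 divr_gt0.
  have [ee [er e1]] : e <= eta / 2 /\ e <= radius p - r /\ e <= 1.
    by rewrite /e !ge_min !lexx !orbT.
  near=> q.
  have hr : `|radius q - radius p| < e by near: q; exact: continuous_dist.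
  have h3 : `|x3 q - x3 p| < e by near: q; apply: continuous_dist => //; exact: cx3.
  have := ler_normD (x3 p - x3 q) (x3 q); rewrite subrK (distrC (x3 p)).
  move: hr; rewrite ltr_norml => /andP[hr1 hr2]; move: h3 => h3 hn.
  have e2 : `|x3 p| = radius p - eps * r + 2 * eta.
    by rewrite /eta; field.
  by split; lra.
have [p' [d [Mp' Vp' d0 Hd]]] := openM Mp pV.
have [y1 y1d y10] : exists2 y1, `|y1 - x1 p'| < d & y1 != 0.
  have [E|n0] := eqVneq (x1 p') 0; last by exists (x1 p') => //; rewrite subrr normr0.
  exists (d / 2); last by rewrite gt_eqF// divr_gt0.
  by rewrite E subr0 gtr0_norm ?divr_gt0// ltr_pdivrMr//; lra.
pose m1 := x2 p' / y1.
pose kap := eta / (2 * (radius p + 2)).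
have rp2 : 0 < 2 * (radius p + 2) by rewrite mulr_gt0// ltr_wpDl// sqrtr_ge0.
have kap0 : 0 < kap by rewrite divr_gt0.
pose s := Num.sqrt (1 + m1 ^+ 2) + kap.
have s0 : 0 < s by rewrite ltr_wpDl// sqrtr_ge0.
have ny : 0 < `|y1| by rewrite normr_gt0.
pose N (k : nat) := bad_values setT k.+1%:R s `|` bad_values setT k.+1%:R (- s).
have ndN k : nowhere_dense2 (N k).
  by apply: nowhere_dense2U; apply: bad_values_nowhere_dense; rewrite ltr0n.
have m1lt : m1 < m1 + Num.min kap (d / `|y1|).
  by rewrite ltrDl lt_min kap0 divr_gt0.
(* a generic slope close to that of [p'] *)
have [m /andP[m1m mm1] gen] := nowhere_dense_sections ndN m1lt.
have [mk md] : `|m - m1| <= kap /\ `|m - m1| < d / `|y1|.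
  have : m - m1 < Num.min kap (d / `|y1|) by rewrite ltrBlDl.
  by rewrite lt_min (gtr0_norm (x := m - m1)) ?subr_gt0// => /andP[/ltW].
have [|q [Mq [Vq1 Vq2 Vq3] q1 q2]] := Hd y1 (m * y1) y1d.
  have -> : m * y1 - x2 p' = (m - m1) * y1 by rewrite /m1; field.
  by rewrite normrM -ltr_pdivlMr.
have rq0 : 0 < radius q by rewrite (lt_trans r0).
pose th := r / radius q.
have thI : 0 < th <= 1 by rewrite divr_gt0//= ler_pdivrMr// mul1r ltW.
(* the point of radius [r] on the ray of [q] *)
have [q' Mq' [e1 e2]] : exists2 q', M q' & x1 q' = th * x1 q /\ x2 q' = th * x2 q.
  by apply: starM => //; case/andP: thI => /ltW ->.
have rq' : radius q' = r.
  have -> : radius q' = Num.sqrt (th ^+ 2 * (x1 q ^+ 2 + x2 q ^+ 2)).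
    by rewrite /radius e1 e2; congr Num.sqrt; ring.
  rewrite sqrtrM ?sqr_ge0// sqrtr_sqr -/(radius q).
  by rewrite gtr0_norm ?divr_gt0// /th divfK// gt_eqF.
have Lm := slope_lip m1 m.
have sL : Num.sqrt (1 + m ^+ 2) <= s /\ s <= Num.sqrt (1 + m ^+ 2) + 2 * kap.
  move: (le_trans Lm mk); rewrite ler_norml /s => /andP[h1 h2].
  by clear -h1 h2; split; lra.
have m20 : 0 <= 1 + m ^+ 2 by rewrite addr_ge0// sqr_ge0.
have h := @ray_lip q q' s m th Mq Mq' s0 _ _ _ _ _ _ thI e1 e2.
have {}h : `|x3 q - x3 q'| <= s * `|x1 q| * (1 - th).
  apply: h.
  - by rewrite q1.
  - by move=> t; exact: starM.
  - by rewrite q1 q2.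
  - rewrite -(sqr_sqrtr m20) ler_pXn2r// ?nnegrE ?sqrtr_ge0 ?(ltW s0)//; tauto.
  - move=> k a b ab; have [y yab ny'] := gen k a b ab; exists y => // hy.
    by apply: ny'; left.
  - move=> k a b ab; have [y yab ny'] := gen k a b ab; exists y => // hy.
    by apply: ny'; right.
have rqE : radius q = Num.sqrt (1 + m ^+ 2) * `|y1|.
  rewrite /radius q1 q2 -sqrtr_sqr -sqrtrM//; congr Num.sqrt; ring.
have b' := base q' Mq'; rewrite rq' in b'; have {}b' := b' (lexx r).
have y1r : `|y1| <= radius p + 1.
  rewrite (le_trans _ (ltW Vq3))// rqE ler_peMl//.
  by rewrite -[leLHS]sqrtr1 ler_sqrt// lerDl sqr_ge0.
have th1 : 0 <= 1 - th by rewrite subr_ge0; case/andP: thI.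
have h2 : s * `|x1 q| * (1 - th) <= radius q - r + eta.
  rewrite q1; apply: (le_trans (y := (Num.sqrt (1 + m ^+ 2) + 2 * kap) * `|y1| * (1 - th))).
    by rewrite ler_wpM2r// ler_wpM2r//; tauto.
  rewrite 2!mulrDl -rqE lerD//.
    by rewrite mulrBr mulr1 /th mulrCA divff ?mulr1// gt_eqF.
  apply: (le_trans (y := 2 * kap * `|y1|)).
    have th1' : 1 - th <= 1 by rewrite lerBlDr lerDl; case/andP: thI => /ltW.
    have k2 : 0 <= 2 * kap by rewrite mulr_ge0// ltW.
    by rewrite ler_piMr// mulr_ge0.
  have y1r' : `|y1| <= radius p + 2 by rewrite (le_trans y1r)// lerD2l ler1n.
  apply: (le_trans (y := 2 * kap * (radius p + 2))).
    by rewrite ler_wpM2l// mulr_ge0// ltW.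
  by rewrite mulrAC /kap mulrC divfK// gt_eqF.
have := ler_normD (x3 q - x3 q') (x3 q'); rewrite subrK.
by move: Vq1; lra.
Unshelve. all: by end_near. Qed.

End ProperGraph.

(** * Twice differentiable functions on the complex plane *)


Section ComplexPlane.
Local Open Scope complex_scope.
Context {R : realType}.
Implicit Types (z w : Cplx R) (f : Cplx R -> R).

Notation Re := (@complex.Re R).
Notation Im := (@complex.Im R).

(** The neighbourhoods of a complex number, with squares instead of discs and a
    real radius. *)
Lemma nearCP z0 (A : set (Cplx R)) :
  nbhs z0 A <->
  exists2 e : R, 0 < e &
    forall z, `|Re z - Re z0| < e -> `|Im z - Im z0| < e -> A z.
Proof.
have normE (z : Cplx R) : `|z| = (Num.sqrt (Re z ^+ 2 + Im z ^+ 2))%:C.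
  exact: (normc_def z).
have ReB (z z' : Cplx R) : Re (z - z') = Re z - Re z' by case: z z' => [? ?] [].
have ImB (z z' : Cplx R) : Im (z - z') = Im z - Im z' by case: z z' => [? ?] [].
split=> [/nbhs_ballP[e /= e0 eA]|[e e0 eA]].
  have eE : e = (Re e)%:C.
    by move: e0; rewrite ltcE/= => /andP[/eqP + _]; case: (e) => a b /= ->.
  have e'0 : 0 < Re e by move: e0; rewrite ltcE/= => /andP[].
  exists (Re e / 2); first by rewrite divr_gt0.
  move=> z hR hI; apply: eA; rewrite /ball/= eE normE ReB ImB ltcR.
  rewrite -(sqr_sqrtr (ltW e'0)) in hR hI *.
  have s0 := sqrtr_ge0 (Re e).
  rewrite -[ltRHS]ger0_norm ?sqr_ge0// -sqrtr_sqr ltr_sqrt; last first.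
    by rewrite exprn_gt0// exprn_gt0// sqrtr_gt0.
  move: hR hI; rewrite (distrC (Re z)) (distrC (Im z)).
  set u := Re z0 - Re z; set v := Im z0 - Im z; set r := Num.sqrt _ ^+ 2 => hu hv.
  have r0 : 0 <= r by rewrite /r sqr_ge0.
  have hu2 : u ^+ 2 <= (r / 2) ^+ 2.
    by rewrite -(real_normK (num_real u)) ler_pXn2r// ?nnegrE ?divr_ge0// ltW.
  have hv2 : v ^+ 2 < (r / 2) ^+ 2.
    by rewrite -(real_normK (num_real v)) ltr_pXn2r// ?nnegrE ?divr_ge0//.
  by have := sqr_ge0 r; nra.
apply/nbhs_ballP; exists e%:C; first by rewrite /= ltcR.
move=> z; rewrite /ball/= normE ReB ImB ltcR => h; apply: eA.
  rewrite distrC -sqrtr_sqr (le_lt_trans _ h)// ler_sqrt ?lerDl ?sqr_ge0//.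
  by rewrite addr_ge0// sqr_ge0.
rewrite distrC -sqrtr_sqr (le_lt_trans _ h)// ler_sqrt ?lerDr ?sqr_ge0//.
by rewrite addr_ge0// sqr_ge0.
Qed.

Lemma Re_continuous (z : Cplx R) : Re w @[w --> z] --> Re z.
Proof.
apply/(@cvgrPdist_lt _ _ _ (nbhs z)) => e e0; apply/nearCP; exists e => // w + _.
by rewrite distrC.
Qed.

Lemma Im_continuous (z : Cplx R) : Im w @[w --> z] --> Im z.
Proof.
apply/(@cvgrPdist_lt _ _ _ (nbhs z)) => e e0; apply/nearCP; exists e => // w _.
by rewrite distrC.
Qed.

Lemma ReD z w : Re (z + w) = Re z + Re w. Proof. by case: z w => [? ?] []. Qed.
Lemma ImD z w : Im (z + w) = Im z + Im w. Proof. by case: z w => [? ?] []. Qed.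

Lemma Re_step b (t : R) : Re (step b t) = if b then 0 else t.
Proof. by case: b. Qed.
Lemma Im_step b (t : R) : Im (step b t) = if b then t else 0.
Proof. by case: b. Qed.

Lemma step0 b : step b (0 : R) = 0. Proof. by case: b. Qed.

Lemma stepD b (s t : R) : step b (s + t) = step b s + step b t.
Proof. by apply/eqP; rewrite eq_complex/= ReD ImD; case: b => /=; rewrite ?addr0 !eqxx. Qed.

(** The closed square of centre [z0] and half-side [r]. *)
Definition csquare z0 (r : R) : set (Cplx R) :=
  [set z | `|Re z - Re z0| <= r /\ `|Im z - Im z0| <= r].

Lemma csquare_nbhs z0 (r : R) : 0 < r -> nbhs z0 (csquare z0 r).
Proof. by move=> r0; apply/nearCP; exists r => // z h1 h2; split; exact: ltW. Qed.

Lemma csquare_compact z0 (r : R) : compact (csquare z0 r).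
Proof.
pose h (u : R * R) : Cplx R := u.1 +i* u.2.
have ch : continuous h.
  move=> u A /nearCP[e e0 eA].
  have c1 : fst v @[v --> u] --> u.1 by exact: cvg_fst.
  have c2 : snd v @[v --> u] --> u.2 by exact: cvg_snd.
  suff : nbhs u (h @^-1` A) by [].
  apply: filterS (filterI (continuous_dist c1 e0) (continuous_dist c2 e0)).
  by move=> v [h1 h2]; exact: eA.
have -> : csquare z0 r = h @` (`[Re z0 - r, Re z0 + r] `*` `[Im z0 - r, Im z0 + r]).
  apply/seteqP; split => [[x y] /= [h1 h2]|_ [[x y] /= [h1 h2] <-]].
    by exists (x, y) => //=; rewrite !in_itv/= -!ler_distl.
  by move: h1 h2; rewrite !in_itv/= -!ler_distl.
apply: continuous_compact; first exact: continuous_subspaceT.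
by apply: compact_setX; exact: segment_compact.
Qed.

Lemma slice_shift b f z (s t : R) : slice b f (z + step b s) t = slice b f z (s + t).
Proof. by rewrite /slice stepD addrA. Qed.

Lemma slice_is_derive b f z (t : R) : derivable (slice b f (z + step b t)) 0 1 ->
  is_derive t 1 (slice b f z) (partial b f (z + step b t)).
Proof.
move=> dv; have D : is_derive (0 : R) 1 (slice b f (z + step b t)) (partial b f (z + step b t)).
  by rewrite /partial derive1E; exact: derivableP.
have -> : slice b f z = slice b f (z + step b t) \o (fun s => s - t).
  by apply/funext => s; rewrite /= slice_shift addrC subrK.
rewrite -[partial _ _ _]mulr1; apply: is_derive1_comp; first by rewrite subrr.
have := is_deriveD (is_derive_id t 1) (is_derive_cst (- t) t 1).
by rewrite addr0.
Qed.

#[local] Opaque partial.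

Section C2.
Variables (W : set (Cplx R)) (f : Cplx R -> R).
Hypothesis fC : Ck_on 2 W f.

Lemma C2_continuous z : W z -> {for z, continuous f}.
Proof. by move=> Wz; have [] := fC Wz (s := [::]). Qed.

Lemma C2_partial_continuous b z : W z -> {for z, continuous (partial b f)}.
Proof. by move=> Wz; have [] := fC Wz (s := [:: b]). Qed.

Lemma C2_partial2_continuous b b' z : W z ->
  {for z, continuous (partial b (partial b' f))}.
Proof. by move=> Wz; have [] := fC Wz (s := [:: b; b']). Qed.

Lemma C2_slice b z t : W (z + step b t) ->
  is_derive t 1 (slice b f z) (partial b f (z + step b t)).
Proof. by move=> Wz; apply: slice_is_derive; have [//|_ dv] := fC Wz (s := [::]); exact: dv. Qed.

Lemma C2_slice_partial b b' z t : W (z + step b t) ->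
  is_derive t 1 (slice b (partial b' f) z) (partial b (partial b' f) (z + step b t)).
Proof. by move=> Wz; apply: slice_is_derive; have [//|_ dv] := fC Wz (s := [:: b']); exact: dv. Qed.

Lemma near_step b z : nbhs z W -> \forall t \near (0 : R), W (z + step b t).
Proof.
move=> /nearCP[e e0 eW]; apply/near0P; exists e => // t te.
by apply: eW; rewrite ?ReD ?ImD addrAC subrr add0r ?Re_step ?Im_step; case: b; rewrite ?normr0.
Qed.

Lemma C2_jet2 b z : nbhs z W ->
  jet2 (slice b f z) (partial b f z) (partial b (partial b f) z).
Proof.
move=> zW; exists (slice b (partial b f) z); split.
- by have := near_step b zW; apply: filterS => t; exact: C2_slice.
- by rewrite /slice step0 addr0.
- have := @C2_slice_partial b b z 0; rewrite step0 addr0; apply.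
  exact: nbhs_singleton.
Qed.

(** First-order Taylor expansion, with a remainder that is uniformly quadratic
    on a small square. *)
Lemma C2_taylor z0 : nbhs z0 W -> exists r C : R, [/\ 0 < r, 0 < C,
  csquare z0 r `<=` W,
  forall b z, csquare z0 r z -> `|partial b f z| <= C &
  forall z z' e, csquare z0 r z -> csquare z0 r z' ->
    `|Re z' - Re z| <= e -> `|Im z' - Im z| <= e ->
    `|f z' - f z - (partial false f z * (Re z' - Re z) +
                    partial true f z * (Im z' - Im z))| <= C * e ^+ 2].
Proof.
move=> z0W; have Wz0 := nbhs_singleton z0W.
have bnd (g : Cplx R -> R) : {for z0, continuous g} ->
    \forall z \near z0, `|g z| <= `|g z0| + 1.
  move=> /continuous_dist/(_ ltr01); apply: filterS => z h.
  by have := ler_normD (g z - g z0) (g z0); rewrite subrK; lra.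
have [a aE] : exists a : bool -> R, forall b, `|partial b f z0| = a b by exists (fun b => `|partial b f z0|).
have [c cE] : exists c : bool -> bool -> R, forall b b', `|partial b (partial b' f) z0| = c b b'.
  by exists (fun b b' => `|partial b (partial b' f) z0|).
have a0 b : 0 <= a b by rewrite -(aE b).
have c0 b b' : 0 <= c b b' by rewrite -(cE b b').
have [B [B0 B1 B2]] : exists B : R, [/\ 0 < B, forall b, a b + 1 <= B & forall b b', c b b' + 1 <= B].
  have a1 := a0 false; have a2 := a0 true; have c1 := c0 false false.
  have c2 := c0 false true; have c3 := c0 true false; have c4 := c0 true true.
  exists (1 + a false + a true + c false false + c false true + c true false + c true true).
  by clear -a1 a2 c1 c2 c3 c4; split; [lra|case; lra|case; case; lra].
have A1 b : `|partial b f z0| + 1 <= B by have := B1 b; rewrite -(aE b).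
have A2 b b' : `|partial b (partial b' f) z0| + 1 <= B by have := B2 b b'; rewrite -(cE b b').
have [r0 r00 Hr] : exists2 e : R, 0 < e & forall z, `|Re z - Re z0| < e ->
    `|Im z - Im z0| < e -> [/\ W z, forall b, `|partial b f z| <= B &
    forall b b', `|partial b (partial b' f) z| <= B].
  have n1 b : \forall z \near z0, `|partial b f z| <= B.
    apply: filterS (bnd _ (@C2_partial_continuous b _ Wz0)) => z h.
    exact: le_trans h (A1 b).
  have n2 b b' : \forall z \near z0, `|partial b (partial b' f) z| <= B.
    apply: filterS (bnd _ (@C2_partial2_continuous b b' _ Wz0)) => z h.
    exact: le_trans h (A2 b b').
  have fI (A B : set (Cplx R)) := @filterI _ _ (nbhs_filter z0) A B.
  have := fI _ _ z0W (fI _ _ (fI _ _ (n1 false) (n1 true))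
    (fI _ _ (fI _ _ (n2 false false) (n2 false true)) (fI _ _ (n2 true false) (n2 true true)))).
  move=> /nearCP[e e0 He]; exists e => // z hR hI.
  have [h0 [[h1 h2] [[h3 h4] [h5 h6]]]] := He z hR hI.
  split; [exact: h0|by case; [exact: h2|exact: h1]|].
  by case; case; [exact: h6|exact: h5|exact: h4|exact: h3].
pose r := r0 / 4; have rr : r + 2 * r < r0 by rewrite /r; lra.
have rp : 0 < r by rewrite divr_gt0.
have Hsq z b s : csquare z0 r z -> `|s| <= 2 * r -> [/\ W (z + step b s),
    forall b', `|partial b' f (z + step b s)| <= B &
    forall b' b'', `|partial b' (partial b'' f) (z + step b s)| <= B].
  move=> [h1 h2] sr; apply: Hr; rewrite ?ReD ?ImD ?Re_step ?Im_step.
    rewrite addrAC (le_lt_trans (ler_normD _ _))// (le_lt_trans _ rr)// lerD//.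
    by case: b => //; rewrite normr0 mulr_ge0// ltW.
  rewrite addrAC (le_lt_trans (ler_normD _ _))// (le_lt_trans _ rr)// lerD//.
  by case: b => //; rewrite normr0 mulr_ge0// ltW.
have Hsq0 z : csquare z0 r z -> [/\ W z, forall b', `|partial b' f z| <= B &
    forall b' b'', `|partial b' (partial b'' f) z| <= B].
  move=> zr; have := @Hsq z true 0 zr; rewrite step0 addr0 normr0; apply.
  by rewrite mulr_ge0// ltW.
have mvf z b t : csquare z0 r z -> `|t| <= 2 * r ->
    exists2 s, `|s| <= `|t| & f (z + step b t) - f z = partial b f (z + step b s) * t.
  move=> zr tr; have [s st E] := @mean_value R (slice b f z)
    (fun s => partial b f (z + step b s)) t (fun s st => C2_slice
      (let: And3 Ws _ _ := Hsq z b s zr (le_trans st tr) in Ws)).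
  by exists s => //; rewrite -E /slice step0 addr0.
have mvp z b b' t : csquare z0 r z -> `|t| <= 2 * r ->
    `|partial b' f (z + step b t) - partial b' f z| <= B * `|t|.
  move=> zr tr; have [s st E] := @mean_value R (slice b (partial b' f) z)
    (fun s => partial b (partial b' f) (z + step b s)) t (fun s st => C2_slice_partial b'
      (let: And3 Ws _ _ := Hsq z b s zr (le_trans st tr) in Ws)).
  have -> : partial b' f (z + step b t) - partial b' f z = partial b (partial b' f) (z + step b s) * t.
    by rewrite -E /slice step0 addr0.
  rewrite normrM ler_wpM2r//.
  by have [_ _] := Hsq z b s zr (le_trans st tr); apply.
exists r, (4 * B); split => //.
- by rewrite mulr_gt0.
- by move=> z /Hsq0[].
- by move=> b z /Hsq0[_ /(_ b) h _]; rewrite (le_trans h)// ler_peMl ?ler1n// ltW.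
move=> z z' e sz sz' hR hI.
set u := Re z' - Re z; set v := Im z' - Im z.
have tri (x y d : R) : `|x - d| <= r -> `|y - d| <= r -> `|x - y| <= 2 * r.
  by move=> h1 h2; have := ler_distD d x y; rewrite (distrC d y); lra.
have u2 : `|u| <= 2 * r by apply: (tri _ _ (Re z0)); [case: sz'|case: sz].
have v2 : `|v| <= 2 * r by apply: (tri _ _ (Im z0)); [case: sz'|case: sz].
pose z1 := z + step false u.
have Rz1 : Re z1 = Re z' by rewrite /z1 ReD /= /u addrC subrK.
have Iz1 : Im z1 = Im z by rewrite /z1 ImD /= addr0.
have sz1 : csquare z0 r z1.
  by split; rewrite ?Rz1 ?Iz1; [case: sz'|case: sz].
have z'E : z' = z1 + step true v.
  by apply/eqP; rewrite eq_complex ReD ImD Rz1 Iz1 /= addr0 /v addrC subrK !eqxx.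
have [s su E1] := mvf z false u sz u2.
have [t tv E2] := mvf z1 true v sz1 v2.
have F1 := mvp z false false s sz (le_trans su u2).
have F2 := mvp z1 true true t sz1 (le_trans tv v2).
have F3 := mvp z false true u sz u2.
have -> : f z' - f z - (partial false f z * u + partial true f z * v) =
    (partial false f (z + step false s) - partial false f z) * u +
    ((partial true f (z1 + step true t) - partial true f z1) * v +
     (partial true f z1 - partial true f z) * v).
  rewrite [in RHS]mulrBl -E1 [in RHS]mulrBl [in RHS]mulrBl -E2 -z'E.
  by move: (f z) (f z') (f z1) => *; ring.
have e0 : 0 <= e by exact: le_trans hR.
have pr (x a1' b1' : R) : `|x| <= B * a1' -> a1' <= e -> `|b1'| <= e -> `|x * b1'| <= B * e ^+ 2.
  move=> hx ha hb; rewrite normrM expr2 mulrA ler_pM//.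
  by rewrite (le_trans hx)// ler_wpM2l// ltW.
have G1 := pr _ _ _ F1 (le_trans su hR) hR.
have G2 := pr _ _ _ F2 (le_trans tv hI) hI.
have G3 := pr _ _ _ F3 hR hI.
rewrite (le_trans (ler_normD _ _))//.
have := ler_normD ((partial true f (z1 + step true t) - partial true f z1) * v)
  ((partial true f z1 - partial true f z) * v).
have : 0 <= B * e ^+ 2 by rewrite mulr_ge0 ?sqr_ge0// ltW.
rewrite -/z1 in G3; rewrite -[4 * B * _]mulrA; move: G1 G2 G3; clear; lra.
Qed.

End C2.

End ComplexPlane.

(** * Conformal spacelike surfaces in charts *)


Section Charts.
Local Open Scope complex_scope.
Context {R : realType} {T : topologicalType} (S : riemann_surface R T).

Notation Re := (@complex.Re R).
Notation Im := (@complex.Im R).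

Section OneChart.
Variables (c : chart R T).
Hypothesis Sc : atlas S c.

Lemma paramK z : cimg c z -> cdom c (param c z) /\ coord c (param c z) = z.
Proof. by move=> [p cp <-]; rewrite (coordK Sc cp). Qed.

Lemma param_nbhs q (V : set T) : cdom c q -> nbhs q V ->
  nbhs (coord c q) (param c @^-1` V).
Proof.
move=> cq qV; have zi : cimg c (coord c q) by exists q.
have h : param c w @[w --> coord c q] --> param c (coord c q) := param_continuous Sc zi.
by rewrite (coordK Sc cq) in h; exact: h.
Qed.

Lemma coord_nbhs q (A : set (Cplx R)) : cdom c q -> nbhs (coord c q) A ->
  nbhs q (cdom c `&` coord c @^-1` A).
Proof.
move=> cq qA; apply: filterI; last exact: (coord_continuous Sc cq).
by apply: open_nbhs_nbhs; split => //; exact: cdom_open Sc.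
Qed.

Lemma chart_nbhs (U : set T) q : open U -> U q -> cdom c q ->
  nbhs (coord c q) (coord c @` (cdom c `&` U)).
Proof.
move=> oU Uq cq.
have h1 : nbhs (coord c q) (cimg c).
  by apply: open_nbhs_nbhs; split; [exact: cimg_open Sc|exists q].
have h2 := param_nbhs cq (open_nbhs_nbhs (conj oU Uq)).
apply: (@filterS _ _ (nbhs_filter (coord c q))); last first.
  exact: (@filterI _ _ (nbhs_filter (coord c q)) _ _ h1 h2).
move=> z [/paramK[h3 h4] h5]; by exists (param c z).
Qed.

Lemma surface_continuous k (U : set T) (f : T -> R) q : open U -> U q -> cdom c q ->
  Ck_surface S k U f -> {for q, continuous f}.
Proof.
move=> oU Uq cq /(_ c Sc) fC.
have [cf _] := fC (coord c q) (ex_intro2 _ _ q (conj cq Uq) erefl) [::] (leq0n k).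
rewrite /= in cf.
move=> A fA; rewrite -(coordK Sc cq) in fA.
apply: filterS (coord_nbhs cq (cf A fA)) => p [cp].
by rewrite /= (coordK Sc cp).
Qed.

End OneChart.

(** Two proportional linear forms on the plane: one dominates the other. *)
Lemma proportional_forms (a1 b1 a2 b2 : R) : a1 * b2 = a2 * b1 ->
  (forall x y, `|a2 * x + b2 * y| <= `|a1 * x + b1 * y|) \/
  (forall x y, `|a1 * x + b1 * y| <= `|a2 * x + b2 * y|).
Proof.
wlog N12 : a1 b1 a2 b2 / a2 ^+ 2 + b2 ^+ 2 <= a1 ^+ 2 + b1 ^+ 2.
  move=> H E; have [h|/ltW h] := leP (a2 ^+ 2 + b2 ^+ 2) (a1 ^+ 2 + b1 ^+ 2).
    exact: H.
  by have [] := H _ _ _ _ h (esym E); [right|left].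
move=> E; left => x y.
have [N0|N0] := eqVneq (a1 ^+ 2 + b1 ^+ 2) 0.
  have : a2 ^+ 2 + b2 ^+ 2 = 0.
    by apply/eqP; rewrite eq_le -{1}N0 N12 addr_ge0 ?sqr_ge0.
  move/eqP; rewrite paddr_eq0 ?sqr_ge0// !sqrf_eq0 => /andP[/eqP -> /eqP ->].
  by rewrite !mul0r addr0 normr0.
have Np : 0 < a1 ^+ 2 + b1 ^+ 2 by rewrite lt_neqAle eq_sym N0 addr_ge0 ?sqr_ge0.
rewrite -(@ler_pXn2r _ 2)// ?nnegrE// !real_normK ?num_real//.
rewrite -(ler_pM2r Np).
have -> : (a2 * x + b2 * y) ^+ 2 * (a1 ^+ 2 + b1 ^+ 2) =
    (a1 * x + b1 * y) ^+ 2 * (a2 ^+ 2 + b2 ^+ 2) +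
    (a1 * b2 - a2 * b1) * ((b2 * a1 + a2 * b1) * (y ^+ 2 - x ^+ 2) +
     2 * (a1 * a2 - b1 * b2) * x * y) by ring.
by rewrite E subrr mul0r addr0 ler_wpM2l// sqr_ge0.
Qed.

(** Two lightlike orthogonal vectors are proportional. *)
Lemma lightlike_minors (x1 x2 x3 y1 y2 y3 : R) :
  x1 ^+ 2 + x2 ^+ 2 = x3 ^+ 2 -> y1 ^+ 2 + y2 ^+ 2 = y3 ^+ 2 ->
  x1 * y1 + x2 * y2 = x3 * y3 ->
  [/\ x1 * y2 = x2 * y1, x1 * y3 = x3 * y1 & x2 * y3 = x3 * y2].
Proof.
move=> hx hy hxy.
have m12 : (x1 * y2 - x2 * y1) ^+ 2 = 0.
  have -> : (x1 * y2 - x2 * y1) ^+ 2 =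
    (x1 ^+ 2 + x2 ^+ 2) * (y1 ^+ 2 + y2 ^+ 2) - (x1 * y1 + x2 * y2) ^+ 2 by ring.
  by rewrite hx hy hxy; ring.
have E12 : x1 * y2 - x2 * y1 = 0 by apply/eqP; rewrite -sqrf_eq0 m12.
have E13 : x1 * y3 - x3 * y1 = 0.
  apply/eqP; rewrite -sqrf_eq0; apply/eqP.
  have -> : (x1 * y3 - x3 * y1) ^+ 2 = x1 ^+ 2 * y3 ^+ 2 + x3 ^+ 2 * y1 ^+ 2 -
    2 * x1 * y1 * (x3 * y3) by ring.
  rewrite -hx -hy -hxy -[RHS]m12; ring.
have E23 : x2 * y3 - x3 * y2 = 0.
  apply/eqP; rewrite -sqrf_eq0; apply/eqP.
  have -> : (x2 * y3 - x3 * y2) ^+ 2 = x2 ^+ 2 * y3 ^+ 2 + x3 ^+ 2 * y2 ^+ 2 -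
    2 * x2 * y2 * (x3 * y3) by ring.
  rewrite -hx -hy -hxy -[RHS]m12; ring.
by split; apply/eqP; rewrite -subr_eq0; apply/eqP.
Qed.

End Charts.

(** * The induced metric and its degeneracies *)

(* [partial] is never unfolded below. *)
#[local] Opaque partial.

Section Immersion.
Context {R : realType} {T : topologicalType} (S : riemann_surface R T).
Variables (X : T -> 'rV[R]_3) (U : set T).
Hypothesis oU : open U.
Hypothesis XC : forall j k, Ck_surface S k U (component X j).
Hypothesis XU : forall c, atlas S c -> forall p, U p -> cdom c p ->
  conformal_at X c (coord c p).

Notation Re := (@complex.Re R).
Notation Im := (@complex.Im R).

Let px (c : chart R T) j z := partial false (component X j \o param c) z.
Let py (c : chart R T) j z := partial true (component X j \o param c) z.

(** The factor [E = G] of the induced metric in the conformal chart [c]; it may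
    vanish. *)
Definition conf_factor (c : chart R T) z : R :=
  px c 0 z ^+ 2 + px c 1 z ^+ 2 - px c 2 z ^+ 2.

Lemma lorentz_dX (c : chart R T) b b' z :
  lorentz (dX [:: b] X c z) (dX [:: b'] X c z) =
  partial b (component X 0 \o param c) z * partial b' (component X 0 \o param c) z +
  partial b (component X 1 \o param c) z * partial b' (component X 1 \o param c) z -
  partial b (component X 2 \o param c) z * partial b' (component X 2 \o param c) z.
Proof. by rewrite /lorentz !mxE. Qed.

Lemma conformalE c p : atlas S c -> U p -> cdom c p -> let z := coord c p in
  conf_factor c z = py c 0 z ^+ 2 + py c 1 z ^+ 2 - py c 2 z ^+ 2 /\
  px c 0 z * py c 0 z + px c 1 z * py c 1 z - px c 2 z * py c 2 z = 0.
Proof.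
move=> Sc Up cp z; have [h1 h2] := XU Sc Up cp.
rewrite (lorentz_dX c false false) (lorentz_dX c true true) in h1.
by rewrite (lorentz_dX c false true) in h2.
Qed.

Lemma C2_component c j : atlas S c ->
  Ck_on 2 (coord c @` (cdom c `&` U)) (component X j \o param c).
Proof. exact: (@XC j 2). Qed.

Lemma component_continuous j q : U q -> {for q, continuous (component X j)}.
Proof.
move=> Uq; have [c Sc cq] := atlas_cover S q.
exact: (surface_continuous Sc oU Uq cq (@XC j 0%N)).
Qed.

(** The expansion of [C2_taylor] for the three coordinates, with the same
    constants. *)
Lemma taylor3 c q : atlas S c -> U q -> cdom c q -> exists r C : R,
  [/\ [/\ 0 < r, r <= 1 & 0 < C], csquare (coord c q) r `<=` coord c @` (cdom c `&` U),
  forall j b z, csquare (coord c q) r z -> `|partial b (component X j \o param c) z| <= C &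
  forall j z z' e, csquare (coord c q) r z -> csquare (coord c q) r z' ->
    `|Re z' - Re z| <= e -> `|Im z' - Im z| <= e ->
    `|(component X j \o param c) z' - (component X j \o param c) z -
      (px c j z * (Re z' - Re z) + py c j z * (Im z' - Im z))| <= C * e ^+ 2].
Proof.
move=> Sc Uq cq; have zW := chart_nbhs Sc oU Uq cq.
have H j := C2_taylor (C2_component j Sc) zW.
have [r0 [C0 [r00 C00 W0 b0 t0]]] := H 0.
have [r1 [C1 [r10 C10 W1 b1 t1]]] := H 1.
have [r2 [C2 [r20 C20 W2 b2 t2]]] := H 2.
pose r := Num.min 1 (Num.min r0 (Num.min r1 r2)); pose C := C0 + C1 + C2.
have [h [h0 [h1 h2]]] : r <= 1 /\ r <= r0 /\ r <= r1 /\ r <= r2.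
  by rewrite /r !ge_min !lexx !orbT.
have sub r' z : r <= r' -> csquare (coord c q) r z -> csquare (coord c q) r' z.
  by move=> rr [k1 k2]; split; exact: le_trans rr.
have [c0 [c1 c2]] : C0 <= C /\ C1 <= C /\ C2 <= C by rewrite /C; split; [lra|split; lra].
have I3 (P : 'I_3 -> Prop) : P 0 -> P 1 -> P 2 -> forall j, P j.
  move=> P0 P1 P2 j; have : j \in [:: 0; 1; 2].
    by case: j => [[|[|[|]]]].
  by rewrite !inE => /or3P[] /eqP ->.
exists r, C; split.
- by split => //; [rewrite !lt_min ltr01 r00 r10|rewrite /C !addr_gt0].
- by move=> z /(sub _ _ h0) /W0.
- apply: I3 => b z sz.
  + exact: le_trans (b0 b z (sub _ _ h0 sz)) c0.
  + exact: le_trans (b1 b z (sub _ _ h1 sz)) c1.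
  + exact: le_trans (b2 b z (sub _ _ h2 sz)) c2.
- apply: I3 => z z' e sz sz' hR hI.
  + apply: le_trans (t0 z z' e (sub _ _ h0 sz) (sub _ _ h0 sz') hR hI) _.
    by rewrite ler_wpM2r// sqr_ge0.
  + apply: le_trans (t1 z z' e (sub _ _ h1 sz) (sub _ _ h1 sz') hR hI) _.
    by rewrite ler_wpM2r// sqr_ge0.
  + apply: le_trans (t2 z z' e (sub _ _ h2 sz) (sub _ _ h2 sz') hR hI) _.
    by rewrite ler_wpM2r// sqr_ge0.
Qed.

(** A Lorentzian square survives quadratic errors: [L] is the linear part of
    [D], of Lorentzian square [la * n]. *)
Lemma quadratic_perturbation (L1 L2 L3 D1 D2 D3 la n e C : R) :
  0 <= e -> e <= 1 -> 0 <= C -> e ^+ 2 <= n ->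
  `|L1| <= 2 * C * e -> `|L2| <= 2 * C * e -> `|L3| <= 2 * C * e ->
  `|D1 - L1| <= C * e ^+ 2 -> `|D2 - L2| <= C * e ^+ 2 -> `|D3 - L3| <= C * e ^+ 2 ->
  L1 ^+ 2 + L2 ^+ 2 - L3 ^+ 2 = la * n -> 30 * C ^+ 2 * e <= la ->
  la / 2 * n <= D1 ^+ 2 + D2 ^+ 2 - D3 ^+ 2.
Proof.
move=> e0 e1 C0 en l1 l2 l3 d1 d2 d3 E small.
have Ce : 0 <= C * e by exact: mulr_ge0.
have pert L D : `|L| <= 2 * C * e -> `|D - L| <= C * e ^+ 2 ->
    `|D ^+ 2 - L ^+ 2| <= 5 * C ^+ 2 * e * e ^+ 2.
  move=> l d; have -> : D ^+ 2 - L ^+ 2 = (D - L) * (2 * L + (D - L)) by ring.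
  have h : `|2 * L + (D - L)| <= 5 * C * e.
    rewrite (le_trans (ler_normD _ _))// normrM (ger0_norm (x := 2))//.
    have : C * e ^+ 2 <= C * e by rewrite expr2 mulrA ler_piMr.
    lra.
  rewrite normrM (le_trans (ler_pM _ _ d h))//.
  by rewrite le_eqVlt; apply/orP; left; apply/eqP; ring.
have := pert _ _ l1 d1; have := pert _ _ l2 d2; have := pert _ _ l3 d3.
have s1 : 15 * C ^+ 2 * e * e ^+ 2 <= la / 2 * n.
  have la0 : 0 <= la by apply: le_trans small; rewrite !mulr_ge0// sqr_ge0.
  rewrite (le_trans (y := la / 2 * e ^+ 2))//.
    by rewrite ler_wpM2r ?sqr_ge0//; lra.
  by rewrite ler_wpM2l// divr_ge0.
have s2 : 15 * C ^+ 2 * e * e ^+ 2 = 3 * (5 * C ^+ 2 * e * e ^+ 2) by ring.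
rewrite s2 in s1; move: s1; set w := 5 * _ * _ * _ => s1.
rewrite !ler_norml => /andP[? ?] /andP[? ?] /andP[? ?].
have -> : la / 2 * n = la * n - la / 2 * n by field.
rewrite -E; lra.
Qed.

(** Where the conformal factor is positive the chords are spacelike. *)
Lemma spacelike_expansion c q : atlas S c -> U q -> cdom c q ->
  0 < conf_factor c (coord c q) -> exists2 r, 0 < r &
  forall z, csquare (coord c q) r z -> (coord c @` (cdom c `&` U)) z /\
   conf_factor c (coord c q) / 2 *
     ((Re z - Re (coord c q)) ^+ 2 + (Im z - Im (coord c q)) ^+ 2) <=
   (X (param c z) 0 0 - X q 0 0) ^+ 2 + (X (param c z) 0 1 - X q 0 1) ^+ 2
    - (X (param c z) 0 2 - X q 0 2) ^+ 2.
Proof.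
move=> Sc Uq cq la0; set z0 := coord c q; set la := conf_factor c z0.
have [r [C [[r0 r1 C0] sW bd ty]]] := taylor3 Sc Uq cq.
pose r' := Num.min r (la / (30 * C ^+ 2)).
have c2 : 0 < 30 * C ^+ 2 by rewrite mulr_gt0// exprn_gt0.
have r'0 : 0 < r' by rewrite lt_min r0 divr_gt0.
have [r'r r'la] : r' <= r /\ r' <= la / (30 * C ^+ 2) by rewrite /r' !ge_min !lexx orbT.
exists r' => // z [zR zI].
have sz : csquare z0 r z by split; exact: le_trans r'r.
have sz0 : csquare z0 r z0 by split; rewrite subrr normr0 ltW.
split; first exact: sW.
set u := Re z - Re z0; set v := Im z - Im z0.
pose e := Num.max `|u| `|v|.
have [ue ve] : `|u| <= e /\ `|v| <= e by rewrite /e !le_max !lexx orbT.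
have er' : e <= r' by rewrite ge_max zR zI.
have e0 : 0 <= e by rewrite le_max normr_ge0.
have Xq j : X q 0 j = (component X j \o param c) z0.
  by rewrite /component/= /z0 (coordK Sc cq).
have lin j : `|px c j z0 * u + py c j z0 * v| <= 2 * C * e.
  rewrite (le_trans (ler_normD _ _))// !normrM.
  have := ler_pM (normr_ge0 _) (normr_ge0 u) (bd j false z0 sz0) ue.
  have := ler_pM (normr_ge0 _) (normr_ge0 v) (bd j true z0 sz0) ve.
  rewrite -/(px c j z0) -/(py c j z0); lra.
have [E1 E2] := conformalE Sc Uq cq.
apply: (@quadratic_perturbation (px c 0 z0 * u + py c 0 z0 * v)
  (px c 1 z0 * u + py c 1 z0 * v) (px c 2 z0 * u + py c 2 z0 * v) _ _ _ la _ e C).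
- exact: e0.
- exact: le_trans (le_trans r'r r1).
- exact: ltW.
- by rewrite /e; case: (leP `|u| `|v|) => _; rewrite real_normK ?num_real// ?lerDr ?lerDl sqr_ge0.
- exact: lin.
- exact: lin.
- exact: lin.
- rewrite Xq; exact: ty.
- rewrite Xq; exact: ty.
- rewrite Xq; exact: ty.
- rewrite -/z0 in E1 E2; rewrite -/la in E1.
  have -> : la * (u ^+ 2 + v ^+ 2) = la * u ^+ 2 + la * v ^+ 2 by ring.
  rewrite {2}E1 /la /conf_factor -[RHS]addr0 -[X in _ = _ + X](mulr0 (2 * u * v)) -E2; ring.
- by rewrite mulrC -ler_pdivlMr// (le_trans er').
Qed.

End Immersion.

Lemma norm_addM_le (R : realDomainType) (a b m c k : R) :
  `|a| <= c -> `|b| <= c -> `|m| <= k -> `|a + m * b| <= c + k * c.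
Proof.
move=> ha hb hm; rewrite (le_trans (ler_normD _ _))// lerD// normrM.
by apply: ler_pM.
Qed.

Lemma norm_subM_le (R : realDomainType) (a b m c k : R) :
  `|a| <= c -> `|b| <= c -> `|m| <= k -> `|a - m * b| <= c + k * c.
Proof. by move=> ha hb hm; rewrite -mulNr; apply: norm_addM_le; rewrite ?normrN. Qed.

Lemma norm_le_perturb (R : realDomainType) (a b l1 l2 e : R) :
  `|a - l1| <= e -> `|b - l2| <= e -> `|l2| <= `|l1| -> `|b| <= `|a| + (e + e).
Proof.
move=> ha hb h; have := ler_normD (b - l2) l2; have := ler_normD (l1 - a) a.
by rewrite !subrK (distrC l1) => *; lra.
Qed.

Lemma sum_constants_ge (R : realDomainType) (K k kK : R) : 0 <= K -> 0 <= k -> 0 <= kK ->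
  let C := 4 * K + 4 * kK + k + kK + 1 + K in
  [/\ 0 <= C, 4 * K <= C, 4 * kK <= C & k <= C].
Proof. by move=> K0 k0 kK0 C; rewrite /C; split; lra. Qed.

Section LocalGeometry.
Context {R : realType} {T : topologicalType} (S : riemann_surface R T).
Variables (X : T -> 'rV[R]_3) (U : set T).
Hypothesis oU : open U.
Hypothesis XC : forall j k, Ck_surface S k U (component X j).
Hypothesis XU : forall c, atlas S c -> forall p, U p -> cdom c p ->
  conformal_at X c (coord c p).
Variables (M : set T) (a : 'rV[R]_3).

Notation Re := (@complex.Re R).
Notation Im := (@complex.Im R).

Let x j (q : T) : R := X q 0 j - a 0 j.

(** A conformal metric cannot be negative definite: two timelike
    vectors are never orthogonal. *)
Lemma conf_factor_ge0 c q : atlas S c -> U q -> cdom c q ->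
  0 <= conf_factor X c (coord c q).
Proof.
move=> Sc Uq cq; have [] := conformalE XU Sc Uq cq; rewrite /conf_factor.
move: (partial _ _ _) (partial _ _ _) (partial _ _ _).
move: (partial _ _ _) (partial _ _ _) (partial _ _ _) => b3 b2 b1 a3 a2 a1 hE hF.
rewrite leNgt; apply/negP => E0.
have : 0 <= (a1 * b2 - a2 * b1) ^+ 2 by exact: sqr_ge0.
have -> : (a1 * b2 - a2 * b1) ^+ 2 =
  (a1 ^+ 2 + a2 ^+ 2) * (b1 ^+ 2 + b2 ^+ 2) - (a1 * b1 + a2 * b2) ^+ 2 by ring.
have -> : a1 * b1 + a2 * b2 = a3 * b3 by apply/eqP; rewrite -subr_eq0 hF.
have hA : 0 <= a1 ^+ 2 + a2 ^+ 2 by rewrite addr_ge0 ?sqr_ge0.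
have hB : 0 <= b1 ^+ 2 + b2 ^+ 2 by rewrite addr_ge0 ?sqr_ge0.
move: E0 hE hA hB; move: (a1 ^+ 2 + a2 ^+ 2) (b1 ^+ 2 + b2 ^+ 2) => A B.
rewrite exprMn; move: (a3 ^+ 2) (b3 ^+ 2) => A3 B3 E0 hE hA hB h.
nra.
Qed.

Lemma spacelike_chords_conf c q : atlas S c -> U q -> cdom c q ->
  0 < conf_factor X c (coord c q) -> spacelike_chords (x 0) (x 1) (x 2) q.
Proof.
move=> Sc Uq cq la0; have [r r0 H] := spacelike_expansion oU XC XU Sc Uq cq la0.
apply: filterS (coord_nbhs Sc cq (csquare_nbhs (coord c q) r0)) => p [cp /H[_]].
rewrite (coordK Sc cp) => h.
have E (u v w : R) : (u - w) - (v - w) = u - v by rewrite opprB addrA subrK.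
rewrite !E -subr_ge0 (le_trans _ h)// mulr_ge0// ?addr_ge0 ?sqr_ge0//.
by rewrite divr_ge0// ltW.
Qed.

(** The conformal factor vanishes at the points with timelike chords. There the
    differential of [X] sends the coordinate vectors to proportional lightlike
    vectors, so that [sard_nowhere_dense] applies. *)
Lemma bad_values_local q0 : U q0 -> exists2 V, nbhs q0 V & forall k s, 0 < k ->
  nowhere_dense2 (bad_values M (x 0) (x 1) (x 2) V k s).
Proof.
move=> Uq0; have [c Sc cq0] := atlas_cover S q0.
have [r [C [[r0 r1 C0] sW bd ty]]] := taylor3 oU XC Sc Uq0 cq0.
set z0 := coord c q0 in sW bd ty.
exists (cdom c `&` coord c @^-1` csquare z0 r).
  exact: (coord_nbhs Sc cq0 (csquare_nbhs z0 r0)).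
move=> k s k0.
pose Z := [set q | [/\ (cdom c `&` coord c @^-1` csquare z0 r) q,
  box M (x 0) (x 1) (x 2) k q, k^-1 <= `|x 0 q| & ~ spacelike_chords (x 0) (x 1) (x 2) q]].
pose u q := Re (coord c q); pose v q := Im (coord c q).
pose p j q := partial false (component X j \o param c) (coord c q).
pose p' j q := partial true (component X j \o param c) (coord c q).
have xE j q q' : Z q -> Z q' -> x j q' - x j q =
    (component X j \o param c) (coord c q') - (component X j \o param c) (coord c q).
  move=> [[cq _] _ _ _] [[cq' _] _ _ _].
  by rewrite /x /component/= (coordK Sc cq) (coordK Sc cq') opprB addrA subrK.
have tay j q q' e : Z q -> Z q' -> `|u q' - u q| <= e -> `|v q' - v q| <= e ->
    `|x j q' - x j q - (p j q * (u q' - u q) + p' j q * (v q' - v q))| <= C * e ^+ 2.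
  move=> Zq Zq' hu hv; rewrite (xE _ _ _ Zq Zq'); apply: ty => //.
    by case: Zq => [[]].
  by case: Zq' => [[]].
have Ze q q' e : Z q -> Z q' -> `|u q' - u q| <= e -> `|v q' - v q| <= e ->
    exists e', [/\ 0 <= e', e' <= e, e' <= 2, `|u q' - u q| <= e' & `|v q' - v q| <= e'].
  move=> [[_ [h1 h2]] _ _ _] [[_ [h3 h4]] _ _ _] hu hv.
  exists (Num.max `|u q' - u q| `|v q' - v q|); split.
  - by rewrite le_max normr_ge0.
  - by rewrite ge_max hu.
  - rewrite ge_max; apply/andP; split.
      have := ler_distD (Re z0) (u q') (u q); rewrite (distrC (Re z0)) -/(u q) -/(u q').
      by move: h1 h3 r1; rewrite -/(u q) -/(u q'); lra.
    have := ler_distD (Im z0) (v q') (v q); rewrite (distrC (Im z0)) -/(v q) -/(v q').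
    by move: h2 h4 r1; rewrite -/(v q) -/(v q'); lra.
  - by rewrite le_max lexx.
  - by rewrite le_max lexx orbT.
have lip j q q' e : Z q -> Z q' -> `|u q' - u q| <= e -> `|v q' - v q| <= e ->
    `|x j q' - x j q| <= 4 * C * e.
  move=> Zq Zq' hu hv; have [e' [e'0 e'e e'2 hu' hv']] := Ze _ _ _ Zq Zq' hu hv.
  have sq : csquare z0 r (coord c q) by case: Zq => [[]].
  have := tay j _ _ _ Zq Zq' hu' hv'.
  have := ler_pM (normr_ge0 _) (normr_ge0 _) (bd j false _ sq) hu'.
  have := ler_pM (normr_ge0 _) (normr_ge0 _) (bd j true _ sq) hv'.
  rewrite -!normrM -/(p j q) -/(p' j q).
  have : C * e' ^+ 2 <= 2 * (C * e').
    have -> : C * e' ^+ 2 = e' * (C * e') by ring.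
    by rewrite ler_wpM2r// mulr_ge0// ltW.
  have : C * e' <= C * e by rewrite ler_wpM2l// ltW.
  set A := p j q * _; set B := p' j q * _; set D := x j q' - x j q.
  have := ler_normD (D - (A + B)) (A + B); rewrite subrK.
  have := ler_normD A B; lra.
have Zx q : Z q -> [/\ x 0 q != 0, `|x 0 q| <= k, (`|x 0 q|)^-1 <= k & `|x 1 q / x 0 q| <= k ^+ 2].
  move=> [_ [_ h1 h2 _] h3 _].
  have n0 : 0 < `|x 0 q| by rewrite (lt_le_trans _ h3)// invr_gt0.
  have i0 : (`|x 0 q|)^-1 <= k by rewrite invf_ple ?posrE.
  split => //; first by rewrite -normr_gt0.
  by rewrite normrM normfV expr2 ler_pM// invr_ge0.
pose m q := x 1 q / x 0 q; pose g q := x 2 q + s * x 0 q.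
(* increments of the slope, cleared of the denominator *)
have mE q q' : Z q -> Z q' -> x 0 q' * (m q' - m q) = (x 1 q' - x 1 q) - m q * (x 0 q' - x 0 q).
  by move=> /Zx[h _ _ _] /Zx[h' _ _ _]; rewrite /m; field; rewrite h h'.
have gE q q' : g q' - g q = (x 2 q' - x 2 q) + s * (x 0 q' - x 0 q) by rewrite /g; ring.
have k20 : 0 <= k ^+ 2 by exact: sqr_ge0.
have mk q q' D : Z q -> Z q' -> `|x 0 q' * (m q' - m q)| <= D -> `|m q' - m q| <= k * D.
  move=> Zq /Zx[h _ h' _] hD.
  have -> : m q' - m q = (x 0 q')^-1 * (x 0 q' * (m q' - m q)) by rewrite mulKf.
  by rewrite normrM normfV ler_pM// invr_ge0.
pose K := C * (1 + k ^+ 2 + `|s|).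
have K0 : 0 <= K by rewrite mulr_ge0 ?(ltW C0)// addr_ge0// addr_ge0.
have kK : 0 <= k * K by rewrite mulr_ge0// ltW.
pose C1 := 4 * K + 4 * (k * K) + k + k * K + 1 + K.
have [C10 C1a C1b C1c] := sum_constants_ge K0 (ltW k0) kK.
rewrite -/C1 in C10 C1a C1b C1c.
have nd := @sard_nowhere_dense R T Z u v m g (Re z0 - r) (Im z0 - r) (2 * r) C1 _ C10.
apply: nd.
- by rewrite mulr_gt0.
- move=> q [[_ []]]; rewrite !ler_distl => h1 h2 _ _ _.
  have rr (b : R) : b - r + 2 * r = b + r by ring.
  by rewrite !rr.
- move=> q q' e Zq Zq' hu hv.
  have e0 : 0 <= e by exact: le_trans hu.
  have l0 := lip 0 _ _ _ Zq Zq' hu hv; have l1 := lip 1 _ _ _ Zq Zq' hu hv.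
  have l2 := lip 2 _ _ _ Zq Zq' hu hv.
  have [_ _ _ mq] := Zx _ Zq.
  have Ce : 0 <= 4 * C * e by rewrite mulr_ge0// mulr_ge0// ltW.
  have KE : C * (4 * e) + k ^+ 2 * (C * (4 * e)) + `|s| * (C * (4 * e)) = K * (4 * e).
    by rewrite /K; ring.
  have C4 : 4 * C * e = C * (4 * e) by ring.
  rewrite C4 in l0 l1 l2 Ce; have s0 := mulr_ge0 (normr_ge0 s) Ce.
  split.
    apply: le_trans (mk _ _ (K * (4 * e)) Zq Zq' _) _.
      rewrite (mE _ _ Zq Zq') (le_trans (norm_subM_le l1 l0 mq))//.
      by rewrite -KE lerDl.
    by rewrite (_ : k * (K * (4 * e)) = 4 * (k * K) * e) ?ler_wpM2r//; ring.
  rewrite gE (le_trans (norm_addM_le l2 l0 (lexx _)))//.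
  apply: (le_trans (y := K * (4 * e))).
    by rewrite -KE lerD2r lerDl mulr_ge0.
  by rewrite (_ : K * (4 * e) = 4 * K * e) ?ler_wpM2r//; ring.
- move=> q Zq.
  have [[cq sq] _ _ nsp] := Zq.
  have Uq : U q by have [q' [cq' Uq'] E] := sW _ sq; rewrite -(coordK Sc cq) -E (coordK Sc cq').
  have la0 : conf_factor X c (coord c q) = 0.
    apply/eqP; rewrite eq_le conf_factor_ge0// andbT leNgt; apply/negP => /(spacelike_chords_conf Sc Uq cq).
    exact: nsp.
  have [hG hF] := conformalE XU Sc Uq cq.
  have [m01 m02 m12] : [/\ p 0 q * p' 1 q = p 1 q * p' 0 q,
      p 0 q * p' 2 q = p 2 q * p' 0 q & p 1 q * p' 2 q = p 2 q * p' 1 q].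
    exact: (lightlike_minors (subr0_eq la0) (subr0_eq (etrans (esym hG) la0)) (subr0_eq hF)).
  (* the linear parts of the increments of the slope and of [g] *)
  have prop : (p 1 q - m q * p 0 q) * (p' 2 q + s * p' 0 q) =
              (p 2 q + s * p 0 q) * (p' 1 q - m q * p' 0 q).
    have -> : (p 1 q - m q * p 0 q) * (p' 2 q + s * p' 0 q) = p 1 q * p' 2 q +
      s * (p 1 q * p' 0 q) - m q * (p 0 q * p' 2 q) - m q * s * (p 0 q * p' 0 q) by ring.
    by rewrite m12 m02 -m01; ring.
  have rem q' e : Z q' -> `|u q' - u q| <= e -> `|v q' - v q| <= e ->
    `|x 0 q' * (m q' - m q) - ((p 1 q - m q * p 0 q) * (u q' - u q) +
        (p' 1 q - m q * p' 0 q) * (v q' - v q))| <= K * e ^+ 2 /\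
    `|g q' - g q - ((p 2 q + s * p 0 q) * (u q' - u q) +
        (p' 2 q + s * p' 0 q) * (v q' - v q))| <= K * e ^+ 2.
    move=> Zq' hu hv.
    have t0 := tay 0 _ _ _ Zq Zq' hu hv; have t1 := tay 1 _ _ _ Zq Zq' hu hv.
    have t2 := tay 2 _ _ _ Zq Zq' hu hv; have [_ _ _ mq] := Zx _ Zq.
    have Ce : 0 <= C * e ^+ 2 by rewrite mulr_ge0 ?sqr_ge0// ltW.
    have KE : K * e ^+ 2 = C * e ^+ 2 + k ^+ 2 * (C * e ^+ 2) + `|s| * (C * e ^+ 2).
      by rewrite /K; ring.
    have s0 := mulr_ge0 (normr_ge0 s) Ce; have k2 := mulr_ge0 k20 Ce.
    rewrite KE (mE _ _ Zq Zq') gE; move: t0 t1 t2.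
    set D0 := x 0 q' - x 0 q; set D1 := x 1 q' - x 1 q; set D2 := x 2 q' - x 2 q.
    set du := u q' - u q; set dv := v q' - v q => t0 t1 t2.
    split.
      have -> : D1 - m q * D0 - ((p 1 q - m q * p 0 q) * du + (p' 1 q - m q * p' 0 q) * dv) =
        (D1 - (p 1 q * du + p' 1 q * dv)) - m q * (D0 - (p 0 q * du + p' 0 q * dv)) by ring.
      by rewrite (le_trans (norm_subM_le t1 t0 mq))// lerDl.
    have -> : D2 + s * D0 - ((p 2 q + s * p 0 q) * du + (p' 2 q + s * p' 0 q) * dv) =
      (D2 - (p 2 q * du + p' 2 q * dv)) + s * (D0 - (p 0 q * du + p' 0 q * dv)) by ring.
    by rewrite (le_trans (norm_addM_le t2 t0 (lexx _)))// lerD2r lerDl.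
  have KK e : K * e ^+ 2 + K * e ^+ 2 <= 4 * K * e ^+ 2.
    have -> : 4 * K * e ^+ 2 = K * e ^+ 2 + K * e ^+ 2 + (K * e ^+ 2 + K * e ^+ 2) by ring.
    by rewrite lerDl addr_ge0// mulr_ge0 ?sqr_ge0.
  have [dom|dom] := proportional_forms prop; [left|right] => q' e Zq' hu hv.
    have [r1' r2'] := rem q' e Zq' hu hv.
    have h := norm_le_perturb r1' r2' (dom _ _).
    rewrite (le_trans h)//; apply: lerD.
      rewrite normrM ler_wpM2r//; have [_ xk _ _] := Zx _ Zq'.
      exact: le_trans xk C1c.
    by rewrite (le_trans (KK e))// ler_wpM2r ?sqr_ge0.
  have [r1' r2'] := rem q' e Zq' hu hv.
  have h := norm_le_perturb r2' r1' (dom _ _).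
  apply: le_trans (mk _ _ _ Zq Zq' h) _; rewrite mulrDr; apply: lerD.
    by rewrite ler_wpM2r.
  rewrite (le_trans (ler_wpM2l (ltW k0) (KK e)))//.
  rewrite (_ : k * (4 * K * e ^+ 2) = 4 * (k * K) * e ^+ 2) ?ler_wpM2r ?sqr_ge0//; ring.
Qed.

End LocalGeometry.

(** * The cone estimate for a spacelike graph *)

Lemma sum_sq_continuous (R : realType) (T : topologicalType) (f g : T -> R) (a b : R) z :
  f w @[w --> z] --> f z -> g w @[w --> z] --> g z ->
  ((f w - a) * (f w - a) + (g w - b) * (g w - b)) @[w --> z] -->
  (f z - a) * (f z - a) + (g z - b) * (g z - b).
Proof.
move=> cf cg; have cf' : f w - a @[w --> z] --> f z - a by apply: cvgB => //; exact: cvg_cst.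
have cg' : g w - b @[w --> z] --> g z - b by apply: cvgB => //; exact: cvg_cst.
by apply: cvgD; apply: cvgM.
Qed.

Section ConeOfImmersion.
Context {R : realType} {T : topologicalType} (S : riemann_surface R T).
Variables (X : T -> 'rV[R]_3) (U O M : set T) (p0 : T) (Omega : set (Cplx R)).
Hypothesis oU : open U.
Hypothesis XC : forall j k, Ck_surface S k U (component X j).
Hypothesis XU : forall c, atlas S c -> forall p, U p -> cdom c p ->
  conformal_at X c (coord c p).
Hypothesis oO : open O.
Hypothesis OM : O `<=` M.
Hypothesis MU : M `<=` U.
Hypothesis clO : M `<=` closure O.
Hypothesis spO : forall c, atlas S c -> forall p, O p -> cdom c p ->
  spacelike_at X c (coord c p).

Notation Re := (@complex.Re R).
Notation Im := (@complex.Im R).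

Let x j (q : T) : R := X q 0 j - X p0 0 j.

Lemma conf_factor_gt0 c q : atlas S c -> O q -> cdom c q ->
  0 < conf_factor X c (coord c q).
Proof.
move=> Sc Oq cq; have := spO Sc Oq cq (a := 1) (b := 0).
rewrite scale1r scale0r addr0 lorentz_dX -!expr2; apply.
by rewrite xpair_eqE oner_eq0.
Qed.

(** The projection of the interior is open: minimise the distance to the
    target value on a small square of a chart. A minimum point is interior, and
    the differential of the projection is invertible there. *)
Lemma projection_open p V : O p -> nbhs p V -> exists2 d, 0 < d &
  forall y1 y2, `|y1 - x 0 p| < d -> `|y2 - x 1 p| < d ->
    exists q, [/\ O q, V q, x 0 q = y1 & x 1 q = y2].
Proof.
move=> Op pV; have [c Sc cp] := atlas_cover S p.
have Up := MU (OM Op).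
have la0 := conf_factor_gt0 Sc Op cp; set la := conf_factor X c _ in la0.
have [r r0 Hr] := spacelike_expansion oU XC XU Sc Up cp la0.
set z0 := coord c p in la la0 Hr.
have [e e0 He] : exists2 e : R, 0 < e & forall z, `|Re z - Re z0| < e ->
    `|Im z - Im z0| < e -> cimg c z /\ (V `&` O) (param c z).
  apply/nearCP; apply: (@filterI _ _ (nbhs_filter z0)).
    by apply: open_nbhs_nbhs; split; [exact: cimg_open Sc|exists p].
  apply: (param_nbhs Sc cp); apply: filterI => //.
  by apply: open_nbhs_nbhs.
pose rho := Num.min r (e / 2).
have rho0 : 0 < rho by rewrite lt_min r0 divr_gt0.
have [rhor rhoe] : rho <= r /\ rho < e.
  by rewrite /rho gt_min ge_min lexx orbC ltr_pdivrMr//; split => //; lra.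
have Hsq z : csquare z0 rho z -> [/\ (coord c @` (cdom c `&` U)) z, V (param c z),
    O (param c z) & cdom c (param c z) /\ coord c (param c z) = z].
  move=> [h1 h2]; have [zc [Vz Oz]] := He z (le_lt_trans h1 rhoe) (le_lt_trans h2 rhoe).
  have [h3 h4] := paramK Sc zc; split => //.
  by exists (param c z) => //; split => //; exact: MU (OM Oz).
pose d := rho * Num.sqrt la / 4.
have d0 : 0 < d by rewrite divr_gt0// mulr_gt0// sqrtr_gt0.
have d2 : 16 * d ^+ 2 = rho ^+ 2 * la.
  by rewrite /d expr_div_n exprMn sqr_sqrtr ?(ltW la0)//; field.
exists d => // y1 y2 hy1 hy2.
pose F j := component X j \o param c.
pose h z := (F 0 z - (y1 + X p0 0 0)) * (F 0 z - (y1 + X p0 0 0)) +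
            (F 1 z - (y2 + X p0 0 1)) * (F 1 z - (y2 + X p0 0 1)).
have ch z : csquare z0 rho z -> h w @[w --> z] --> h z.
  move=> /Hsq[Wz _ _ _].
  have c0 : F 0 w @[w --> z] --> F 0 z := C2_continuous (C2_component XC 0 Sc) Wz.
  have c1 : F 1 w @[w --> z] --> F 1 z := C2_continuous (C2_component XC 1 Sc) Wz.
  have h1 := @sum_sq_continuous R (Cplx R) (F 0) (F 1) (y1 + X p0 0 0) (y2 + X p0 0 1) z c0 c1.
  exact h1.
have z0sq : csquare z0 rho z0 by split; rewrite subrr normr0 ltW.
have [|zm] := @compact_EVT_min _ R h (csquare z0 rho) (ex_intro _ z0 z0sq) (@csquare_compact R z0 rho).
  by apply: continuous_in_subspaceT => z; rewrite inE => /ch.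
rewrite inE => zmsq zmin.
have {}zmin z : csquare z0 rho z -> h zm <= h z by move=> zs; apply: zmin; rewrite inE.
have Fp j : F j z0 = X p 0 j by rewrite /F /= /z0 (coordK Sc cp).
have hz0 : h z0 < 2 * d ^+ 2.
  have sq (u : R) : `|u| < d -> u * u < d ^+ 2.
    by move=> ud; rewrite -expr2 -(real_normK (num_real u)) ltr_pXn2r// nnegrE// ltW.
  rewrite /h !Fp mulr2n [ltRHS](_ : _ = d ^+ 2 + d ^+ 2); last by ring.
  apply: ltrD; apply: sq.
    have -> : X p 0 0 - (y1 + X p0 0 0) = - (y1 - x 0 p) by rewrite /x; ring.
    by rewrite normrN.
  have -> : X p 0 1 - (y2 + X p0 0 1) = - (y2 - x 1 p) by rewrite /x; ring.
  by rewrite normrN.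
have [zmR zmI] : `|Re zm - Re z0| < rho /\ `|Im zm - Im z0| < rho.
  have [hR hI] := zmsq.
  have notb : (Re zm - Re z0) ^+ 2 + (Im zm - Im z0) ^+ 2 < rho ^+ 2.
    rewrite ltNge; apply/negP => big.
    have [_ h1] := Hr zm (conj (le_trans hR rhor) (le_trans hI rhor)).
    have h2 := le_lt_trans (zmin _ z0sq) hz0.
    have h3 := ler_wpM2l (ltW la0) big.
    have sq (u w : R) : u ^+ 2 / 2 - w ^+ 2 <= (u - w) ^+ 2.
      by have := sqr_ge0 (u / 2 - w); have := sqr_ge0 u; rewrite !expr2; nra.
    have s1 := sq (X (param c zm) 0 0 - X p 0 0) (y1 - x 0 p).
    have s2 := sq (X (param c zm) 0 1 - X p 0 1) (y2 - x 1 p).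
    have e1 : (y1 - x 0 p) ^+ 2 < d ^+ 2.
      by rewrite -(real_normK (num_real (y1 - _))) ltr_pXn2r// nnegrE// ltW.
    have e2 : (y2 - x 1 p) ^+ 2 < d ^+ 2.
      by rewrite -(real_normK (num_real (y2 - _))) ltr_pXn2r// nnegrE// ltW.
    have hE : h zm = (X (param c zm) 0 0 - X p 0 0 - (y1 - x 0 p)) ^+ 2 +
                     (X (param c zm) 0 1 - X p 0 1 - (y2 - x 1 p)) ^+ 2.
      by rewrite /h /F /component /x /=; ring.
    have := sqr_ge0 (X (param c zm) 0 2 - X p 0 2).
    move: h1 h2 h3 s1 s2 e1 e2 d2; rewrite hE -/la -/z0; lra.
  have conv (u v : R) : u ^+ 2 + v ^+ 2 < rho ^+ 2 -> `|u| < rho.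
    move=> uv; rewrite -(@ltr_pXn2r _ 2)// ?nnegrE ?(ltW rho0)//.
    by rewrite real_normK ?num_real// (le_lt_trans _ uv)// lerDl sqr_ge0.
  by split; [exact: conv notb|apply: conv; rewrite addrC; exact: notb].
have [Wm Vm Om [cm zmE]] := Hsq zm zmsq.
have Wnb : nbhs zm (coord c @` (cdom c `&` U)).
  by rewrite -zmE; apply: (chart_nbhs Sc oU (MU (OM Om)) cm).
have crit b : (F 0 zm - (y1 + X p0 0 0)) * partial b (F 0) zm +
              (F 1 zm - (y2 + X p0 0 1)) * partial b (F 1) zm = 0.
  have jj j y := jet2D (C2_jet2 (C2_component XC j Sc) b Wnb) (jet2_cst (- (y + X p0 0 j))).
  have J0 := jet2M (jj 0 y1) (jj 0 y1); have J1 := jet2M (jj 1 y2) (jj 1 y2).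
  have J := jet2D J0 J1; have := jet2_local_min_slope J.
  rewrite /slice step0 !addr0 -/(F 0) -/(F 1) => H.
  have : (\forall t \near (0 : R), h zm <= h (zm + step b t)).
    have nb : nbhs zm (csquare z0 rho).
      apply/nearCP; exists (Num.min (rho - `|Re zm - Re z0|) (rho - `|Im zm - Im z0|)).
        by rewrite lt_min !subr_gt0 zmR.
      move=> w; rewrite !lt_min => /andP[a1 _] /andP[_ a2].
      split; first by have := ler_distD (Re zm) (Re w) (Re z0); lra.
      by have := ler_distD (Im zm) (Im w) (Im z0); lra.
    by have := near_step b nb; apply: filterS => t; exact: zmin.
  move=> /H; lra.
have [E1 E2] := conformalE XU Sc (MU (OM Om)) cm.
have lm0 := conf_factor_gt0 Sc Om cm; rewrite zmE in E1 E2 lm0.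
have cx := crit false; have cy := crit true.
move: E1 E2 lm0 cx cy; rewrite /conf_factor -/(F 0) -/(F 1) -/(F 2).
move: (partial false (F 0) zm) (partial false (F 1) zm) (partial false (F 2) zm)
  (partial true (F 0) zm) (partial true (F 1) zm) (partial true (F 2) zm)
  => a0 a1 a2 b0 b1 b2 E1 E2 lm0.
set u := F 0 zm - _; set w := F 1 zm - _ => cx cy.
have J2 : (a0 * b1 - a1 * b0) ^+ 2 = (a0 ^+ 2 + a1 ^+ 2 - a2 ^+ 2) *
    ((a0 ^+ 2 + a1 ^+ 2 - a2 ^+ 2) + a2 ^+ 2 + b2 ^+ 2).
  have ab : a0 * b0 + a1 * b1 = a2 * b2 by apply/eqP; rewrite -subr_eq0 E2.
  have -> : (a0 * b1 - a1 * b0) ^+ 2 = (a0 ^+ 2 + a1 ^+ 2) * (b0 ^+ 2 + b1 ^+ 2) -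
    (a0 * b0 + a1 * b1) ^+ 2 by ring.
  have -> : b0 ^+ 2 + b1 ^+ 2 = (a0 ^+ 2 + a1 ^+ 2 - a2 ^+ 2) + b2 ^+ 2.
    by rewrite E1 subrK.
  by rewrite ab; ring.
have J0 : a0 * b1 - a1 * b0 != 0.
  rewrite -sqrf_eq0 J2 mulf_neq0 ?gt_eqF//.
  by rewrite -addrA ltr_wpDr// addr_ge0 ?sqr_ge0.
have u0 : u = 0.
  have : u * (a0 * b1 - a1 * b0) = 0.
    have -> : u * (a0 * b1 - a1 * b0) = (u * a0 + w * a1) * b1 - (u * b0 + w * b1) * a1 by ring.
    by rewrite cx cy !mul0r subrr.
  by move/eqP; rewrite mulf_eq0 (negbTE J0) orbF => /eqP.
have w0 : w = 0.
  have : w * (a0 * b1 - a1 * b0) = 0.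
    have -> : w * (a0 * b1 - a1 * b0) = (u * b0 + w * b1) * a0 - (u * a0 + w * a1) * b0 by ring.
    by rewrite cx cy !mul0r subrr.
  by move/eqP; rewrite mulf_eq0 (negbTE J0) orbF => /eqP.
exists (param c zm); split => //.
  by apply/eqP; rewrite -subr_eq0 -u0; apply/eqP; rewrite /x /u /F /component /=; ring.
by apply/eqP; rewrite -subr_eq0 -w0; apply/eqP; rewrite /x /w /F /component /=; ring.
Qed.

Hypothesis properM : proper_on M X.
Hypothesis Op0 : O p0.
Hypothesis starO : starlike (pi0 (X p0)) Omega.
Hypothesis graphO : graph_over (X @` M) Omega.

Lemma pi0_image p : M p -> Omega (pi0 (X p)).
Proof.
move=> Mp; have [u E] := graphO.
have : (X @` M) (X p) by exists p.
rewrite E => -[z Oz zE]; suff -> : pi0 (X p) = z by [].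
by rewrite -zE /pi0 !mxE /=; case: (z).
Qed.

Lemma graph_fiber p q : M p -> M q -> x 0 p = x 0 q -> x 1 p = x 1 q -> x 2 p = x 2 q.
Proof.
move=> Mp Mq /addIr e0 /addIr e1; have [u E] := graphO.
have [z Oz zE] : [set space_point z (u z) | z in Omega] (X p) by rewrite -E; exists p.
have [w Ow wE] : [set space_point z (u z) | z in Omega] (X q) by rewrite -E; exists q.
have zw : z = w.
  apply/eqP; rewrite eq_complex; move: e0 e1; rewrite -zE -wE !mxE /= => -> ->.
  by rewrite !eqxx.
by rewrite /x -zE -wE zw.
Qed.

Lemma graph_star p th : M p -> 0 <= th <= 1 ->
  exists2 q, M q & x 0 q = th * x 0 p /\ x 1 q = th * x 1 p.
Proof.
move=> Mp thI; have [_ st] := starO; have := st _ (pi0_image Mp) th thI.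
have [u E] := graphO; set z := _ + _ => Oz.
have : (X @` M) (space_point z (u z)) by rewrite E; exists z.
move=> [q Mq qE]; exists q => //.
by rewrite /x qE !mxE /= !(mul0r, subr0, mulr0, addr0, oppr0); split; ring.
Qed.

Lemma box_compact k : compact (box M (x 0) (x 1) (x 2) k).
Proof.
have -> : box M (x 0) (x 1) (x 2) k = M `&` X @^-1` [set v | forall j, `[X p0 0 j - k, X p0 0 j + k]%classic (v 0 j)].
  apply/seteqP; split => [p [Mp h0 h1 h2]|p [Mp h]].
    split => // j; rewrite /= in_itv/= -ler_distl.
    have : j \in [:: 0; 1; 2] by case: j => [[|[|[|]]]].
    by rewrite !inE => /or3P[] /eqP ->.
  by split => //; rewrite /x ler_distl; [have := h 0|have := h 1|have := h 2]; rewrite /= in_itv/=.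
apply: properM; apply: (@rV_compact _ _ (fun j => `[X p0 0 j - k, X p0 0 j + k]%classic)).
by move=> j; exact: segment_compact.
Qed.

Lemma x_continuous j p : M p -> {for p, continuous (x j)}.
Proof.
move=> Mp; have cj : {for p, continuous (component X j)} by exact: (component_continuous oU XC (MU Mp)).
by apply: cvgB; [exact: cj|exact: cvg_cst].
Qed.

(** Near the centre, where the metric is definite, the height is at most a
    constant smaller than one times the radius. *)
Lemma cone_estimate_near : exists r eps : R, [/\ 0 < r, 0 < eps &
  forall p, M p -> radius (x 0) (x 1) p <= r ->
    `|x 2 p| <= (1 - eps) * radius (x 0) (x 1) p].
Proof.
have Up0 := MU (OM Op0).
have [c Sc cp0] := atlas_cover S p0; set z0 := coord c p0.
have la0 := conf_factor_gt0 Sc Op0 cp0; set la := conf_factor X c _ in la0.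
have [r r0 Hr] := spacelike_expansion oU XC XU Sc Up0 cp0 la0.
have [r' [C [[r'0 r'1 C0] sW bd ty]]] := taylor3 oU XC Sc Up0 cp0.
have k0 : 0 < 64 * C ^+ 2 by rewrite mulr_gt0// exprn_gt0.
pose ka := Num.min (la / 2 / (64 * C ^+ 2)) 1.
have ka0 : 0 < ka by rewrite lt_min ltr01 !divr_gt0.
have [kala ka1] : ka <= la / 2 / (64 * C ^+ 2) /\ ka <= 1 by rewrite /ka !ge_min !lexx orbT.
pose V := [set q | x 2 q ^+ 2 <= (1 - ka) * (x 0 q ^+ 2 + x 1 q ^+ 2)].
pose rho := Num.min r r'.
have rho0 : 0 < rho by rewrite lt_min r0.
have [rhor rhor'] : rho <= r /\ rho <= r' by rewrite /rho !ge_min !lexx orbT.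
have pV : nbhs p0 V.
  apply: filterS (coord_nbhs Sc cp0 (csquare_nbhs z0 rho0)) => q [cq [hR hI]].
  have := Hr (coord c q) (conj (le_trans hR rhor) (le_trans hI rhor)).
  rewrite (coordK Sc cq) -/la -/z0 => -[_].
  have sq : csquare z0 r' (coord c q) by split; [exact: le_trans hR rhor'|exact: le_trans hI rhor'].
  have sq0 : csquare z0 r' z0 by split; rewrite subrr normr0 ltW.
  set u := Re _ - Re _; set v := Im _ - Im _.
  have bnd j : x j q ^+ 2 <= 32 * C ^+ 2 * (u ^+ 2 + v ^+ 2).
    pose e := Num.max `|u| `|v|.
    have [ue ve] : `|u| <= e /\ `|v| <= e by rewrite /e !le_max !lexx orbT.
    have e0 : 0 <= e by exact: le_trans ue.
    have e1 : e <= 1.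
      by rewrite ge_max (le_trans (le_trans hR rhor') r'1) (le_trans (le_trans hI rhor') r'1).
    have e2 : e ^+ 2 <= u ^+ 2 + v ^+ 2.
      by rewrite /e; case: (leP `|u| `|v|) => _; rewrite real_normK ?num_real// ?lerDr ?lerDl sqr_ge0.
    have := ty j z0 (coord c q) e sq0 sq ue ve.
    have -> : (component X j \o param c) (coord c q) - (component X j \o param c) z0 = x j q.
      by rewrite /x /component /= /z0 (coordK Sc cq) (coordK Sc cp0).
    have b1 := ler_pM (normr_ge0 _) (normr_ge0 u) (bd j false z0 sq0) ue.
    have b2 := ler_pM (normr_ge0 _) (normr_ge0 v) (bd j true z0 sq0) ve.
    rewrite -!normrM in b1 b2; move: b1 b2; rewrite -/u -/v.
    set A := _ * u; set B := _ * v => b1 b2 b3.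
    have Ce : C * e ^+ 2 <= C * e by rewrite ler_wpM2l ?(ltW C0)// expr2 ler_piMr.
    have xe : `|x j q| <= 4 * (C * e).
      have := ler_normD (x j q - (A + B)) (A + B); rewrite subrK.
      have := ler_normD A B; have := mulr_ge0 (ltW C0) e0; lra.
    rewrite -(real_normK (num_real (x j q))).
    have : `|x j q| ^+ 2 <= (4 * (C * e)) ^+ 2.
      by rewrite ler_pXn2r// nnegrE// !mulr_ge0// ltW.
    move/le_trans; apply; rewrite !exprMn.
    have := ler_wpM2l (sqr_ge0 C) e2; have := mulr_ge0 (sqr_ge0 C) (sqr_ge0 e); lra.
  have bx := bnd 0; have bx' := bnd 1.
  rewrite -/(x 0 q) -/(x 1 q) -/(x 2 q) /V /= => h.
  have sx : x 0 q ^+ 2 + x 1 q ^+ 2 <= 64 * C ^+ 2 * (u ^+ 2 + v ^+ 2) by lra.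
  have n0 : 0 <= u ^+ 2 + v ^+ 2 by rewrite addr_ge0 ?sqr_ge0.
  have h2 : ka * (x 0 q ^+ 2 + x 1 q ^+ 2) <= la / 2 * (u ^+ 2 + v ^+ 2).
    rewrite (le_trans (ler_wpM2l (ltW ka0) sx))// mulrA ler_wpM2r//.
    by rewrite -ler_pdivlMr.
  rewrite mulrBl mul1r; lra.
have [d d0 Hd] := projection_open Op0 pV.
have x00 j : x j p0 = 0 by rewrite /x subrr.
exists (d / 2), (ka / 2); split; [by rewrite divr_gt0|by rewrite divr_gt0|].
move=> p Mp rp.
have xr (u v : R) : `|u| <= Num.sqrt (u ^+ 2 + v ^+ 2).
  by rewrite -sqrtr_sqr ler_sqrt ?lerDl ?addr_ge0 ?sqr_ge0.
have h0 : `|x 0 p - x 0 p0| < d.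
  by rewrite x00 subr0 (le_lt_trans (xr _ (x 1 p)))// (le_lt_trans rp)// ltr_pdivrMr//; lra.
have h1 : `|x 1 p - x 1 p0| < d.
  rewrite x00 subr0 (le_lt_trans (xr _ (x 0 p)))// addrC (le_lt_trans rp)//.
  by rewrite ltr_pdivrMr//; lra.
have [q [Oq Vq q0 q1]] := Hd _ _ h0 h1.
have x2E : x 2 p = x 2 q by apply: graph_fiber => //; exact: OM.
move: Vq; rewrite /V /= q0 q1 -x2E => h.
have s0 : 0 <= x 0 p ^+ 2 + x 1 p ^+ 2 by rewrite addr_ge0 ?sqr_ge0.
have k1 : 0 <= 1 - ka / 2 by lra.
rewrite -(@ler_pXn2r _ 2)// ?nnegrE ?mulr_ge0 ?sqrtr_ge0//.
rewrite real_normK ?num_real// exprMn sqr_sqrtr// (le_trans h)// ler_wpM2r//.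
by have := sqr_ge0 ka; rewrite !expr2; nra.
Qed.

Lemma immersion_cone_estimate : exists r eps : R, [/\ 0 < r, 0 < eps,
  forall p, M p -> radius (x 0) (x 1) p <= r ->
    `|x 2 p| <= (1 - eps) * radius (x 0) (x 1) p &
  forall p, M p -> r <= radius (x 0) (x 1) p ->
    `|x 2 p| <= radius (x 0) (x 1) p - eps * r].
Proof.
have [r [eps [r0 eps0 base]]] := cone_estimate_near.
exists r, eps; split => //.
apply: (@cone_estimate R T M (x 0) (x 1) (x 2)) => //.
- exact: x_continuous.
- exact: x_continuous.
- exact: x_continuous.
- exact: box_compact.
- exact: graph_fiber.
- by move=> q Mq; exact: (bad_values_local oU XC XU _ _ (MU Mq)).
- exact: graph_star.
- move=> p V Mp pV.
  have [p' [Op' Vp']] := clO Mp (nbhs_interior pV).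
  have [d d0 Hd] := projection_open Op' Vp'.
  exists p', d; split => //; [exact: OM|exact: nbhs_singleton|].
  by move=> y1 y2 h1 h2; have [q [Oq Vq q1 q2]] := Hd _ _ h1 h2; exists q; split => //; exact: OM.
Qed.

End ConeOfImmersion.

(** * Harmonicity of the coordinates *)


Section CauchyRiemann.
Local Open Scope complex_scope.
Context {R : realType}.

Notation Re := (@complex.Re R).
Notation Im := (@complex.Im R).

Lemma is_derive0P (g : R -> R) (a : R) :
  (forall e : R, 0 < e -> exists2 d : R, 0 < d &
    forall t, t != 0 -> `|t| < d -> `|t^-1 * (g t - g 0) - a| < e) ->
  is_derive (0 : R) 1 g a.
Proof.
move=> H.
have cv : (h^-1 *: (g (h *: (1 : R) + 0) - g 0)) @[h --> (0 : R)^'] --> a.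
  apply/cvgrPdist_lt => e e0; have [d d0 Hd] := H e e0.
  rewrite near_withinE; apply/near0P; exists d => // t td t0.
  by rewrite distrC addr0 [_ *: 1]mulr1; exact: Hd.
apply: DeriveDef; first exact: (cvgP a cv).
exact: (cvg_lim _ cv).
Qed.

(** The Cauchy-Riemann equations, as partial derivatives of the real and
    imaginary parts. *)
Lemma cauchy_riemann (h : Cplx R -> Cplx R) z : derivable h z 1 ->
  exists A B : R,
  [/\ is_derive (0 : R) 1 (fun t => Re (h (z + step false t))) A,
      is_derive (0 : R) 1 (fun t => Im (h (z + step false t))) B,
      is_derive (0 : R) 1 (fun t => Re (h (z + step true t))) (- B) &
      is_derive (0 : R) 1 (fun t => Im (h (z + step true t))) A].
Proof.
move=> dh; pose D : Cplx R := 'D_1 h z.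
have key (e : R) : 0 < e -> exists2 d : R, 0 < d & forall k : R[i], k != 0 ->
    `|Re k| < d -> `|Im k| < d ->
    `|Re (k^-1 * (h (z + k) - h z)) - Re D| < e /\
    `|Im (k^-1 * (h (z + k) - h z)) - Im D| < e.
  move=> e0; have cv : (k^-1 *: (h (k *: (1 : Cplx R) + z) - h z)) @[k --> (0 : R[i]^o)^'] --> D := dh.
  have nD : nbhs D [set w : Cplx R | `|Re w - Re D| < e /\ `|Im w - Im D| < e].
    by apply/nearCP; exists e.
  have /nearCP[d d0 Hd] : nbhs (0 : R[i]^o) [set k | k != 0 ->
      `|Re (k^-1 *: (h (k *: (1 : Cplx R) + z) - h z)) - Re D| < e /\
      `|Im (k^-1 *: (h (k *: (1 : Cplx R) + z) - h z)) - Im D| < e] := cv _ nD.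
  exists d => // k k0 kR kI; have := Hd k.
  rewrite /= !subr0 => /(_ kR kI k0).
  by rewrite [k *: 1]mulr1 [k + z]addrC.
have sn0 b (t : R) : t != 0 -> step b t != 0.
  by move=> t0; rewrite eq_complex; case: b => /=; rewrite (negbTE t0) ?andbF.
have s_lt b (t d : R) : 0 < d -> `|t| < d -> `|Re (step b t)| < d /\ `|Im (step b t)| < d.
  by move=> d0 td; rewrite Re_step Im_step; case: b; rewrite normr0.
exists (Re D), (Im D); split; apply: is_derive0P => e /key[d d0 Hd]; exists d => // t t0 td.
- have [h1 h2] := s_lt false t d d0 td; have [+ _] := Hd _ (sn0 false t t0) h1 h2.
  rewrite step0 addr0; congr (`|_ - _| < _).
  case: (h (z + _)) (h z) => [u v] [u' v'] /=; field; exact: t0.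
- have [h1 h2] := s_lt false t d d0 td; have [_ +] := Hd _ (sn0 false t t0) h1 h2.
  rewrite step0 addr0; congr (`|_ - _| < _).
  case: (h (z + _)) (h z) => [u v] [u' v'] /=; field; exact: t0.
- have [h1 h2] := s_lt true t d d0 td; have [_ +] := Hd _ (sn0 true t t0) h1 h2.
  rewrite step0 addr0 -normrN; congr (`|_| < _).
  case: (h (z + _)) (h z) => [u v] [u' v'] /=; field; exact: t0.
- have [h1 h2] := s_lt true t d d0 td; have [+ _] := Hd _ (sn0 true t t0) h1 h2.
  rewrite step0 addr0; congr (`|_ - _| < _).
  case: (h (z + _)) (h z) => [u v] [u' v'] /=; field; exact: t0.
Qed.

End CauchyRiemann.

Lemma continuous_add (R : realType) (T : topologicalType) (f g : T -> R) z :
  f w @[w --> z] --> f z -> g w @[w --> z] --> g z ->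
  (f w + g w) @[w --> z] --> f z + g z.
Proof. by move=> cf cg; apply: cvgD. Qed.

Lemma derivable_div_exp (K : numFieldType) (g : K^o -> K^o) (z z0 : K^o) n :
  derivable g z 1 -> z != z0 ->
  derivable (fun w : K^o => g w / (w - z0) ^+ n : K^o) z 1.
Proof.
move=> dg zz0.
have dX : derivable (fun w : K^o => (w - z0) ^+ n : K^o) z 1.
  elim: n => [|n IH].
    by have -> : (fun w : K^o => (w - z0) ^+ 0 : K^o) = cst 1 by apply/funext => w; rewrite expr0.
  have -> : (fun w : K^o => (w - z0) ^+ n.+1 : K^o) =
      (fun w : K^o => w - z0 : K^o) * (fun w : K^o => (w - z0) ^+ n : K^o).
    by apply/funext => w; rewrite exprS.
  by apply: derivableM => //; apply: derivableB.
apply: (@derivableM K K^o g (fun w : K^o => ((w - z0) ^+ n)^-1 : K^o)) => //.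
by apply: derivableV => //; rewrite expf_neq0// subr_eq0.
Qed.


Section Harmonicity.
Local Open Scope complex_scope.
Context {R : realType}.

Notation Re := (@complex.Re R).
Notation Im := (@complex.Im R).

(** The real part of the primitive of a meromorphic function is harmonic where
    it is twice differentiable. *)
Lemma meromorphic_gradient_harmonic (W : set (Cplx R)) (f : Cplx R -> R)
    (om : Cplx R -> Cplx R) z0 :
  Ck_on 2 W f -> nbhs z0 W -> meromorphic_at om z0 ->
  (forall z, W z -> om z = partial false f z +i* (- partial true f z)) ->
  partial false (partial false f) z0 + partial true (partial true f) z0 = 0.
Proof.
move=> fC zW [n [g [gd gom]]] omE.
have [e1 e10 H1] : exists2 e : R, 0 < e & forall z, `|Re z - Re z0| < e ->
    `|Im z - Im z0| < e -> W z /\ derivable g z 1.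
  by apply/nearCP; exact: (@filterI _ _ (nbhs_filter z0)).
have /nearCP[e2 e20 H2] : nbhs z0 [set z | z != z0 -> om z = g z / (z - z0) ^+ n] by exact: gom.
pose e := Num.min e1 e2; have e0 : 0 < e by rewrite lt_min e10.
have lap z : z != z0 -> `|Re z - Re z0| < e -> `|Im z - Im z0| < e ->
    partial false (partial false f) z + partial true (partial true f) z = 0.
  move=> zz0; rewrite !lt_min => /andP[r1 r2] /andP[i1 i2].
  have [Wz gz] := H1 z r1 i1.
  have zE : (z - z0 : Cplx R) != 0 by rewrite subr_eq0.
  pose h (w : Cplx R) : Cplx R := partial false f w +i* (- partial true f w).
  have near_z : \forall w \near z, W w /\ g w / (w - z0) ^+ n = h w.
    have d1 : 0 < e - `|Re z - Re z0| by rewrite subr_gt0 lt_min r1.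
    have d2 : 0 < e - `|Im z - Im z0| by rewrite subr_gt0 lt_min i1.
    have zn : nbhs z [set w : Cplx R | w != z0].
      have := @open_nbhs_nbhs (Cplx R) z [set~ z0].
      move=> H; apply: (@filterS _ _ (nbhs_filter z) _ _ _ (H _)) => [w /eqP//|].
      split; last by apply/eqP.
      apply: closed_openC; apply: accessible_closed_set1; apply: hausdorff_accessible.
      exact: norm_hausdorff.
    have zs : nbhs z [set w : Cplx R | `|Re w - Re z0| < e /\ `|Im w - Im z0| < e].
      apply/nearCP; exists (Num.min (e - `|Re z - Re z0|) (e - `|Im z - Im z0|)).
        by rewrite lt_min d1.
      move=> w; rewrite !lt_min => /andP[w1 _] /andP[_ w2].
      split; first by have := ler_distD (Re z) (Re w) (Re z0); lra.
      by have := ler_distD (Im z) (Im w) (Im z0); lra.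
    apply: (@filterS _ _ (nbhs_filter z) _ _ _ (@filterI _ _ (nbhs_filter z) _ _ zn zs)).
    move=> w [wz0 []]; rewrite !lt_min => /andP[a1 a2] /andP[b1 b2].
    have [Ww _] := H1 w a1 b1; split => //.
    by rewrite -(H2 w a2 b2 wz0) (omE w Ww).
  have dh : derivable h z 1.
    have dq := @derivable_div_exp (R[i]) g z z0 n gz zz0.
    apply: near_eq_derivable dq.
    by apply: filterS near_z => w [].
  have [A [B [h1 _ _ h2]]] := cauchy_riemann dh.
  have s1 := @C2_slice_partial R W f fC false false z 0.
  have s2 := @C2_slice_partial R W f fC true true z 0.
  rewrite !step0 !addr0 in s1 s2.
  have [_ E1] := s1 Wz; have [_ E1'] := h1; have [_ E2] := s2 Wz.
  have h3 : is_derive (0 : R) 1 (slice true (partial true f) z) (- A).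
    have -> : slice true (partial true f) z = - (fun t => Im (h (z + step true t))).
      by apply/funext => t; rewrite /h /slice /GRing.opp /= opprK.
    exact: is_deriveN.
  have [_ E2'] := h3.
  rewrite -E1 -E2 E2'.
  have -> : 'D_1 (slice false (partial false f) z) 0 = A by exact: E1'.
  by rewrite subrr.
pose L z := partial false (partial false f) z + partial true (partial true f) z.
have Wz0 := nbhs_singleton zW.
have cL : L w @[w --> z0] --> L z0.
  have c0 := @C2_partial2_continuous R W f fC false false z0 Wz0.
  have c1 := @C2_partial2_continuous R W f fC true true z0 Wz0.
  exact (continuous_add c0 c1).
apply/eqP; rewrite -normr_le0; apply/ler_addgt0Pr => eps eps0; rewrite add0r.
have /nearCP[d d0 Hd] := continuous_dist cL eps0.
pose t := Num.min d e / 2; have m0 : 0 < Num.min d e by rewrite lt_min d0.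
have t0 : 0 < t by rewrite divr_gt0.
have [td te] : t < d /\ t < e.
  have : t < Num.min d e by rewrite ltr_pdivrMr//; lra.
  by rewrite lt_min => /andP[].
set z1 := z0 + step false t.
have hR : Re z1 - Re z0 = t by rewrite ReD Re_step addrAC subrr add0r.
have hI : Im z1 - Im z0 = 0 by rewrite ImD Im_step addrAC subrr add0r.
have z10 : z1 != z0.
  by apply/eqP => E; move: t0; rewrite -hR E subrr ltxx.
have L1 : L z1 = 0.
  by apply: lap z10 _ _; rewrite ?hR ?hI ?normr0// gtr0_norm.
have := Hd z1; rewrite hR hI normr0 gtr0_norm// => /(_ td d0).
by rewrite L1 sub0r normrN => /ltW.
Qed.

End Harmonicity.

(** * Maximum principles *)


Section WithinContinuity.
Context {R : realType} {T : topologicalType}.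

Lemma within_continuousP (A : set T) (g : T -> R) :
  {within A, continuous g} <->
  (forall p, A p -> forall e : R, 0 < e -> \forall q \near p, A q -> `|g q - g p| < e).
Proof.
split=> [/subspace_continuousP cg p Ap e e0|H].
  have /cvgrPdist_lt/(_ e e0) := cg p Ap.
  by rewrite near_withinE; apply: filterS => q h /h; rewrite distrC.
apply/subspace_continuousP => p Ap; apply/cvgrPdist_lt => e e0.
by rewrite near_withinE; apply: filterS (H p Ap e e0) => q h /h; rewrite distrC.
Qed.

Lemma within_continuous_of_continuous (A : set T) (g : T -> R) :
  (forall p, A p -> {for p, continuous g}) -> {within A, continuous g}.
Proof.
move=> cg; apply/within_continuousP => p Ap e e0.
by apply: filterS (continuous_dist (cg p Ap) e0).
Qed.

Lemma compact_sublevel (A : set T) (g : T -> R) (c : R) : compact A ->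
  {within A, continuous g} -> compact (A `&` [set p | g p <= c]).
Proof.
move=> cA /within_continuousP cg F FF FA.
have FA' : F A by apply: filterS FA => p [].
have [p [Ap clp]] := cA F FF FA'; exists p; split => //; split => //=.
rewrite leNgt; apply/negP => cp.
have d0 : 0 < g p - c by rewrite subr_gt0.
have [q [[Aq qc] h]] := clp _ _ FA (cg p Ap _ d0).
by have := h Aq; rewrite ltr_norml => /andP[+ _]; move: qc => /=; lra.
Qed.

End WithinContinuity.

Lemma opp_continuous_at (R : realType) (T : topologicalType) (g : T -> R) z :
  g w @[w --> z] --> g z -> - g w @[w --> z] --> - g z.
Proof. exact: cvgN. Qed.

Lemma add_inv_continuous (R : realType) (T : topologicalType) (f g : T -> R) (e : R) z :
  f w @[w --> z] --> f z -> g w @[w --> z] --> g z -> g z != 0 ->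
  (f w + e * (g w)^-1) @[w --> z] --> f z + e * (g z)^-1.
Proof.
move=> cf cg g0; apply: cvgD => //; apply: cvgM; first exact: cvg_cst.
exact: cvgV.
Qed.

Section StrongMaximum.
Local Open Scope complex_scope.
Context {R : realType}.

Notation Re := (@complex.Re R).
Notation Im := (@complex.Im R).

(** [f] is twice differentiable along the axes at [z], with zero Laplacian. *)
Definition harmonic_jet (f : Cplx R -> R) z : Prop := exists a b a' b',
  [/\ jet2 (slice false f z) a b, jet2 (slice true f z) a' b' & b + b' = 0].

Lemma harmonic_jetN f z : harmonic_jet f z -> harmonic_jet (fun w => - f w) z.
Proof.
move=> [a [b [a' [b' [h h' E]]]]]; exists (-1 * a), (-1 * b), (-1 * a'), (-1 * b').
split; last by rewrite -mulrDr E mulr0.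
- by apply: jet2_near (jet2Z (-1) h); apply/near0P; exists 1 => // t _; rewrite mulN1r.
- by apply: jet2_near (jet2Z (-1) h'); apply/near0P; exists 1 => // t _; rewrite mulN1r.
Qed.

Lemma jet2_id : @jet2 R (fun t => t) 1 0.
Proof.
exists (fun=> 1); split => //; last exact: is_derive_cst.
by apply/near0P; exists 1 => // t _; exact: is_derive_id.
Qed.

(** The square of the distance from [w]. *)
Definition sqdist (w z : Cplx R) : R :=
  (Re z - Re w) * (Re z - Re w) + (Im z - Im w) * (Im z - Im w).

Lemma sqdist_jet (w z : Cplx R) :
  jet2 (slice false (sqdist w) z) (2 * (Re z - Re w)) 2 /\
  jet2 (slice true (sqdist w) z) (2 * (Im z - Im w)) 2.
Proof.
have base (u c : R) : jet2 (fun t => (u + t) * (u + t) + c) (2 * u) 2.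
  have j := jet2D (jet2_cst u) jet2_id.
  have := jet2D (jet2M j j) (jet2_cst c); rewrite !addr0.
  by congr (jet2 _ _ _); ring.
split.
  have -> : slice false (sqdist w) z = (fun t => (Re z - Re w + t) * (Re z - Re w + t) +
      (Im z - Im w) * (Im z - Im w)).
    by apply/funext => t; rewrite /slice /sqdist ReD ImD /= addr0 (addrAC (Re z)).
  exact: base.
have -> : slice true (sqdist w) z = (fun t => (Im z - Im w + t) * (Im z - Im w + t) +
      (Re z - Re w) * (Re z - Re w)).
  by apply/funext => t; rewrite /slice /sqdist ReD ImD /= addr0 (addrAC (Im z)) [LHS]addrC.
exact: base.
Qed.

Lemma sqdist_continuous (w z : Cplx R) : {for z, continuous (sqdist w)}.
Proof.
exact (@sum_sq_continuous R (Cplx R) Re Im (Re w) (Im w) z (Re_continuous (z := z)) (Im_continuous (z := z))).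
Qed.

(** If a harmonic function bounded by [s] on a disc is smaller than [s] at the
    centre, it is smaller than [s] in the disc. The barrier is the strictly
    subharmonic function [1 / |z - w|^2]. *)
Lemma harmonic_disc_lt (f : Cplx R -> R) (w : Cplx R) (rho s : R) : 0 < rho ->
  (forall z, sqdist w z <= rho ^+ 2 ->
     [/\ harmonic_jet f z, {for z, continuous f} & f z <= s]) ->
  f w < s -> forall z, sqdist w z < rho ^+ 2 -> f z < s.
Proof.
move=> rho0 H fw z zr.
have sww : sqdist w w = 0 by rewrite /sqdist !subrr mul0r addr0.
have swr : sqdist w w <= rho ^+ 2 by rewrite sww sqr_ge0.
have [_ cfw _] := H w swr.
pose eta := (s - f w) / 2; have eta0 : 0 < eta by rewrite divr_gt0// subr_gt0.
have /nearCP[e e0 He] := continuous_dist cfw eta0.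
pose de := Num.min e rho / 2; have m0 : 0 < Num.min e rho by rewrite lt_min e0.
have de0 : 0 < de by rewrite divr_gt0.
have [dee der] : de < e /\ de < rho.
  have : de < Num.min e rho by rewrite /de ltr_pdivrMr//; lra.
  by rewrite lt_min => /andP[].
have inner v : sqdist w v <= de ^+ 2 -> f v < s - eta.
  move=> vd; have conv (a b : R) : a * a + b * b <= de ^+ 2 -> `|a| < e.
    move=> h; rewrite (le_lt_trans _ dee)// -(@ler_pXn2r _ 2)// ?nnegrE ?(ltW de0)//.
    by rewrite real_normK ?num_real// (le_trans _ h)// expr2 lerDl -expr2 sqr_ge0.
  have h1 := conv _ _ vd; rewrite /sqdist addrC in vd; have h2 := conv _ _ vd.
  by have := He v h1 h2; rewrite ltr_norml => /andP[_]; rewrite /eta; lra.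
have [zde|dez] := leP (sqdist w z) (de ^+ 2).
  by rewrite (lt_trans (inner z zde))// ltrBlDr ltrDl.
rewrite ltNge; apply/negP => sfz.
have de2 : 0 < de ^+ 2 by rewrite exprn_gt0.
have rho2 : 0 < rho ^+ 2 by rewrite exprn_gt0.
pose K := (csquare w rho `&` [set v | sqdist w v <= rho ^+ 2]) `&`
  [set v | - sqdist w v <= - de ^+ 2].
have KP v : K v <-> de ^+ 2 <= sqdist w v <= rho ^+ 2.
  split=> [[[_ h1] h2]|/andP[h1 h2]].
    by apply/andP; split => //; move: h2; rewrite /= lerN2.
  split; last by rewrite /= lerN2.
  split => //; have conv (a b : R) : a * a + b * b <= rho ^+ 2 -> `|a| <= rho.
    move=> h; rewrite -(@ler_pXn2r _ 2)// ?nnegrE ?(ltW rho0)//.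
    by rewrite real_normK ?num_real// (le_trans _ h)// expr2 lerDl -expr2 sqr_ge0.
  by split; [exact: conv h2|move: h2; rewrite /sqdist addrC; exact: conv].
have cK : compact K.
  apply: compact_sublevel; first apply: compact_sublevel.
  - exact: csquare_compact.
  - by apply: within_continuous_of_continuous => v _; exact: sqdist_continuous.
  - apply: within_continuous_of_continuous => v _.
    exact (opp_continuous_at (@sqdist_continuous w v)).
pose eps := eta * de ^+ 2; have eps0 : 0 < eps by rewrite mulr_gt0.
pose G v := f v + eps * (sqdist w v)^-1.
have Kz : K z by apply/KP; rewrite !ltW.
have posK v : K v -> 0 < sqdist w v by move=> /KP/andP[h _]; exact: lt_le_trans h.
have cG : {within K, continuous G}.
  apply: within_continuous_of_continuous => v Kv.
  have [_ cf _] : [/\ harmonic_jet f v, {for v, continuous f} & f v <= s].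
    by apply: H; have /KP/andP[] := Kv.
  exact (@add_inv_continuous R (Cplx R) f (sqdist w) eps v cf (@sqdist_continuous w v) (lt0r_neq0 (posK v Kv))).
have [zm] := compact_EVT_max (ex_intro _ z Kz) cK cG; rewrite inE => Kzm zmax.
have {}zmax v : K v -> G v <= G zm by move=> Kv; apply: zmax; rewrite inE.
have Nz := posK z Kz; have Nm := posK zm Kzm.
have big : s + eps * (rho ^+ 2)^-1 < G zm.
  apply: lt_le_trans (zmax z Kz); rewrite /G ler_ltD// ltr_pM2l//.
  by rewrite ltf_pV2 ?posrE.
have /KP/andP[zm1 zm2] := Kzm.
have [jm cfm fm] := H zm zm2.
have zm2' : sqdist w zm < rho ^+ 2.
  rewrite lt_neqAle zm2 andbT; apply/eqP => E.
  by move: big; rewrite /G E ltrD2r ltNge fm.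
have zm1' : de ^+ 2 < sqdist w zm.
  rewrite lt_neqAle zm1 andbT; apply/eqP => E.
  have := inner zm; rewrite -E => /(_ (lexx _)) h.
  have : eps * (rho ^+ 2)^-1 >= 0 by rewrite ltW// mulr_gt0 // invr_gt0.
  have : eps * (de ^+ 2)^-1 = eta by rewrite /eps mulfK// gt_eqF.
  by move: big; rewrite /G -E; lra.
have nK : nbhs zm K.
  have m0' : 0 < Num.min (sqdist w zm - de ^+ 2) (rho ^+ 2 - sqdist w zm).
    by rewrite lt_min !subr_gt0 zm1'.
  apply: (@filterS _ _ (nbhs_filter zm) _ _ _ (continuous_dist (@sqdist_continuous w zm) m0')).
  move=> v; rewrite /= lt_min ltr_norml => /andP[/andP[h1 _]]; rewrite ltr_norml => /andP[_ h2].
  by apply/KP; apply/andP; split; lra.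
have [a [b [a' [b' [j1 j2 E]]]]] := jm.
have [s1 s2] := sqdist_jet w zm.
have st0 (g : Cplx R -> R) bb : slice bb g zm 0 = g zm by rewrite /slice step0 addr0.
have pos1 bb : 0 < slice bb (sqdist w) zm 0 by rewrite st0.
have g1 := jet2D j1 (jet2Z eps (jet2V s1 (pos1 false))).
have g2 := jet2D j2 (jet2Z eps (jet2V s2 (pos1 true))).
have mx bb : \forall t \near (0 : R), G (zm + step bb t) <= G zm.
  by have := near_step bb nK; apply: filterS => t; exact: zmax.
have l1 := jet2_local_max g1 _; have l2 := jet2_local_max g2 _.
have {}l1 := l1 _; have {}l2 := l2 _.
have e1' : b + eps * (2 * (2 * (Re zm - Re w)) ^+ 2 / sqdist w zm ^+ 3 - 2 / sqdist w zm ^+ 2) <= 0.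
  have := l1; rewrite !st0; apply; exact: (mx false).
have e2' : b' + eps * (2 * (2 * (Im zm - Im w)) ^+ 2 / sqdist w zm ^+ 3 - 2 / sqdist w zm ^+ 2) <= 0.
  have := l2; rewrite !st0; apply; exact: (mx true).
have : 0 < eps * (4 / sqdist w zm ^+ 2) by rewrite mulr_gt0// divr_gt0// exprn_gt0.
have -> : eps * (4 / sqdist w zm ^+ 2) =
  (b + eps * (2 * (2 * (Re zm - Re w)) ^+ 2 / sqdist w zm ^+ 3 - 2 / sqdist w zm ^+ 2)) +
  (b' + eps * (2 * (2 * (Im zm - Im w)) ^+ 2 / sqdist w zm ^+ 3 - 2 / sqdist w zm ^+ 2)).
  rewrite addrACA E add0r -mulrDr; congr (_ * _).
  have -> : 2 * (2 * (Re zm - Re w)) ^+ 2 / sqdist w zm ^+ 3 - 2 / sqdist w zm ^+ 2 +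
   (2 * (2 * (Im zm - Im w)) ^+ 2 / sqdist w zm ^+ 3 - 2 / sqdist w zm ^+ 2) =
   8 * sqdist w zm / sqdist w zm ^+ 3 - 4 / sqdist w zm ^+ 2.
    rewrite {5}/sqdist; field; exact: lt0r_neq0.
  by field; exact: lt0r_neq0.
by move=> h; move: e1' e2' h; lra.
Qed.

End StrongMaximum.

(** * The barrier at infinity *)


Section Barrier.
Context {R : realType}.

(** For an orthogonal basis [A, B] of equal squares [la > 0] of a spacelike
    plane, the tangential part of [x] is at least as long as [x]. *)
Lemma tangential_part_ge (a1 a2 a3 b1 b2 b3 x1 x2 x3 la : R) : 0 < la ->
  a1 ^+ 2 + a2 ^+ 2 - a3 ^+ 2 = la -> b1 ^+ 2 + b2 ^+ 2 - b3 ^+ 2 = la ->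
  a1 * b1 + a2 * b2 - a3 * b3 = 0 ->
  la * (x1 ^+ 2 + x2 ^+ 2 - x3 ^+ 2) <=
  (x1 * a1 + x2 * a2 - x3 * a3) ^+ 2 + (x1 * b1 + x2 * b2 - x3 * b3) ^+ 2.
Proof.
move=> la0 hA hB hAB.
pose det := a1 * (b2 * x3 - b3 * x2) - a2 * (b1 * x3 - b3 * x1) + a3 * (b1 * x2 - b2 * x1).
have gram : det ^+ 2 = - ((a1 ^+ 2 + a2 ^+ 2 - a3 ^+ 2) *
    ((b1 ^+ 2 + b2 ^+ 2 - b3 ^+ 2) * (x1 ^+ 2 + x2 ^+ 2 - x3 ^+ 2) -
     (x1 * b1 + x2 * b2 - x3 * b3) ^+ 2) -
   (a1 * b1 + a2 * b2 - a3 * b3) *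
    ((a1 * b1 + a2 * b2 - a3 * b3) * (x1 ^+ 2 + x2 ^+ 2 - x3 ^+ 2) -
     (x1 * a1 + x2 * a2 - x3 * a3) * (x1 * b1 + x2 * b2 - x3 * b3)) +
   (x1 * a1 + x2 * a2 - x3 * a3) *
    ((a1 * b1 + a2 * b2 - a3 * b3) * (x1 * b1 + x2 * b2 - x3 * b3) -
     (b1 ^+ 2 + b2 ^+ 2 - b3 ^+ 2) * (x1 * a1 + x2 * a2 - x3 * a3))).
  by rewrite /det; ring.
have := sqr_ge0 det; rewrite gram hA hB hAB.
set al := x1 * a1 + _ - _; set be := x1 * b1 + _ - _; set f := x1 ^+ 2 + _ - _ => h.
by rewrite -(ler_pM2l la0); move: h; rewrite !expr2; lra.
Qed.

Lemma lorentz_square_jet (g1 g2 g3 : R -> R) a1 a2 a3 b1 b2 b3 :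
  jet2 g1 a1 b1 -> jet2 g2 a2 b2 -> jet2 g3 a3 b3 ->
  jet2 (fun t => g1 t * g1 t + g2 t * g2 t + -1 * (g3 t * g3 t))
    (2 * (g1 0 * a1 + g2 0 * a2 - g3 0 * a3))
    (2 * (a1 ^+ 2 + a2 ^+ 2 - a3 ^+ 2) + 2 * (g1 0 * b1 + g2 0 * b2 - g3 0 * b3)).
Proof.
move=> j1 j2 j3.
have := jet2D (jet2D (jet2M j1 j1) (jet2M j2 j2)) (jet2Z (-1) (jet2M j3 j3)).
by congr (jet2 _ _ _); ring.
Qed.

Lemma log_log_jet (g : R -> R) (c a b : R) : jet2 g a b -> 0 < g 0 ->
  0 < 1 + (ln (g 0) - c) ->
  jet2 (fun t => ln (1 + (ln (g t) - c)))
    (a / g 0 / (1 + (ln (g 0) - c)))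
    ((b / g 0 - (a / g 0) ^+ 2) / (1 + (ln (g 0) - c)) -
     (a / g 0 / (1 + (ln (g 0) - c))) ^+ 2).
Proof.
move=> jg g0 l0.
have j := jet2D (jet2_cst 1) (jet2D (jet2_ln jg g0) (jet2_cst (- c))).
by have := jet2_ln j l0; rewrite !addr0 !add0r.
Qed.

(** On a maximal surface [log (1 + log <x, x> - c)] is strictly superharmonic
    where [log <x, x> >= c]: the Laplacian of [<x, x>] is [4 la]
    and the square of its gradient at least [4 la <x, x>]. Here [g] and [h] are
    the coordinates along the two axes of a conformal chart. *)
Lemma log_log_superharmonic (g1 g2 g3 h1 h2 h3 : R -> R)
    (a1 a2 a3 b1 b2 b3 a1' a2' a3' b1' b2' b3' la c : R) :
  jet2 g1 a1 b1 -> jet2 g2 a2 b2 -> jet2 g3 a3 b3 ->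
  jet2 h1 a1' b1' -> jet2 h2 a2' b2' -> jet2 h3 a3' b3' ->
  h1 0 = g1 0 -> h2 0 = g2 0 -> h3 0 = g3 0 ->
  b1 + b1' = 0 -> b2 + b2' = 0 -> b3 + b3' = 0 -> 0 < la ->
  a1 ^+ 2 + a2 ^+ 2 - a3 ^+ 2 = la -> a1' ^+ 2 + a2' ^+ 2 - a3' ^+ 2 = la ->
  a1 * a1' + a2 * a2' - a3 * a3' = 0 ->
  0 < g1 0 * g1 0 + g2 0 * g2 0 + -1 * (g3 0 * g3 0) ->
  0 <= ln (g1 0 * g1 0 + g2 0 * g2 0 + -1 * (g3 0 * g3 0)) - c ->
  exists A B A' B', [/\
    jet2 (fun t => ln (1 + (ln (g1 t * g1 t + g2 t * g2 t + -1 * (g3 t * g3 t)) - c))) A B,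
    jet2 (fun t => ln (1 + (ln (h1 t * h1 t + h2 t * h2 t + -1 * (h3 t * h3 t)) - c))) A' B' &
    B + B' < 0].
Proof.
move=> j1 j2 j3 k1 k2 k3 e1 e2 e3 L1 L2 L3 la0 hA hB hAB f0 l0.
have jf := lorentz_square_jet j1 j2 j3; have kf := lorentz_square_jet k1 k2 k3.
have l1 : 0 < 1 + (ln (g1 0 * g1 0 + g2 0 * g2 0 + -1 * (g3 0 * g3 0)) - c).
  by rewrite ltr_pwDl.
have J := log_log_jet jf f0 l1.
have K := log_log_jet kf.
rewrite e1 e2 e3 in K; have {}K := K c f0 l1.
do 4 eexists; split; [exact: J|exact: K|].
have tang := tangential_part_ge (g1 0) (g2 0) (g3 0) la0 hA hB hAB.
rewrite hA hB.
have -> : g1 0 * b1' + g2 0 * b2' - g3 0 * b3' = - (g1 0 * b1 + g2 0 * b2 - g3 0 * b3).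
  have -> : b1' = - b1 by lra. have -> : b2' = - b2 by lra. have -> : b3' = - b3 by lra.
  by ring.
move: tang f0 l1; rewrite -!expr2.
have -> : g1 0 ^+ 2 + g2 0 ^+ 2 + -1 * g3 0 ^+ 2 = g1 0 ^+ 2 + g2 0 ^+ 2 - g3 0 ^+ 2 by ring.
set f := _ - g3 0 ^+ 2; set u := _ - g3 0 * a3; set v := _ - g3 0 * a3'.
set w := _ - g3 0 * b3; set l := 1 + _ => tang f0 l1.
have fn : f != 0 by rewrite gt_eqF.
have ln0 : l != 0 by rewrite gt_eqF.
have -> : ((2 * la + 2 * w) / f - (2 * u / f) ^+ 2) / l - (2 * u / f / l) ^+ 2 +
  (((2 * la + 2 * - w) / f - (2 * v / f) ^+ 2) / l - (2 * v / f / l) ^+ 2) =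
  - (4 * (u ^+ 2 + v ^+ 2 - la * f) / (f ^+ 2 * l) + 4 * (u ^+ 2 + v ^+ 2) / (f * l) ^+ 2).
  by field; rewrite fn ln0.
rewrite oppr_lt0; apply: ltr_wpDl.
  apply: divr_ge0; first by rewrite mulr_ge0// subr_ge0.
  by rewrite mulr_ge0 ?sqr_ge0// ltW.
apply: divr_gt0; last by rewrite exprn_gt0// mulr_gt0.
by rewrite mulr_gt0// (lt_le_trans _ tang)// mulr_gt0.
Qed.

End Barrier.

Section BoundedHarmonic.
Context {R : realType} {T : topologicalType} (S : riemann_surface R T).
Variables (X : T -> 'rV[R]_3) (U O M : set T) (p0 : T).
Hypothesis oU : open U.
Hypothesis XC : forall j k, Ck_surface S k U (component X j).
Hypothesis XU : forall c, atlas S c -> forall p, U p -> cdom c p ->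
  conformal_at X c (coord c p).
Hypothesis oO : open O.
Hypothesis OM : O `<=` M.
Hypothesis MU : M `<=` U.
Hypothesis spO : forall c, atlas S c -> forall p, O p -> cdom c p ->
  spacelike_at X c (coord c p).
Hypothesis harmX : forall j c, atlas S c -> forall p, O p -> cdom c p ->
  partial false (partial false (component X j \o param c)) (coord c p) +
  partial true (partial true (component X j \o param c)) (coord c p) = 0.
Hypothesis properM : proper_on M X.
Hypothesis Op0 : O p0.
Hypothesis connM : connected M.

Let x j (q : T) : R := X q 0 j - X p0 0 j.
Let rad := radius (x 0) (x 1).

Variables (r eps : R).
Hypothesis r0 : 0 < r.
Hypothesis eps0 : 0 < eps.
Hypothesis near_cone : forall p, M p -> rad p <= r -> `|x 2 p| <= (1 - eps) * rad p.
Hypothesis far_cone : forall p, M p -> r <= rad p -> `|x 2 p| <= rad p - eps * r.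

Variables (F : T -> R) (B : R).
Hypothesis cF : {within M, continuous F}.
Hypothesis harmF : forall c, atlas S c -> forall p, O p -> cdom c p ->
  harmonic_jet (F \o param c) (coord c p).
Hypothesis FB : forall p, M p -> `|F p| <= B.
Hypothesis F0 : forall p, M p -> ~ O p -> F p = 0.
Hypothesis bd : exists2 p, M p & ~ O p.

(** The Lorentzian square of the position vector from the centre. *)
Let f q : R := x 0 q * x 0 q + x 1 q * x 1 q + -1 * (x 2 q * x 2 q).
(** A lower bound of [f] beyond the radius [r]. *)
Let f0 : R := eps * r * r.
(** The barrier: nonnegative, proper and strictly superharmonic beyond the
    radius [r]. *)
Let phi q : R := ln (1 + (ln (f q) - ln f0)).

Let rad_ge0 q : 0 <= rad q. Proof. exact: sqrtr_ge0. Qed.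

Let f0_gt0 : 0 < f0. Proof. by rewrite !mulr_gt0. Qed.

Let f_ge q : M q -> r <= rad q -> eps * r * rad q <= f q.
Proof.
move=> Mq rq; have h := far_cone Mq rq.
have -> : f q = (rad q - `|x 2 q|) * (rad q + `|x 2 q|).
  rewrite -subr_sqr real_normK ?num_real// /rad /radius sqr_sqrtr ?addr_ge0 ?sqr_ge0//.
  by rewrite /f; ring.
have hn := normr_ge0 (x 2 q); have er : 0 < eps * r by rewrite mulr_gt0.
by apply: ler_pM => //; lra.
Qed.

Let f0_le q : M q -> r <= rad q -> f0 <= f q.
Proof.
by move=> Mq rq; rewrite (le_trans _ (f_ge Mq rq))// ler_wpM2l// ltW// mulr_gt0.
Qed.

Let log_ge0 q : M q -> r <= rad q -> 0 <= ln (f q) - ln f0.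
Proof.
move=> Mq rq; have h := f0_le Mq rq.
by rewrite subr_ge0 ler_ln ?posrE// (lt_le_trans f0_gt0).
Qed.

Let phi_ge0 q : M q -> r <= rad q -> 0 <= phi q.
Proof. by move=> Mq rq; rewrite ln_ge0// lerDl log_ge0. Qed.

Let x_cont j p : M p -> {for p, continuous (x j)}.
Proof. by move=> Mp; exact: (@x_continuous R T S X U M p0 oU XC MU j p Mp). Qed.

Let rad_cont p : M p -> {for p, continuous rad}.
Proof.
move=> Mp; apply: (@radius_continuous R T M (x 0) (x 1)) => //; exact: x_cont.
Qed.

Let phi_cont p : M p -> r <= rad p -> {for p, continuous phi}.
Proof.
move=> Mp rp.
have cf : {for p, continuous f}.
  have h j : x j w @[w --> p] --> x j p := @x_cont j p Mp.
  apply: cvgD; first by apply: cvgD; apply: cvgM; exact: h.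
  by apply: cvgM; [exact: cvg_cst|apply: cvgM; exact: h].
have fp : 0 < f p by rewrite (lt_le_trans f0_gt0)// f0_le.
have cl : ln (f w) @[w --> p] --> ln (f p).
  by apply: (continuous_cvg _ (continuous_ln fp)); exact: cf.
have cl' : 1 + (ln (f w) - ln f0) @[w --> p] --> 1 + (ln (f p) - ln f0).
  by apply: cvgD; [exact: cvg_cst|apply: cvgB => //; exact: cvg_cst].
have lp : 0 < 1 + (ln (f p) - ln f0) by rewrite ltr_pwDl// log_ge0.
exact: (continuous_cvg _ (continuous_ln lp) cl').
Qed.

Let box_comp k : compact (box M (x 0) (x 1) (x 2) k).
Proof. exact: (@box_compact R T X M p0 properM k). Qed.

Let x_le_rad q : `|x 0 q| <= rad q /\ `|x 1 q| <= rad q.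
Proof.
have xr (u v : R) : `|u| <= Num.sqrt (u ^+ 2 + v ^+ 2).
  by rewrite -sqrtr_sqr ler_sqrt ?lerDl ?addr_ge0 ?sqr_ge0.
by split; [exact: xr|rewrite /rad /radius addrC; exact: xr].
Qed.

Let x2_le_rad q : M q -> `|x 2 q| <= rad q.
Proof.
move=> Mq; have [rq|/ltW rq] := leP (rad q) r.
  have := near_cone Mq rq; have := mulr_ge0 (ltW eps0) (rad_ge0 q); lra.
have := far_cone Mq rq; have := mulr_gt0 eps0 r0; lra.
Qed.

Let disc_compact k : compact (M `&` [set q | rad q <= k]).
Proof.
have -> : M `&` [set q | rad q <= k] = box M (x 0) (x 1) (x 2) k `&` [set q | rad q <= k].
  apply/seteqP; split=> q [] => [Mq qk|[Mq _ _ _] qk]; split => //; split => //.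
  - exact: le_trans (proj1 (x_le_rad q)) qk.
  - exact: le_trans (proj2 (x_le_rad q)) qk.
  - exact: le_trans (x2_le_rad Mq) qk.
apply: compact_sublevel; first exact: box_comp.
by apply: within_continuous_of_continuous => q [Mq _ _ _]; exact: rad_cont.
Qed.

(** Second derivative test for [F - e phi] at a point beyond the radius [r]. *)
Let no_interior_max (e : R) q : 0 < e -> O q -> r < rad q ->
  ~ (\forall q' \near q, F q' - e * phi q' <= F q - e * phi q).
Proof.
move=> e0 Oq rq mx.
have [c Sc cq] := atlas_cover S q; set z0 := coord c q.
have Mq := OM Oq; have Uq := MU Mq.
have zW := chart_nbhs Sc oU Uq cq.
have la0 := conf_factor_gt0 spO Sc Oq cq.
have [hG hF] := conformalE XU Sc Uq cq.
have jx j b : jet2 (fun t => x j (param c (z0 + step b t)))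
    (partial b (component X j \o param c) z0)
    (partial b (partial b (component X j \o param c)) z0).
  have := jet2D (C2_jet2 (C2_component XC j Sc) b zW) (jet2_cst (- X p0 0 j)).
  by rewrite !addr0.
have q0 b : param c (z0 + step b 0) = q by rewrite step0 addr0 /z0 (coordK Sc cq).
have e0' j : x j (param c (z0 + step true 0)) = x j (param c (z0 + step false 0)).
  by rewrite !q0.
have fE0 := f0_le Mq (ltW rq); have fq : 0 < f q by rewrite (lt_le_trans f0_gt0).
have fq' : 0 < f (param c (z0 + step false 0)) by rewrite q0.
have lq' : 0 <= ln (f (param c (z0 + step false 0))) - ln f0.
  by rewrite q0; exact: log_ge0 Mq (ltW rq).
have [A [B1 [A' [B1' [jA jA' neg]]]]] := log_log_superharmonic
  (jx 0 false) (jx 1 false) (jx 2 false) (jx 0 true) (jx 1 true) (jx 2 true)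
  (e0' 0) (e0' 1) (e0' 2) (harmX 0 Sc Oq cq) (harmX 1 Sc Oq cq) (harmX 2 Sc Oq cq)
  la0 erefl (esym hG) hF fq' lq'.
have [a [b [a' [b' [j1 j2 E]]]]] := harmF Sc Oq cq.
have mz b1 : \forall t \near (0 : R), F (param c (z0 + step b1 t)) - e * phi (param c (z0 + step b1 t)) <=
   F (param c (z0 + step b1 0)) - e * phi (param c (z0 + step b1 0)).
  have := near_step b1 (param_nbhs Sc cq mx); apply: filterS => t /=.
  by rewrite q0.
have l1 := jet2_local_max (jet2D j1 (jet2Z (- e) jA)).
have l2 := jet2_local_max (jet2D j2 (jet2Z (- e) jA')).
have {}l1 : b + - e * B1 <= 0.
  by apply: l1; apply: filterS (mz false) => t; rewrite -!mulNr.
have {}l2 : b' + - e * B1' <= 0.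
  by apply: l2; apply: filterS (mz true) => t; rewrite -!mulNr.
have : 0 < e * - (B1 + B1') by rewrite mulr_gt0// oppr_gt0.
lra.
Qed.

(** A nonnegative bound of [F] near the centre is a bound of [F] everywhere:
    [F - e phi] is negative at infinity and has no interior maximum beyond the
    radius [r]. *)
Let far_bound (sg : R) q : 0 <= sg -> (forall p, M p -> rad p <= r -> F p <= sg) ->
  M q -> r <= rad q -> F q <= sg.
Proof.
move=> sg0 near_bd Mq rq; rewrite leNgt; apply/negP => big.
have phq := phi_ge0 Mq rq.
pose e := (F q - sg) / (2 * (phi q + 1)).
have ph1 : 0 < 2 * (phi q + 1) by rewrite mulr_gt0// ltr_wpDl.
have e0 : 0 < e by rewrite divr_gt0// subr_gt0.
have Gq : sg < F q - e * phi q.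
  have : e * (2 * (phi q + 1)) = F q - sg by rewrite /e divfK// gt_eqF.
  have := mulr_ge0 (ltW e0) phq; lra.
(* [phi] exceeds [`|B| / e] beyond the radius [rho0] *)
pose H := `|B| / e; pose rho0 := expR (expR H - 1 + ln f0) / (eps * r).
have er : 0 < eps * r by rewrite mulr_gt0.
have out p : M p -> r <= rad p -> rho0 <= rad p -> F p - e * phi p <= sg.
  move=> Mp rp bigp.
  have fp : expR (expR H - 1 + ln f0) <= f p.
    by rewrite (le_trans _ (f_ge Mp rp))// mulrC -ler_pdivrMr.
  have lp : expR H - 1 + ln f0 <= ln (f p).
    by rewrite -(expRK (expR H - 1 + ln f0)) ler_ln// posrE ?expR_gt0// (lt_le_trans _ fp)// expR_gt0.
  have Hp : H <= phi p.
    rewrite -(expRK H) /phi ler_ln ?posrE ?expR_gt0//; first by lra.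
    by rewrite ltr_pwDl// log_ge0.
  have : `|B| <= e * phi p by rewrite mulrC -ler_pdivrMr.
  have := ler_norm (F p); have := FB Mp; have := ler_norm B; lra.
pose rho := Num.max rho0 (rad q).
have [rho_0 rhoq] : rho0 <= rho /\ rad q <= rho by rewrite /rho !le_max !lexx orbT.
pose K := (M `&` [set p | rad p <= rho]) `&` [set p | - rad p <= - r].
have KP p : K p <-> [/\ M p, rad p <= rho & r <= rad p].
  by split=> [[[h1 h2] h3]|[h1 h2 h3]]; do ?split; rewrite //= ?lerN2//; move: h3; rewrite /= lerN2.
have cK : compact K.
  apply: compact_sublevel; first exact: disc_compact.
  apply: within_continuous_of_continuous => p [Mp _].
  exact (opp_continuous_at (@rad_cont p Mp)).
have cG : {within K, continuous (fun p => F p - e * phi p)}.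
  apply/within_continuousP => p Kp d d0; have /KP[Mp _ rp] := Kp.
  have d2 : 0 < d / 2 by rewrite divr_gt0.
  have d3 : 0 < d / 2 / e by rewrite divr_gt0.
  have h1 := proj1 (within_continuousP M F) cF p Mp _ d2.
  have h2 := continuous_dist (phi_cont Mp rp) d3.
  apply: filterS (filterI h1 h2) => p' [k1 k2] /KP[Mp' _ _].
  have {}k1 := k1 Mp'; rewrite ltr_pdivlMr// in k2.
  have -> : F p' - e * phi p' - (F p - e * phi p) = (F p' - F p) - (phi p' - phi p) * e by ring.
  rewrite (le_lt_trans (ler_normB _ _))// normrM (gtr0_norm e0).
  by rewrite [ltRHS]splitr ltrD.
have Kq : K q by apply/KP.
have [qm] := compact_EVT_max (ex_intro _ q Kq) cK cG; rewrite inE => Kqm qmax.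
have {}qmax p : K p -> F p - e * phi p <= F qm - e * phi qm.
  by move=> Kp; apply: qmax; rewrite inE.
have /KP[Mm rm1 rm2] := Kqm.
have Gm : sg < F qm - e * phi qm := lt_le_trans Gq (qmax q Kq).
have phm := mulr_ge0 (ltW e0) (phi_ge0 Mm rm2).
have Fm : sg < F qm by lra.
have rm3 : rad qm < rho.
  rewrite ltNge; apply/negP => h.
  by have := out qm Mm rm2 (le_trans rho_0 h); rewrite leNgt Gm.
have rm4 : r < rad qm.
  rewrite ltNge; apply/negP => h.
  by have := near_bd qm Mm h; rewrite leNgt Fm.
have Om : O qm.
  by apply: contrapT => nO; move: Fm; rewrite (F0 Mm nO) ltNge sg0.
apply: (no_interior_max e0 Om rm4).
have m0 : 0 < Num.min (rad qm - r) (rho - rad qm) by rewrite lt_min !subr_gt0 rm4.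
have nO := open_nbhs_nbhs (conj oO Om).
apply: filterS (filterI nO (continuous_dist (@rad_cont qm Mm) m0)) => p [Op].
rewrite lt_min ltr_norml => /andP[/andP[h1 _]]; rewrite ltr_norml => /andP[_ h2].
by apply: qmax; apply/KP; split; [exact: OM|lra|lra].
Qed.

(** The strong maximum principle: the set where an interior maximum is attained
    is open. *)
Let max_open (s : R) q : (forall p, M p -> F p <= s) -> O q -> F q = s ->
  \forall p \near q, F p = s.
Proof.
move=> Fs Oq Fq; have [c Sc cq] := atlas_cover S q; set z0 := coord c q.
have zW := chart_nbhs Sc oO Oq cq.
have /nearCP[e e0 He] := zW.
have rho0 : 0 < e / 2 by rewrite divr_gt0.
pose u := F \o param c.
have WH z : (coord c @` (cdom c `&` O)) z ->
    [/\ harmonic_jet u z, {for z, continuous u} & u z <= s].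
  move=> [p [cp Op] <-]; split; first exact: harmF.
    apply/(@cvgrPdist_lt _ _ _ (nbhs (coord c p))) => d d0.
    have h := proj1 (within_continuousP M F) cF p (OM Op) d d0.
    have hO := open_nbhs_nbhs (conj oO Op).
    have h' : nbhs p [set p' | `|F p - F p'| < d].
      apply: filterS (filterI h hO) => p' [h1 Op'] /=.
      by rewrite distrC; apply: h1; exact: OM.
    by have := param_nbhs Sc cp h'; rewrite /u /= (coordK Sc cp).
  by rewrite /u /= (coordK Sc cp); apply: Fs; exact: OM.
have sqn : nbhs z0 [set w : Cplx R | `|complex.Re w - complex.Re z0| < e / 4 /\
    `|complex.Im w - complex.Im z0| < e / 4].
  by apply/nearCP; exists (e / 4); rewrite ?divr_gt0.
apply: filterS (coord_nbhs Sc cq sqn) => p [cp [pR pI]].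
have zz0 : sqdist (coord c p) z0 < (e / 2) ^+ 2.
  have sq (a b : R) : `|a - b| < e / 4 -> (b - a) * (b - a) < (e / 4) ^+ 2.
    move=> h; rewrite -expr2 -(real_normK (num_real (b - a))) distrC.
    by rewrite ltr_pXn2r// nnegrE// divr_ge0// ltW.
  have := sq _ _ pR; have := sq _ _ pI; have := sqr_ge0 e.
  rewrite /sqdist !expr_div_n; move: (e ^+ 2) => e2; lra.
have Hin z : sqdist (coord c p) z <= (e / 2) ^+ 2 -> (coord c @` (cdom c `&` O)) z.
  have conv (a b : R) : a * a + b * b <= (e / 2) ^+ 2 -> `|a| <= e / 2.
    move=> h; rewrite -(@ler_pXn2r _ 2)// ?nnegrE ?(ltW rho0)//.
    by rewrite real_normK ?num_real// (le_trans _ h)// expr2 lerDl -expr2 sqr_ge0.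
  move=> h; have hR := conv _ _ h; rewrite /sqdist addrC in h; have hI := conv _ _ h.
  apply: He.
    by have := ler_distD (complex.Re (coord c p)) (complex.Re z) (complex.Re z0); lra.
  by have := ler_distD (complex.Im (coord c p)) (complex.Im z) (complex.Im z0); lra.
have Wp : (coord c @` (cdom c `&` O)) (coord c p).
  by apply: Hin; rewrite /sqdist !subrr mul0r addr0 sqr_ge0.
have [_ _ up] := WH _ Wp.
have uE q' : cdom c q' -> u (coord c q') = F q' by move=> cq'; rewrite /u /= (coordK Sc cq').
apply/eqP; rewrite eq_le -{1}uE// up leNgt; apply/negP => Fp.
have us : u (coord c p) < s by rewrite uE.
have := harmonic_disc_lt rho0 (fun z hz => WH z (Hin z hz)) us zz0.
by rewrite uE// Fq ltxx.
Qed.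

(** A positive supremum of [F] would be attained, by [far_bound], at an interior
    point at distance at most [r] from the centre; [F] would then be constant,
    although it vanishes at some point. *)
Lemma bounded_harmonic_le0 q : M q -> F q <= 0.
Proof.
move=> Mq; rewrite leNgt; apply/negP => Fq.
have Mp0 := OM Op0.
pose K := M `&` [set p | rad p <= r].
have K0 : K p0.
  split => //=; rewrite /rad /radius /x !subrr expr0n addr0 sqrtr0; exact: ltW.
have cK : compact K by exact: disc_compact.
have cFK : {within K, continuous F} by apply: continuous_subspaceW cF => p [].
have [pm] := compact_EVT_max (ex_intro _ p0 K0) cK cFK; rewrite inE => -[Mm rm] pmax.
have near_le p : M p -> rad p <= r -> F p <= F pm.
  by move=> Mp rp; apply: pmax; rewrite inE.
have all_le p : M p -> F p <= Num.max 0 (F pm).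
  move=> Mp; have [h|/ltW h] := leP (rad p) r.
    by rewrite le_max near_le// orbT.
  apply: far_bound => //; first by rewrite le_max lexx.
  by move=> p' Mp' rp'; rewrite le_max near_le// orbT.
have pm0 : 0 < F pm.
  have := lt_le_trans Fq (all_le q Mq); rewrite lt_max ltxx.
  by case/orP.
have {}all_le p : M p -> F p <= F pm.
  by move=> /all_le; rewrite max_r// ltW.
pose A := [set p | M p /\ F p = F pm].
have AO p : A p -> O p.
  move=> [Mp Fp]; apply: contrapT => nO; move: pm0.
  by rewrite -Fp (F0 Mp nO) ltxx.
have oA : open A.
  rewrite openE => p Ap; have Op := AO p Ap; have [Mp Fp] := Ap.
  have h := max_open all_le Op Fp; have hO := open_nbhs_nbhs (conj oO Op).
  by apply: filterS (filterI h hO) => p' [h1 /OM].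
have AM : A = M.
  apply: connM; first by exists pm.
  - by exists A => //; apply/seteqP; split=> [p [Mp Fp]|p [_]].
  - exists (closure A); first exact: closed_closure.
    apply/seteqP; split=> [p Ap|p [Mp clp]].
      by split; [case: Ap|exact: subset_closure].
    split => //; apply/eqP; rewrite -subr_eq0 -normr_le0; apply/ler_addgt0Pr => d d0.
    have [p' [[Mp' Fp'] h]] := clp _ (proj1 (within_continuousP M F) cF p Mp d d0).
    by rewrite add0r -Fp' distrC ltW// h.
have [b Mb nOb] := bd.
by apply: nOb; apply: AO; rewrite AM.
Qed.

End BoundedHarmonic.

Theorem theorem3p2 (R : realType) (T : topologicalType)
    (S : riemann_surface R T) (M dM : set T)
    (X : T -> 'rV[R]_3) (p0 : T) (Omega : set (Cplx R)) :
  ~ compact [set: T] ->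
  surface_with_boundary S M dM ->
  dM !=set0 ->
  conformal_maximal_immersion S M dM X ->
  proper_on M X ->
  (M `\` dM) p0 ->
  closed Omega ->
  starlike (pi0 (X p0)) Omega ->
  graph_over (X @` M) Omega ->
  relative_parabolic S M dM.
Proof.
move=> _ [connM dMM dME _] [b dMb] [[U [oU MU XC XU]] spO _ [Uw [oUw MUw weier]]]
  properM Op0 _ starO graphO.
pose O := M `\` dM.
have OM : O `<=` M by move=> p [].
have oO : open O.
  rewrite openE => p Op; apply: contrapT => nint; case: (Op) => _; apply.
  by rewrite dME; split => //; apply: subset_closure.
have clO : M `<=` closure O.
  move=> p Mp; have [dp|ndp] := pselect (dM p).
    by rewrite dME in dp; case: dp.
  by apply: subset_closure.
have OU : O `<=` U by move=> p /OM /MU.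
(* the coordinates are harmonic: their gradients extend to meromorphic forms *)
have harmX j c : atlas S c -> forall p, O p -> cdom c p ->
    partial false (partial false (component X j \o param c)) (coord c p) +
    partial true (partial true (component X j \o param c)) (coord c p) = 0.
  move=> Sc p Op cp; have [om [[mer _] omE]] := weier j.
  have zW := chart_nbhs Sc oO Op cp.
  apply: (meromorphic_gradient_harmonic _ zW (mer c Sc p (MUw _ (OM _ Op)) cp)).
    move=> _ [p' [cp' Op'] <-]; apply: (XC j 2%N c Sc); exists p' => //.
    by split => //; exact: OU.
  by move=> _ [p' [cp' Op'] <-]; rewrite omE.
have [r [eps [r0 eps0 near_cone far_cone]]] :=
  immersion_cone_estimate oU XC XU oO OM MU clO spO properM Op0 starO graphO.
move=> F cF [FC FL] [B FB] F0.
have nO p : M p -> ~ O p -> dM p.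
  by move=> Mp nOp; apply: contrapT => ndp; apply: nOp.
have bdry : exists2 p, M p & ~ O p by exists b; [exact: dMM|case].
have harmF c : atlas S c -> forall p, O p -> cdom c p ->
    harmonic_jet (F \o param c) (coord c p).
  move=> Sc p Op cp; have zW := chart_nbhs Sc oO Op cp.
  by do 4 eexists; split;
    [exact: (C2_jet2 (FC c Sc) false zW)|exact: (C2_jet2 (FC c Sc) true zW)|exact: FL].
(* the conclusion for [F] and for [- F] *)
have le0 (G : T -> R) : {within M, continuous G} ->
    (forall c, atlas S c -> forall p, O p -> cdom c p ->
       harmonic_jet (G \o param c) (coord c p)) ->
    (forall p, M p -> `|G p| <= B) -> (forall p, M p -> ~ O p -> G p = 0) ->
    forall p, M p -> G p <= 0.
  move=> cG hG GB G0.
  exact: (bounded_harmonic_le0 oU XC XU oO OM MU spO harmX properM Op0 connM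
    r0 eps0 near_cone far_cone cG hG GB G0 bdry).
move=> p Mp; apply/eqP; rewrite eq_le; apply/andP; split.
  by apply: le0 Mp => // q Mq /(nO q Mq); exact: F0.
rewrite -oppr_le0; apply: (le0 (fun q => - F q)) Mp => //.
- by move=> q; apply: cvgN; exact: cF.
- by move=> c Sc q Oq cq; exact: harmonic_jetN (harmF c Sc q Oq cq).
- by move=> q Mq; rewrite normrN; exact: FB.
- by move=> q Mq /(nO q Mq) dq; rewrite (F0 q dq) oppr0.
Qed.
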